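(* Let $s\in(0,1)$, $\varepsilon=1$ and $p>1$. 1. If $p\ge \frac{N}{N-2s}$, then $\mathcal E_1=\{0\}$. 2. If $1<p\le 1+\frac{2s}{N}$, then $\mathcal E_1^+=\{0\}$. 3. If $1+\frac{2s}{N}<p<\frac{N}{N-2s}$, then $\mathcal E_1^+=\{0,\omega_1\}$, where $\omega_1$ is a positive solution of $$\mathcal A_s[\omega]+\Lambda_{s,p,N}\,\omega=0\ \text{ in }\mathbb S^N_+,\qquad \frac{\partial\omega}{\partial\nu^s}+|\omega|^{p-1}\omega=0\ \text{ on }\mathbb S^{N-1}.$$
   Context: $N$ is a positive integer with $N>2s$. The half sphere is $\mathbb S^N_+=\{(\sigma'\cos\phi,\sin\phi):\sigma'\in\mathbb S^{N-1},\ \phi\in(0,\frac\pi2]\}\subset\mathbb R^{N+1}$, and its boundary $\{\phi=0\}$ is identified with $\mathbb S^{N-1}$. In the coordinates $(\sigma',\phi)$, $$\mathcal A_s[w]=\frac{1}{\lambda_s(\phi)(\cos\phi)^{N-1}}\big(\lambda_s(\phi)(\cos\phi)^{N-1}w_\phi\big)_\phi+\frac1{\cos^2\phi}\Delta_{\mathbb S^{N-1}}w,\qquad \lambda_s(\phi)=(\sin\phi)^{1-2s},$$ $$\frac{\partial w}{\partial\nu^s}(\sigma')=-\lim_{\phi\to0}(\sin\phi)^{1-2s}w_\phi(\sigma',\phi),\qquad \Lambda_{s,p,N}=\frac{2s}{p-1}\Big(\frac{2s}{p-1}+2s-N\Big).$$ For $\varepsilon=\pm1$, $\mathcal E_\varepsilon$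 is the set of functions $\omega\in C(\overline{\mathbb S^N_+})\cap C^2(\mathbb S^N_+)$ satisfying $\mathcal A_s[\omega]+\Lambda_{s,p,N}\omega=0$ in $\mathbb S^N_+$ and $\frac{\partial\omega}{\partial\nu^s}+\varepsilon|\omega|^{p-1}\omega=0$ on $\mathbb S^{N-1}$; $\mathcal E_\varepsilon^+$ is the set of its nonnegative elements. *)

(* Defs.v *)
From HB Require Import structures.
From mathcomp Require Import all_boot all_order all_algebra.
From mathcomp Require Import all_classical all_reals all_analysis.
Set Implicit Arguments.
Unset Strict Implicit.
Unset Printing Implicit Defensive.
Import Order.TTheory GRing.Theory Num.Theory numFieldNormedType.Exports.
Local Open Scope classical_set_scope.
Local Open Scope ring_scope.

Section calculus.
Context {R : realType} {n : nat}.
Implicit Types (f : 'rV[R]_n -> R) (x : 'rV[R]_n).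

(* The library norm on 'rV[R]_n is the sup norm (same topology). *)
Definition enorm x : R := Num.sqrt (\sum_(i < n) x 0 i ^+ 2).

Definition partial (i : 'I_n) f : 'rV[R]_n -> R := 'D_(delta_mx 0 i) f.

(* Meaningful for open U only. *)
Definition C1_on (U : set 'rV[R]_n) f : Prop := forall i x, U x ->
  derivable f x (delta_mx 0 i) /\ {for x, continuous (partial i f)}.

Definition C2_on (U : set 'rV[R]_n) f : Prop :=
  C1_on U f /\ forall i, C1_on U (partial i f).

Definition laplacian f x : R := \sum_(i < n) partial i (partial i f) x.

Definition usphere : set 'rV[R]_n := [set x | enorm x = 1].

Definition radial_proj x : 'rV[R]_n := (enorm x)^-1 *: x.

(* A function on an open part O of the unit sphere is C^2 iff its extension,
   homogeneous of degree 0, is C^2 on the open cone spanned by O. *)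
Definition C2_on_sphere (O : set 'rV[R]_n) f : Prop :=
  C2_on [set x | O (radial_proj x)] (f \o radial_proj).

(* The Laplace-Beltrami operator of the unit sphere of R^n is the restriction
   to the sphere of the Euclidean Laplacian of the extension homogeneous of
   degree 0.  For n = 1 the sphere is {-1, 1} and this operator is 0. *)
Definition sphere_laplacian f x : R := laplacian (f \o radial_proj) x.

End calculus.

Section half_sphere.
Context {R : realType} {N : nat}.
Implicit Types (w : 'rV[R]_(N + 1) -> R) (sigma : 'rV[R]_N) (phi : R).

Definition hs_point sigma phi : 'rV[R]_(N + 1) :=
  row_mx (cos phi *: sigma) (sin phi)%:M.

Definition half_sphere : set 'rV[R]_(N + 1) :=
  [set hs_point sigma phi | sigma in usphere & phi in `]0, pi / 2]].

Definition lambda_s (s phi : R) : R := sin phi `^ (1 - 2 * s).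

Definition d_phi w sigma phi : R := derive1 (fun t : R => w (hs_point sigma t)) phi.

Definition As_coord (s : R) w sigma phi : R :=
  derive1 (fun t : R => lambda_s s t * cos t ^+ N.-1 * d_phi w sigma t) phi
    / (lambda_s s phi * cos phi ^+ N.-1)
  + sphere_laplacian (fun sigma' => w (hs_point sigma' phi)) sigma
    / cos phi ^+ 2.

(* The coordinates degenerate at the north pole phi = pi / 2, where cos
   vanishes; there the operator is defined by its continuous extension. *)
Definition As (s : R) w sigma phi : R :=
  if phi < pi / 2 then As_coord s w sigma phi
  else lim (As_coord s w sigma t @[t --> (pi / 2)^'-]).

(* sigma stands for the boundary point hs_point sigma 0. *)
Definition conormal_quot (s : R) w sigma phi : R :=
  sin phi `^ (1 - 2 * s) * d_phi w sigma phi.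

Definition has_conormal (s : R) w sigma : Prop :=
  cvg (conormal_quot s w sigma t @[t --> 0^'+]).

Definition conormal (s : R) w sigma : R :=
  - lim (conormal_quot s w sigma t @[t --> 0^'+]).

Definition Lambda (s p : R) : R :=
  2 * s / (p - 1) * (2 * s / (p - 1) + 2 * s - N%:R).

(* Elements are total functions on R^(N+1), but every condition depends only
   on their values on the closed half sphere; accordingly they are to be
   compared with =1 on closure half_sphere. *)
Definition EE (s p eps : R) : set ('rV[R]_(N + 1) -> R) :=
  [set w | [/\ {within closure half_sphere, continuous w},
    C2_on_sphere half_sphere w,
    (forall sigma phi, usphere sigma -> 0 < phi <= pi / 2 ->
       As s w sigma phi + Lambda s p * w (hs_point sigma phi) = 0) &
    (forall sigma, usphere sigma -> has_conormal s w sigma /\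
       conormal s w sigma + eps * (`|w (hs_point sigma 0)| `^ (p - 1)
                                   * w (hs_point sigma 0)) = 0)]].

Definition EEplus (s p eps : R) : set ('rV[R]_(N + 1) -> R) :=
  [set w | EE s p eps w /\ forall x, closure half_sphere x -> 0 <= w x].

End half_sphere.

(* Main.v *)
(* Extended to be homogeneous of degree 0, functions on the half sphere turn A_s into the
   operator Delta + (1 - 2s) / z d/dz on the half space z > 0, which obeys the strong minimum
   principle inside and, for supersolutions, a Hopf lemma u >= c (sin phi)^(2s) near the
   boundary.

   If p >= N / (N - 2s) then Lambda <= 0; a positive maximum of a solution would be attained
   on the boundary, where the Neumann condition makes the solution increase inwards.

   If p <= 1 + 2s / N then Lambda >= 2sN, while h = (sin phi)^(2s) satisfies
   A_s h = - 2sN h.  For the largest c with c h <= w, w - c h is a supersolution, so by the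
   Hopf lemma it vanishes; then w = c h vanishes on the boundary but has conormal derivative
   - 2sc, hence c = 0.

   In the remaining range 0 < Lambda < 2sN, and w1 = k G((sin phi)^2), with
   G(t) = 2F1(a, b; N/2; 1 - t), a + b = N/2 - s, a b = - Lambda / 4, is a positive solution for
   the right k.  Any other nonnegative nonzero solution w is positive on the closed half
   sphere; the maximum of w / w1 is attained on the boundary, where the Neumann condition
   forces it to be at most 1, and symmetrically for the minimum. *)

(* The constants have a common origin: on the half space, r^b omega is annihilated by the operator
   exactly when A_s omega + b (b + N - 2s) omega = 0. The exponent b = - 2s / (p - 1) gives Lambda,
   and b = 2s gives 2sN, with z^(2s) as the annihilated function and h as its trace. The obstacle is
   the boundary. Solutions are only continuous there, with exponents 0 and 2s at phi = 0, and the
   drift (1 - 2s) / z is in general singular. Second derivatives are therefore compared at interior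
   points only; at the boundary all information is the limit of (sin phi)^(1 - 2s) w_phi along one
   meridian, whose sign decides whether w grows along it. The pole, where the coordinates
   degenerate, is an ordinary point of the half space; equations reach it by continuity. The series
   of G is centred at the pole, so the boundary t = 0 lies on its circle of convergence. Instead of
   connection formulas, monotone quantities built from the differential equation give the limits of
   G and of t^(1 - s) G' at 0, and their positivity. *)
Require Import Defs.
From HB Require Import structures.
From mathcomp Require Import all_boot all_order all_algebra.
From mathcomp Require Import all_classical all_reals all_analysis.
From mathcomp Require Import ring lra.
Set Implicit Arguments.
Unset Strict Implicit.
Unset Printing Implicit Defensive.
Import Order.TTheory GRing.Theory Num.Theory numFieldNormedType.Exports.
Local Open Scope classical_set_scope.
Local Open Scope ring_scope.

(** * C1 functions *)

Lemma cvg_sumr (R : realType) (I : finType) (T : Type) (F : set_system T)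
    {FF : Filter F} (f : I -> T -> R) (a : I -> R) :
  (forall i, f i x @[x --> F] --> a i) ->
  (\sum_i f i x) @[x --> F] --> \sum_i a i.
Proof. by move=> fa; apply: cvg_big => //; exact: add_continuous. Qed.

(** Both difference quotients are the same function of h. Mostly used at t = 0, to carry
    one-variable rules over to directional derivatives. *)
Lemma is_derive_line (R : realType) (V : normedModType R) (f : V -> R)
    (z v : V) (t d : R) :
  is_derive (t *: v + z) v f d <-> is_derive t 1 (fun s => f (s *: v + z)) d.
Proof.
have E : (fun h : R => h^-1 *: ((f \o shift (t *: v + z)) (h *: v) -
             f (t *: v + z))) =
         (fun h : R => h^-1 *: (((fun s => f (s *: v + z)) \o shift t) (h *: 1) -
             f (t *: v + z))).
  apply/funext => h /=; congr (_ *: (f _ - _)).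
  by rewrite /shift /= addrA -scalerDl [h%:A]mulr1.
split=> -[dv <-]; apply: DeriveDef.
- by move: dv; rewrite /derivable E.
- by rewrite /derive E.
- by move: dv; rewrite /derivable E.
- by rewrite /derive E.
Qed.

(** The mean value theorem applied to the segment between 0 and b; b is a coordinate increment of
    either sign, hence the bounds on absolute values. *)
Lemma mean_value_ineq (R : realType) (g dg : R -> R) (b c e : R) :
  (forall t : R, `|t| <= `|b| -> is_derive t 1 g (dg t)) ->
  (forall t : R, `|t| <= `|b| -> `|dg t - c| <= e) ->
  `|g b - g 0 - c * b| <= e * `|b|.
Proof.
move=> dgE dgc.
have contg : forall u v, `|u| <= `|b| -> `|v| <= `|b| ->
    {within `[u, v], continuous g}.
  move=> u v ub vb; apply: derivable_within_continuous => t.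
  rewrite in_itv/= => /andP[ut tv].
  have [] // := dgE t _.
  rewrite ler_norml; move: ub vb; rewrite !ler_norml; lra.
have [b0|b0|->] := ltgtP b 0; last by rewrite !subrr mulr0 subrr !normr0 mulr0.
- have [/= x||t] := @MVT R g dg b 0 b0.
  + rewrite in_itv/= => /andP[bx x0]; apply: dgE.
    by rewrite (ltr0_norm b0) ltr0_norm// lerN2 ltW.
  + by apply: contg; rewrite ?normr0.
  rewrite in_itv/= => /andP[bt t0] E.
  have -> : g b - g 0 - c * b = (dg t - c) * b by lra.
  rewrite normrM ler_wpM2r//; apply: dgc.
  by rewrite (ltr0_norm b0) ltr0_norm// lerN2 ltW.
- have [/= x||t] := @MVT R g dg 0 b b0.
  + rewrite in_itv/= => /andP[bx x0]; apply: dgE.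
    by rewrite (gtr0_norm b0) gtr0_norm// ltW.
  + by apply: contg; rewrite ?normr0.
  rewrite in_itv/= => /andP[bt t0] E.
  have -> : g b - g 0 - c * b = (dg t - c) * b by lra.
  rewrite normrM ler_wpM2r//; apply: dgc.
  by rewrite (gtr0_norm b0) gtr0_norm// ltW.
Qed.

Section C1_functions.
Context {R : realType} {n : nat}.
Implicit Types (U : set 'rV[R]_n) (f g : 'rV[R]_n -> R).

Lemma coord_le_norm (h : 'rV[R]_n) j : `|h 0 j| <= `|h|.
Proof.
rewrite [X in _ <= X]/Num.Def.normr/= mx_normrE.
exact: (le_bigmax _ (fun ij => `|h ij.1 ij.2|) (0, j)).
Qed.

Lemma norm_le_coord (h : 'rV[R]_n) M : 0 <= M ->
  (forall j, `|h 0 j| <= M) -> `|h| <= M.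
Proof.
move=> M0 hM; rewrite [X in X <= _]/Num.Def.normr/= mx_normrE.
by apply: bigmax_le => // -[i j] _ /=; rewrite ord1.
Qed.

Definition grad_form f (x h : 'rV[R]_n) : R := \sum_j h 0 j * partial j f x.

Lemma grad_form_is_linear f x : linear (grad_form f x).
Proof.
move=> a u v; rewrite /grad_form scaler_sumr -big_split/=; apply: eq_bigr => j _.
by rewrite !mxE mulrDl -mulrA.
Qed.

HB.instance Definition _ f x :=
  GRing.isLinear.Build R 'rV[R]_n R _ (grad_form f x) (grad_form_is_linear f x).

Lemma grad_form_continuous f x : continuous (grad_form f x).
Proof.
move=> h; pose F j (y : 'rV[R]_n) := y 0 j * partial j f x.
apply: (@cvg_sumr _ _ _ (nbhs h) _ F) => j.
by apply: cvgMr_tmp; exact: coord_continuous.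
Qed.

(** The increment is split into one step per coordinate; each step is estimated by
    [mean_value_ineq], and continuity of the partial derivatives makes the errors small. *)
Lemma C1_differentiable U f x : C1_on U f -> nbhs x U -> differentiable f x.
Proof.
move=> CU xU.
have small : forall e, 0 < e -> \forall h \near (0 : 'rV[R]_n),
    `|f (h + x) - f x - grad_form f x h| <= e * `|h|.
  move=> e e0.
  have n0 : 0 < (n.+1%:R : R) by [].
  (* Each of the n steps may cost e' |h|; dividing by n + 1 rather than n covers n = 0. *)
  pose e' := e / n.+1%:R.
  have e'0 : 0 < e' by rewrite divr_gt0.
  have : \forall y \near x, U y /\ forall j, `|partial j f y - partial j f x| <= e'.
    suff Hj j : \forall y \near x, `|partial j f y - partial j f x| <= e'.
      by apply: filterI => //; exact: (filter_forall _ Hj).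
    have [_ /cvgrPdist_le /(_ e' e'0)] := CU j x (nbhs_singleton xU).
    by apply: filterS => y; rewrite distrC.
  move=> /nbhs_ballP[d /= d0 dP].
  apply/nbhs_ballP; exists d => //= h; rewrite -ball_normE/= sub0r normrN => hd.
  (* [tr k] keeps the first k coordinates of h, so consecutive points differ in one coordinate. *)
  pose tr k : 'rV[R]_n := \row_j (if (j < k)%N then h 0 j else 0).
  have trn k (t : R) (j : 'I_n) : `|t| <= `|h 0 j| -> (j = k :> nat) ->
      `|t *: delta_mx 0 j + tr k| <= `|h|.
    move=> th jk; apply: norm_le_coord => // i; rewrite !mxE /= -jk.
    have [->|ij] := eqVneq i j.
      by rewrite ltnn mulr1 addr0 (le_trans th)// coord_le_norm.
    rewrite mulr0 add0r; case: ifP => _; first exact: coord_le_norm.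
    by rewrite normr0.
  have step k : (k <= n)%N ->
     `|f (tr k + x) - f x - \sum_(j < n | (j < k)%N) h 0 j * partial j f x| <= k%:R * (e' * `|h|).
    elim: k => [_|k IH kn].
      rewrite big_pred0// mul0r (_ : tr 0%N = 0) ?add0r ?subrr ?subr0 ?normr0//.
      by apply/rowP => j; rewrite !mxE.
    pose j := Ordinal kn.
    rewrite (bigD1 j)//= (eq_bigl (fun i : 'I_n => (i < k)%N)); last first.
      move=> i; rewrite ltnS leq_eqVlt -(inj_eq val_inj)/=.
      by case: eqVneq => [->|]//=; rewrite ?ltnn ?andbT.
    pose g s := f (s *: delta_mx 0 j + (tr k + x)).
    have gE : f (tr k.+1 + x) = g (h 0 j).
      rewrite /g addrA; congr (f (_ + _)); apply/rowP => i; rewrite !mxE/= ltnS leq_eqVlt.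
      rewrite -(inj_eq val_inj)/=; case: eqVneq => ik /=; last by rewrite mulr0 add0r.
      rewrite ik ltnn addr0 mulr1; congr (h 0 _); exact: val_inj.
    have g0 : f (tr k + x) = g 0 by rewrite /g scale0r add0r.
    have inb s : `|s| <= `|h 0 j| -> ball x d (s *: delta_mx 0 j + (tr k + x)).
      move=> sh; rewrite -ball_normE/= distrC addrA addrK.
      by rewrite (le_lt_trans _ hd)// trn.
    have M : `|g (h 0 j) - g 0 - partial j f x * h 0 j| <= e' * `|h 0 j|.
      apply: (@mean_value_ineq R g
        (fun s => partial j f (s *: delta_mx 0 j + (tr k + x)))) => s sh.
        apply: (is_derive_line f _ _ _ _).1; apply: derivableP.
        by have [/(CU j)[]] := dP _ (inb _ sh).
      by have [_] := dP _ (inb _ sh).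
    have {}IH := IH (ltnW kn).
    have hj : e' * `|h 0 j| <= e' * `|h| by apply: ler_wpM2l; [exact: ltW|exact: coord_le_norm].
    rewrite gE g0 in M IH *.
    rewrite -natr1 mulrDl mul1r.
    apply: le_trans (lerD IH (le_trans M hj)).
    apply: le_trans (ler_normD _ _); rewrite le_eqVlt; apply/orP; left; apply/eqP; congr `|_|.
    ring.
  have := step n (leqnn n).
  rewrite (_ : tr n = h); last by apply/rowP => j; rewrite !mxE ltn_ord.
  under eq_bigl do rewrite ltn_ord.
  move=> H; apply: le_trans H _.
  rewrite mulrA ler_wpM2r// /e' mulrCA ler_piMr ?ltW//.
  by rewrite ltr_pdivrMr// mul1r ltr_nat.
have key : f \o shift x = cst (f x) + grad_form f x +o_ (0 : 'rV[R]_n) id.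
  apply/eqaddoP => e e0; near=> h.
  rewrite [X in `|X|](_ : _ = f (h + x) - f x - grad_form f x h); last first.
    by rewrite !fctE /= opprD addrA.
  by near: h; exact: small.
have dE := diff_unique (@grad_form_continuous f x) key.
apply/diff_locallyP; rewrite dE; split => //.
exact: grad_form_continuous.
Unshelve. all: by end_near. Qed.

Lemma C1_diffE U f x h : C1_on U f -> nbhs x U -> 'd f x h = grad_form f x h.
Proof.
move=> CU xU; have df := C1_differentiable CU xU.
rewrite [h in LHS](row_sum_delta h) linear_sum; apply: eq_bigr => j _ /=.
by rewrite linearZ/= -[RHS]/(_ *: _); congr (_ *: _); rewrite -deriveE.
Qed.

Lemma is_derive_curve U f (c : R -> 'rV[R]_n) (dc : 'I_n -> R) t :
  C1_on U f -> nbhs (c t) U ->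
  (forall j, is_derive t 1 (fun s => c s 0 j) (dc j)) ->
  is_derive t 1 (f \o c) (\sum_j dc j * partial j f (c t)).
Proof.
move=> CU xU dcE.
have dc' : derivable c t 1.
  by apply/derivable_mxP => i j; rewrite ord1; case: (dcE j).
have dc1 : differentiable c t by exact/derivable1_diffP.
have df := C1_differentiable CU xU.
have dfc : differentiable (f \o c) t by exact: differentiable_comp.
apply: DeriveDef; first exact/derivable1_diffP.
rewrite deriveE// diff_comp//= (C1_diffE _ CU xU) -deriveE// derive_mx//.
apply: eq_bigr => j _; rewrite mxE; congr (_ * _).
exact: derive_val.
Qed.

End C1_functions.

Lemma is_derive_comp_dir (R : realType) (V : normedModType R) (f : V -> R)
    (G : R -> R) (x v : V) (d e : R) :
  is_derive x v f d -> is_derive (f x) 1 G e -> is_derive x v (G \o f) (e * d).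
Proof.
move=> df dG; have xE : 0 *: v + x = x by rewrite scale0r add0r.
have {}df : is_derive (0 : R) 1 (fun s => f (s *: v + x)) d.
  by apply: (is_derive_line f _ _ _ _).1; rewrite xE.
rewrite -xE; apply: (is_derive_line (G \o f) _ _ _ _).2.
by apply: (@is_derive1_comp _ G (fun s => f (s *: v + x))) => //; rewrite xE.
Qed.

Lemma partial_val (R : realType) n (f : 'rV[R]_n -> R) i x d :
  is_derive x (delta_mx 0 i) f d -> partial i f x = d.
Proof. by move=> H; exact: derive_val. Qed.

Section C2_closure.
Context {R : realType} {n : nat} (U : set 'rV[R]_n).
Hypothesis Uo : open U.
Implicit Types (f g : 'rV[R]_n -> R).

Lemma C1_on_derive f x i : C1_on U f -> U x ->
  is_derive x (delta_mx 0 i) f (partial i f x).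
Proof. by move=> CU Ux; have [/derivableP] := CU i x Ux. Qed.

Lemma C1_on_continuous f x : C1_on U f -> U x -> {for x, continuous f}.
Proof.
move=> CU Ux; apply: differentiable_continuous; apply: C1_differentiable CU _.
exact: open_nbhs_nbhs.
Qed.

Lemma partial_ext f g i x : (forall y, U y -> f y = g y) -> U x ->
  partial i f x = partial i g x.
Proof.
move=> fg Ux; apply: near_eq_derive; near=> y; apply: fg; near: y.
exact: open_nbhs_nbhs.
Unshelve. all: by end_near. Qed.

(** Since U is open, the candidates [df i] agree with the partial derivatives near each point, and
    continuity transfers. *)
Lemma C1_intro f (df : 'I_n -> 'rV[R]_n -> R) :
  (forall i x, U x -> is_derive x (delta_mx 0 i) f (df i x)) ->
  (forall i x, U x -> {for x, continuous (df i)}) -> C1_on U f.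
Proof.
move=> dfE cdf i x Ux; split; first by case: (dfE i x Ux).
have E y : U y -> partial i f y = df i y.
  by move=> Uy; have := dfE i y Uy => dfi; exact: derive_val.
have H : \forall y \near x, df i y = partial i f y.
  near=> y; rewrite E//; near: y; exact: open_nbhs_nbhs.
have : df i @ x --> partial i f x by rewrite (E x Ux); exact: cdf.
exact: cvg_trans (near_eq_cvg H).
Unshelve. all: by end_near. Qed.

Lemma C1_on_ext f g : (forall y, U y -> f y = g y) -> C1_on U f -> C1_on U g.
Proof.
move=> fg CU; apply: (@C1_intro _ (fun i => partial i f)) => [i x Ux|i x Ux].
  apply: near_eq_is_derive (C1_on_derive i CU Ux); near=> y; apply: fg; near: y.
  exact: open_nbhs_nbhs.
by have [] := CU i x Ux.
Unshelve. all: by end_near. Qed.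

Lemma C2_on_ext f g : (forall y, U y -> f y = g y) -> C2_on U f -> C2_on U g.
Proof.
move=> fg [C1 C2]; split=> [|i]; first exact: C1_on_ext C1.
by apply: C1_on_ext (C2 i) => y Uy; exact: partial_ext.
Qed.

Lemma C1_on_cst (c : R) : C1_on U (cst c).
Proof.
apply: (@C1_intro _ (fun _ => cst 0)) => i x Ux; exact: cst_continuous.
Qed.

Lemma partial_cst (c : R) i (x : 'rV[R]_n) : partial i (cst c) x = 0.
Proof. exact: derive_cst. Qed.

Lemma is_derive_coord (x v : 'rV[R]_n) j :
  is_derive x v (fun y : 'rV[R]_n => y 0 j) (v 0 j).
Proof.
have xE : 0 *: v + x = x by rewrite scale0r add0r.
suff : is_derive (0 *: v + x) v (fun y : 'rV[R]_n => y 0 j) (v 0 j) by rewrite xE.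
apply: (is_derive_line (fun y : 'rV[R]_n => y 0 j) _ _ _ _).2.
rewrite (_ : (fun s => _) = (fun s => s * v 0 j + x 0 j)); last first.
  by apply/funext => s; rewrite !mxE.
by apply: is_derive_eq; rewrite addr0 scaler0 add0r [_%:A]mulr1.
Qed.

Lemma partial_coord i j (x : 'rV[R]_n) :
  partial i (fun y => y 0 j) x = (i == j)%:R.
Proof.
by rewrite /partial; have := is_derive_coord x (delta_mx 0 i) j => H;
  rewrite derive_val mxE eqxx eq_sym.
Qed.

Lemma C2_on_cst (c : R) : C2_on U (cst c).
Proof.
split=> [|i]; first exact: C1_on_cst.
by apply: C1_on_ext (C1_on_cst 0) => y Uy; rewrite partial_cst.
Qed.

Lemma C2_on_coord j : C2_on U (fun y => y 0 j).
Proof.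
split=> [|i].
  apply: (@C1_intro _ (fun i => cst (i == j)%:R)) => [i x Ux|i x Ux].
    by have := is_derive_coord x (delta_mx 0 i) j; rewrite mxE eqxx eq_sym.
  exact: cst_continuous.
apply: C1_on_ext (C1_on_cst (i == j)%:R) => y Uy.
by rewrite partial_coord.
Qed.

Lemma partialD f g i x : C1_on U f -> C1_on U g -> U x ->
  partial i (fun y => f y + g y) x = partial i f x + partial i g x.
Proof. by move=> Cf Cg Ux; apply: deriveD; [case: (Cf i x Ux)|case: (Cg i x Ux)]. Qed.

Lemma partialM f g i x : C1_on U f -> C1_on U g -> U x ->
  partial i (fun y => f y * g y) x = f x * partial i g x + g x * partial i f x.
Proof. by move=> Cf Cg Ux; apply: deriveM; [case: (Cf i x Ux)|case: (Cg i x Ux)]. Qed.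

Lemma C1_onD f g : C1_on U f -> C1_on U g -> C1_on U (fun y => f y + g y).
Proof.
move=> Cf Cg; apply: (@C1_intro _ (fun i x => partial i f x + partial i g x)) => i x Ux.
  exact: is_deriveD (C1_on_derive i Cf Ux) (C1_on_derive i Cg Ux).
by apply: continuousD; [case: (Cf i x Ux)|case: (Cg i x Ux)].
Qed.

Lemma C1_onM f g : C1_on U f -> C1_on U g -> C1_on U (fun y => f y * g y).
Proof.
move=> Cf Cg.
apply: (@C1_intro _ (fun i x => f x * partial i g x + g x * partial i f x)) => i x Ux.
  exact: is_deriveM (C1_on_derive i Cf Ux) (C1_on_derive i Cg Ux).
apply: continuousD; apply: continuousM; [exact: C1_on_continuous Cf Ux|by case: (Cg i x Ux)|
  exact: C1_on_continuous Cg Ux|by case: (Cf i x Ux)].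
Qed.

Lemma C2_onD f g : C2_on U f -> C2_on U g -> C2_on U (fun y => f y + g y).
Proof.
move=> [Cf Cf'] [Cg Cg']; split=> [|i]; first exact: C1_onD.
apply: C1_on_ext (C1_onD (Cf' i) (Cg' i)) => y Uy.
by rewrite partialD.
Qed.

Lemma C2_onM f g : C2_on U f -> C2_on U g -> C2_on U (fun y => f y * g y).
Proof.
move=> [Cf Cf'] [Cg Cg']; split=> [|i]; first exact: C1_onM.
apply: C1_on_ext (C1_onD (C1_onM Cf (Cg' i)) (C1_onM Cg (Cf' i))) => y Uy.
by rewrite partialM.
Qed.

Lemma C2_on_sum (I : Type) (r : seq I) (F : I -> 'rV[R]_n -> R) :
  (forall i, C2_on U (F i)) -> C2_on U (fun y => \sum_(i <- r) F i y).
Proof.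
move=> CF; elim: r => [|i r IH].
  by apply: C2_on_ext (C2_on_cst 0) => y _; rewrite big_nil.
by apply: C2_on_ext (C2_onD (CF i) IH) => y _; rewrite big_cons.
Qed.

Section comp.
Variables (f : 'rV[R]_n -> R) (G dG ddG : R -> R).
Hypothesis GE : forall x, U x -> is_derive (f x) 1 G (dG (f x)).

Lemma C1_on_comp : C1_on U f ->
  (forall x, U x -> {for f x, continuous dG}) -> C1_on U (G \o f).
Proof.
move=> Cf cdG; apply: (@C1_intro _ (fun i x => dG (f x) * partial i f x)) => i x Ux.
  by apply: is_derive_comp_dir; [exact: C1_on_derive|exact: GE].
apply: continuousM; last by case: (Cf i x Ux).
by apply: continuous_comp; [exact: C1_on_continuous Cf Ux|exact: cdG].
Qed.

Lemma partial_comp i x : C1_on U f -> U x ->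
  partial i (G \o f) x = dG (f x) * partial i f x.
Proof.
move=> Cf Ux; have := is_derive_comp_dir (C1_on_derive i Cf Ux) (GE Ux) => H.
exact: derive_val.
Qed.

Hypothesis dGE : forall x, U x -> is_derive (f x) 1 dG (ddG (f x)).

Lemma dG_continuous x : U x -> {for f x, continuous dG}.
Proof.
move=> /dGE[dGx _]; apply: differentiable_continuous; exact/derivable1_diffP.
Qed.

End comp.

Lemma C2_on_comp f (G dG ddG : R -> R) :
  (forall x, U x -> is_derive (f x) 1 G (dG (f x))) ->
  (forall x, U x -> is_derive (f x) 1 dG (ddG (f x))) ->
  (forall x, U x -> {for f x, continuous ddG}) ->
  C2_on U f -> C2_on U (G \o f).
Proof.
move=> GE dGE cddG [Cf Cf']; split=> [|i].
  by apply: C1_on_comp GE Cf _ => x Ux; exact: dG_continuous dGE x Ux.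
have C1 : C1_on U (dG \o f) by exact: C1_on_comp dGE Cf cddG.
apply: C1_on_ext (C1_onM C1 (Cf' i)) => y Uy.
by rewrite (partial_comp GE).
Qed.

End C2_closure.

(** * Geometry of the half sphere *)

Section squared_norm.
Context {R : realType} {n : nat}.
Implicit Types (x : 'rV[R]_n) (U : set 'rV[R]_n).

(** The square of [enorm]: a polynomial, hence smooth at the origin too. *)
Definition sqn x : R := \sum_i x 0 i ^+ 2.

Lemma sqn_ge0 x : 0 <= sqn x.
Proof. by apply: sumr_ge0 => i _; exact: sqr_ge0. Qed.

Lemma enormE x : enorm x = Num.sqrt (sqn x). Proof. by []. Qed.

Lemma usphereE x : usphere x <-> sqn x = 1.
Proof.
rewrite /usphere /= enormE; split=> [E|->]; last exact: sqrtr1.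
by rewrite -[LHS]sqr_sqrtr ?sqn_ge0// E expr1n.
Qed.

Lemma sqnZ a x : sqn (a *: x) = a ^+ 2 * sqn x.
Proof. by rewrite /sqn mulr_sumr; apply: eq_bigr => i _; rewrite mxE exprMn. Qed.

Lemma enormZ a x : 0 <= a -> enorm (a *: x) = a * enorm x.
Proof. by move=> a0; rewrite !enormE sqnZ sqrtrM ?sqr_ge0// sqrtr_sqr ger0_norm. Qed.

Lemma coord_sqr_le x i : x 0 i ^+ 2 <= sqn x.
Proof. by rewrite /sqn (bigD1 i)//= lerDl sumr_ge0// => j _; exact: sqr_ge0. Qed.

Lemma sqn_eq0 x : sqn x = 0 -> x = 0.
Proof.
move=> x0; apply/rowP => i; rewrite mxE; apply/eqP.
by rewrite -sqrf_eq0 eq_le sqr_ge0 andbT -x0 coord_sqr_le.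
Qed.

Lemma C2_on_sqn U : open U -> C2_on U sqn.
Proof.
move=> Uo; rewrite /sqn; apply: (C2_on_sum Uo) => i.
exact: (C2_onM Uo (C2_on_coord Uo i) (C2_on_coord Uo i)).
Qed.

Lemma is_derive_sqn x v : is_derive x v sqn (\sum_i 2 * x 0 i * v 0 i).
Proof.
have -> : sqn = \sum_(i < n) (fun y : 'rV[R]_n => y 0 i ^+ 2).
  by apply/funext => y; rewrite fct_sumE.
apply: is_derive_sum => i.
have := is_deriveX 2 (is_derive_coord x v i).
by rewrite /= expr1.
Qed.

Lemma sqn_continuous : continuous sqn.
Proof.
by move=> x; exact: (C1_on_continuous openT (proj1 (C2_on_sqn openT))).
Qed.

Lemma partial_sqn i x : partial i sqn x = 2 * x 0 i.
Proof.
rewrite /partial; have := is_derive_sqn x (delta_mx 0 i) => H.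
rewrite derive_val (bigD1 i)//= mxE !eqxx mulr1 big1 ?addr0// => j ji.
by rewrite mxE (negbTE ji) andbF mulr0.
Qed.

Lemma enorm_sqn1 x : sqn x = 1 -> enorm x = 1.
Proof. by move=> x1; rewrite enormE x1 sqrtr1. Qed.

Lemma radial_proj_id x : sqn x = 1 -> radial_proj x = x.
Proof. by move=> x1; rewrite /radial_proj enorm_sqn1// invr1 scale1r. Qed.

Lemma enorm_gt0 x : x != 0 -> 0 < enorm x.
Proof.
move=> x0; rewrite enormE sqrtr_gt0 lt_neqAle sqn_ge0 andbT eq_sym.
by apply: contra x0 => /eqP/sqn_eq0 ->.
Qed.

Lemma sqn_radial_proj x : x != 0 -> sqn (radial_proj x) = 1.
Proof.
move=> /enorm_gt0 x0; rewrite sqnZ -[sqn x]sqr_sqrtr ?sqn_ge0// -enormE.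
by rewrite -exprMn mulVf ?gt_eqF// expr1n.
Qed.

Lemma radial_projZ a x : 0 < a -> radial_proj (a *: x) = radial_proj x.
Proof.
move=> a0; rewrite /radial_proj enormZ ?ltW// scalerA invfM mulrAC mulVf ?mul1r//.
by rewrite gt_eqF.
Qed.

Lemma sqn_compact : compact [set x | sqn x = 1].
Proof.
apply: bounded_closed_compact.
  exists 1; split=> // M M1 x /= x1.
  apply: norm_le_coord => [|i]; first by rewrite (le_trans ler01)// ltW.
  rewrite (le_trans _ (ltW M1))// -(@ler_pXn2r _ 2) ?nnegrE//.
  by rewrite expr1n real_normK ?num_real// -x1 coord_sqr_le.
have -> : [set x | sqn x = 1] = sqn @^-1` [set 1] by [].
by apply: preimage_closed; [move=> y _; exact: sqn_continuous|exact: closed_eq].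
Qed.

End squared_norm.

Section half_sphere_geometry.
Context {R : realType} {N : nat}.
Implicit Types (x : 'rV[R]_(N + 1)) (sigma : 'rV[R]_N) (phi : R).

Definition zi : 'I_(N + 1) := rshift N ord0.

Definition upper : set 'rV[R]_(N + 1) := [set x | 0 < x 0 zi].

Lemma upper_open : open upper.
Proof.
have -> : upper = (fun x => x 0 zi) @^-1` [set t | 0 < t] by [].
apply: open_comp; last exact: open_gt.
by move=> y _; exact: coord_continuous.
Qed.

Lemma upper_neq0 x : upper x -> x != 0.
Proof. by apply: contraTneq => ->; rewrite /upper /= mxE ltxx. Qed.

Lemma upperZ a x : 0 < a -> upper x -> upper (a *: x).
Proof. by move=> a0; rewrite /upper /= mxE; exact: mulr_gt0. Qed.

Lemma hs_pointl sigma phi i : hs_point sigma phi 0 (lshift 1 i) = cos phi * sigma 0 i.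
Proof. by rewrite row_mxEl mxE. Qed.

Lemma hs_pointr sigma phi : hs_point sigma phi 0 zi = sin phi.
Proof. by rewrite row_mxEr mxE eqxx mulr1n. Qed.

Lemma sqn_split x : sqn x = \sum_(i < N) x 0 (lshift 1 i) ^+ 2 + x 0 zi ^+ 2.
Proof. by rewrite /sqn big_split_ord/= big_ord1. Qed.

Lemma sqn_hs sigma phi : sqn sigma = 1 -> sqn (hs_point sigma phi) = 1.
Proof.
move=> s1; rewrite sqn_split hs_pointr.
under eq_bigr do rewrite hs_pointl exprMn.
by rewrite -mulr_sumr -/(sqn sigma) s1 mulr1 cos2Dsin2.
Qed.

Lemma hs_upper sigma phi : 0 < phi <= pi / 2 -> upper (hs_point sigma phi).
Proof.
move=> /andP[p0 p1]; rewrite /upper /= hs_pointr sin_gt0_pi// p0/=.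
by apply: le_lt_trans p1 _; have := pi_gt0 R; lra.
Qed.

Hypothesis N0 : (0 < N)%N.

Lemma hs_polar x : sqn x = 1 -> 0 <= x 0 zi ->
  exists sigma phi, [/\ sqn sigma = 1, 0 <= phi <= pi / 2 & x = hs_point sigma phi].
Proof.
move=> x1 z0; set z := x 0 zi in z0.
have z2 : z ^+ 2 <= 1 by rewrite -x1 coord_sqr_le.
have z1 : -1 <= z <= 1 by apply/andP; split; nra.
have sz : sin (asin z) = z by rewrite asinK// in_itv.
have cz : cos (asin z) = Num.sqrt (1 - z ^+ 2) by exact: cos_asin.
have cz2 : cos (asin z) ^+ 2 = 1 - z ^+ 2 by rewrite cz sqr_sqrtr ?subr_ge0.
have phib : 0 <= asin z <= pi / 2.
  rewrite asin_lepi2// andbT leNgt; apply/negP => a0.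
  have : sin (- asin z) > 0.
    rewrite sin_gt0_pihalf// oppr_gt0 a0/= ltrNl lt_neqAle asin_geNpi2// andbT.
    apply/eqP => E; have := sz; rewrite -E sinN sin_pihalf; lra.
  by rewrite sinN sz; lra.
have x'E : \sum_(i < N) x 0 (lshift 1 i) ^+ 2 = 1 - z ^+ 2.
  by rewrite -x1 sqn_split addrK.
(* At the pole any sigma represents x; a basis vector is taken. *)
have [c0|c0] := eqVneq (cos (asin z)) 0.
- exists (delta_mx 0 (Ordinal N0)), (asin z); split=> //.
    rewrite /sqn (bigD1 (Ordinal N0))//= mxE !eqxx expr1n big1 ?addr0// => j jn.
    by rewrite mxE (negbTE jn) andbF expr0n.
  apply/rowP => j; rewrite -(splitK j); case: fintype.splitP => k _.
    rewrite /= hs_pointl c0 mul0r; apply/eqP; rewrite -sqrf_eq0 eq_le sqr_ge0 andbT.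
    have <- : 1 - z ^+ 2 = 0 by rewrite -cz2 c0 expr0n.
    by rewrite -x'E (bigD1 k)//= lerDl sumr_ge0// => ? _; exact: sqr_ge0.
  by rewrite /= ord1 hs_pointr sz.
- exists (\row_i (x 0 (lshift 1 i) / cos (asin z))), (asin z); split=> //.
    rewrite /sqn; under eq_bigr do rewrite mxE exprMn.
    by rewrite -mulr_suml x'E exprVn cz2 divff// -cz2 expf_neq0.
  apply/rowP => j; rewrite -(splitK j); case: fintype.splitP => k _.
    by rewrite /= hs_pointl mxE mulrC divfK.
  by rewrite /= ord1 hs_pointr sz.
Qed.

Lemma half_sphereP x : half_sphere x <-> sqn x = 1 /\ upper x.
Proof.
split=> [[sigma /usphereE s1] [phi]|[x1 ux]].
  by rewrite /= in_itv/= => pb <-; split; [exact: sqn_hs|exact: hs_upper].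
have [sigma [phi [s1 pb E]]] := hs_polar x1 (ltW ux).
exists sigma; first exact/usphereE.
exists phi => //; rewrite /= in_itv/=; case/andP: pb => p0 ->; rewrite andbT.
rewrite lt_neqAle p0 andbT; apply/eqP => p00; move: ux.
by rewrite /upper /= E hs_pointr -p00 sin0 ltxx.
Qed.

(** The open cone over the half sphere, pole included, is the half space; this turns [C2_on_sphere]
    into regularity on [upper]. *)
Lemma upper_radial x : half_sphere (radial_proj x) <-> upper x.
Proof.
split=> [/half_sphereP[x1 ux]|ux].
  have x0 : x != 0.
    apply/eqP => x0; move: ux; rewrite x0 /radial_proj scaler0 /upper /= mxE.
    by rewrite ltxx.
  move: ux; rewrite /upper /= mxE pmulr_rgt0// invr_gt0; exact: enorm_gt0.
apply/half_sphereP; split; first by rewrite sqn_radial_proj// upper_neq0.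
by apply: upperZ => //; rewrite invr_gt0 enorm_gt0// upper_neq0.
Qed.

Lemma radial_upperE : [set x | half_sphere (radial_proj x)] = upper.
Proof. by apply/seteqP; split=> x /=; move/upper_radial. Qed.

Lemma is_derive_hs sigma phi j :
  is_derive phi 1 (fun t => hs_point sigma t 0 j)
    (row_mx (- sin phi *: sigma) (cos phi)%:M 0 j).
Proof.
rewrite -(splitK j); case: fintype.splitP => k _ /=.
  rewrite row_mxEl mxE (_ : (fun t => _) = (fun t => cos t * sigma 0 k)).
    by apply: is_derive_eq; rewrite scaler0 add0r -[LHS]/(_ * _) mulrC.
  by apply/funext => t; rewrite hs_pointl.
rewrite ord1 row_mxEr mxE eqxx mulr1n (_ : (fun t => _) = sin); last first.
  by apply/funext => t; rewrite hs_pointr.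
exact: is_derive_sin.
Qed.

Lemma hs_continuous sigma : continuous (hs_point sigma : R -> 'rV[R]_(N + 1)).
Proof.
move=> phi; apply: differentiable_continuous; apply/derivable1_diffP.
by apply/derivable_mxP => i j; rewrite ord1; case: (is_derive_hs sigma phi j).
Qed.

Lemma closure_hs sigma phi : sqn sigma = 1 -> 0 <= phi <= pi / 2 ->
  closure half_sphere (hs_point sigma phi).
Proof.
move=> s1 /andP[p0 p1]; have [p00|p0'] := eqVneq phi 0; last first.
  apply: subset_closure; exists sigma; first exact/usphereE.
  by exists phi => //=; rewrite in_itv/= p1 lt_neqAle eq_sym p0' p0.
move=> B nB; have := @hs_continuous sigma phi B nB; rewrite p00.
move=> /nbhs_ballP[e /= e0 eB].
have h0 : 0 < pi / 2 :> R by rewrite divr_gt0// pi_gt0.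
pose t := Num.min (e / 2) (pi / 2).
have t0 : 0 < t by rewrite lt_min h0 divr_gt0.
exists (hs_point sigma t); split.
  exists sigma; first exact/usphereE.
  by exists t => //=; rewrite in_itv/= t0 ge_min lexx orbT.
apply: eB; rewrite -ball_normE/= sub0r normrN gtr0_norm//.
by rewrite gt_min; apply/orP; left; lra.
Qed.

Lemma closure_half_sphereP x :
  closure half_sphere x <-> sqn x = 1 /\ 0 <= x 0 zi.
Proof.
split=> [cx|[x1 z0]]; last first.
  by have [sigma [phi [s1 pb ->]]] := hs_polar x1 z0; exact: closure_hs.
have cl : closed ([set x | sqn x = 1] `&` [set x : 'rV[R]_(N + 1) | 0 <= x 0 zi]).
  apply: closedI; first exact: compact_closed (@norm_hausdorff _ _) sqn_compact.
  apply: (@preimage_closed _ _ (fun x : 'rV[R]_(N + 1) => x 0 zi) [set t | 0 <= t]).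
    by move=> y _; exact: coord_continuous.
  exact: closed_ge.
have /closure_id E := cl; suff : closure ([set x | sqn x = 1] `&`
  [set x : 'rV[R]_(N + 1) | 0 <= x 0 zi]) x by rewrite -E => -[].
apply: closureS cx => y /half_sphereP[y1 uy]; split=> //; exact: ltW.
Qed.

Lemma closure_polar x : closure half_sphere x -> exists sigma phi,
  [/\ sqn sigma = 1, 0 <= phi <= pi / 2 & x = hs_point sigma phi].
Proof. by move=> /closure_half_sphereP[]; exact: hs_polar. Qed.

Lemma closure_compact : compact (closure (@half_sphere R N)).
Proof.
apply: subclosed_compact (@closed_closure _ _) (@sqn_compact R (N + 1)) _.
by move=> x /closure_half_sphereP[].
Qed.

Lemma closure_neq0 : closure (@half_sphere R N) !=set0.
Proof.
exists (hs_point (delta_mx 0 (Ordinal N0)) (pi / 2)); apply: closure_hs.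
  rewrite /sqn (bigD1 (Ordinal N0))//= mxE !eqxx expr1n big1 ?addr0// => j jn.
  by rewrite mxE (negbTE jn) andbF expr0n.
by rewrite lexx divr_ge0// pi_ge0.
Qed.

End half_sphere_geometry.

Lemma near_between (R : realType) (a b t : R) : a < t < b ->
  \forall u \near t, a < u < b.
Proof.
by move=> tab; have := @near_in_itvoo R a b t; rewrite in_itv/= => /(_ tab);
  apply: filterS => u; rewrite in_itv.
Qed.

(** Removes the predecessor produced by differentiating a power; for m = 0 both sides vanish. *)
Lemma expr_pred_div (R : realType) m (c : R) : c != 0 ->
  m%:R * c ^+ m.-1 = m%:R * c ^+ m / c.
Proof. by case: m => [|m] c0; rewrite ?mul0r// exprSr mulrA mulfK. Qed.

(** The bracket is W'' plus W' times the logarithmic derivative of the weight, (1 - 2s) cot - m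
    tan. *)
Lemma radial_partE (R : realType) (m : nat) (s : R) (W dW : R -> R) (ddW phi : R) :
  0 < phi < pi / 2 ->
  (forall t : R, 0 < t < pi / 2 -> is_derive t 1 W (dW t)) ->
  is_derive phi 1 dW ddW ->
  is_derive phi 1 (fun t => lambda_s s t * cos t ^+ m * derive1 W t)
    (lambda_s s phi * cos phi ^+ m *
     (ddW + ((1 - 2 * s) * cos phi / sin phi - m%:R * sin phi / cos phi) * dW phi)).
Proof.
move=> pb WE dWE.
have s0 : 0 < sin phi by exact: sin_gt0_pihalf.
have c0 : 0 < cos phi by apply: cos_gt0_pihalf; case/andP: pb => p0 p1; lra.
have H : is_derive phi 1 (fun t => lambda_s s t * cos t ^+ m * dW t)
    (lambda_s s phi * cos phi ^+ m *
     (ddW + ((1 - 2 * s) * cos phi / sin phi - m%:R * sin phi / cos phi) * dW phi)).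
  have lE : is_derive phi 1 (lambda_s s : R -> R)
      ((1 - 2 * s) * (lambda_s s phi / sin phi) * cos phi).
    have := @is_derive1_comp _ (fun a => a `^ (1 - 2 * s)) sin phi _ _
      (is_derive1_powR (1 - 2 * s) s0) (is_derive_sin phi).
    by rewrite powRB ?(gt_eqF s0) ?implybT// powRr1 ?ltW.
  have cE := is_deriveX m (is_derive_cos phi).
  have := is_deriveM (is_deriveM lE cE) dWE.
  rewrite exprfctE /= => H; apply: is_derive_eq H _.
  have := @expr_pred_div R m (cos phi) (lt0r_neq0 c0).
  rewrite /GRing.scale/= !fctE => ->.
  by field; rewrite !gt_eqF.
apply: near_eq_is_derive H; near=> t; congr (_ * _); rewrite derive1E.
have tb : 0 < t < pi / 2 by near: t; exact: near_between.
by have := WE t tb => H'; rewrite derive_val.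
Unshelve. all: by end_near. Qed.

(* On functions homogeneous of degree 0, |x|^2 LE is A_s: see As_coordE.  Locked because
   unification otherwise unfolds the nested directional derivatives. *)
HB.lock Definition LE (R : realType) (N : nat) (s : R) (U : 'rV[R]_(N + 1) -> R)
    (x : 'rV[R]_(N + 1)) : R :=
  laplacian U x + (1 - 2 * s) / x 0 zi * partial zi U x.

Section homogeneous.
Context {R : realType} {N : nat} (U : 'rV[R]_(N + 1) -> R).
Hypothesis N0 : (0 < N)%N.
Hypothesis UZ : forall a x, 0 < a -> U (a *: x) = U x.
Hypothesis CU : C2_on upper U.
Let Uo := @upper_open R N.

Let nbhs_upper (x : 'rV[R]_(N + 1)) : upper x -> nbhs x upper.
Proof. by move=> ux; exact: open_nbhs_nbhs. Qed.

(** Differentiating U(t e_j + a x) = U(t e_j / a + x) in t shows that the partial derivatives are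
    homogeneous of degree -1. *)
Lemma partialZ j a x : 0 < a -> upper x ->
  partial j U (a *: x) = a^-1 * partial j U x.
Proof.
move=> a0 ux.
have dU := C1_on_derive j CU.1 ux.
have dg : is_derive (0 : R) 1 (fun s => U (s *: delta_mx 0 j + x)) (partial j U x).
  by apply: (is_derive_line U _ _ _ _).1; rewrite scale0r add0r.
have dl : is_derive (0 : R) 1 (fun s : R => a^-1 * s) a^-1.
  by apply: is_derive_eq; rewrite [_%:A]mulr1.
have E : (fun s => U (s *: delta_mx 0 j + x)) \o (fun s => a^-1 * s) =
    (fun s => U (s *: delta_mx 0 j + a *: x)).
  apply/funext => s /=; rewrite -[RHS](UZ _ (_ : 0 < a^-1)) ?invr_gt0//.
  by rewrite scalerDr !scalerA mulVf ?scale1r// gt_eqF.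
have : is_derive (0 *: delta_mx 0 j + a *: x) (delta_mx 0 j) U (partial j U x * a^-1).
  apply: (is_derive_line U _ _ _ _).2; rewrite -E.
  by apply: is_derive1_comp; rewrite mulr0.
by rewrite scale0r add0r => H; rewrite /partial derive_val mulrC.
Qed.

Let is_derive_ray (F : 'rV[R]_(N + 1) -> R) x : C1_on upper F -> upper x ->
  is_derive (1 : R) 1 (fun t => F (t *: x)) (\sum_j x 0 j * partial j F x).
Proof.
move=> CF ux.
have -> : \sum_j x 0 j * partial j F x = \sum_j x 0 j * partial j F (1 *: x).
  by rewrite scale1r.
apply: (is_derive_curve (c := fun t => t *: x) CF) => [|j].
  by rewrite scale1r; exact: nbhs_upper.
rewrite (_ : (fun _ => _) = (fun t => t * x 0 j)); last first.
  by apply/funext => t; rewrite mxE.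
by apply: is_derive_eq; rewrite scaler0 add0r [_%:A]mulr1.
Qed.

Lemma Euler1 x : upper x -> \sum_j x 0 j * partial j U x = 0.
Proof.
move=> ux; have H := is_derive_ray CU.1 ux.
have H' : is_derive (1 : R) 1 (fun t => U (t *: x)) 0.
  apply: (@near_eq_is_derive _ _ _ (cst (U x))).
  by near=> t; rewrite UZ//; near: t; exact: lt_nbhsr.
by rewrite -(@derive_val _ _ _ _ _ _ _ H) (@derive_val _ _ _ _ _ _ _ H').
Unshelve. all: by end_near. Qed.

(** Euler's identity for [partial zi U], which has degree -1. *)
Lemma Euler2 x : upper x ->
  \sum_j x 0 j * partial j (partial zi U) x = - partial zi U x.
Proof.
move=> ux; have H := is_derive_ray (CU.2 zi) ux.
have H' : is_derive (1 : R) 1 (fun t => partial zi U (t *: x)) (- partial zi U x).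
  have H2 : is_derive (1 : R) 1 (fun t : R => t^-1 * partial zi U x) (- partial zi U x).
    have d1 := is_deriveV (f := id) (oner_neq0 R) (is_derive_id (1 : R) 1).
    have := is_deriveM d1 (is_derive_cst (partial zi U x) (1 : R) 1).
    move/is_derive_eq; apply; rewrite scaler0 add0r /= expr1n invr1 scaleN1r.
    by rewrite -[LHS]/(_ * _) mulrN1.
  apply: near_eq_is_derive H2; near=> t; rewrite partialZ//.
  by near: t; exact: lt_nbhsr.
by rewrite -(@derive_val _ _ _ _ _ _ _ H) (@derive_val _ _ _ _ _ _ _ H').
Unshelve. all: by end_near. Qed.

Lemma Euler3 x : upper x ->
  \sum_j x 0 j * partial zi (partial j U) x = - partial zi U x.
Proof.
move=> ux.
have H : is_derive x (delta_mx 0 zi) (\sum_j (fun y : 'rV[R]_(N + 1) => y 0 j * partial j U y))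
    (\sum_j (x 0 j * partial zi (partial j U) x + partial j U x * (j == zi)%:R)).
  apply: is_derive_sum => j.
  have := is_deriveM (is_derive_coord x (delta_mx 0 zi) j) (C1_on_derive zi (CU.2 j) ux).
  by rewrite mxE eqxx.
have : 'D_(delta_mx 0 zi) (\sum_j (fun y : 'rV[R]_(N + 1) => y 0 j * partial j U y)) x = 0.
  rewrite -(derive_cst (0 : R) x (delta_mx 0 zi)).
  apply: near_eq_derive; near=> y; rewrite fct_sumE; apply: Euler1.
  by near: y; exact: nbhs_upper.
rewrite derive_val big_split/= [X in _ + X](bigD1 zi)//= eqxx mulr1.
rewrite [X in _ + (_ + X)]big1 => [|j /negbTE->]; last by rewrite mulr0.
by rewrite addr0 => /eqP; rewrite addr_eq0 => /eqP.
Unshelve. all: by end_near. Qed.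

End homogeneous.

(** * The operator in Euclidean coordinates *)

Lemma is_derive_enorm (R : realType) n (y : 'rV[R]_n) i : y != 0 ->
  is_derive y (delta_mx 0 i) enorm (y 0 i / enorm y).
Proof.
move=> y0; have e0 := enorm_gt0 y0.
have s0 : 0 < sqn y by rewrite -sqrtr_gt0.
have ds : is_derive y (delta_mx 0 i) sqn (2 * y 0 i).
  rewrite -(partial_sqn i y).
  exact: C1_on_derive (proj1 (C2_on_sqn (@openT _))) _.
have := is_derive_comp_dir ds (is_derive1_sqrt s0).
by move/is_derive_eq; apply; rewrite -enormE; field; rewrite gt_eqF.
Qed.

Section conversion.
Context {R : realType} {N : nat}.
Hypothesis N0 : (0 < N)%N.
Implicit Types (F U : 'rV[R]_(N + 1) -> R).

(** For c = r cos phi and d = r sin phi, this is a positive multiple of the point of latitude phi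
    above y / |y|. Hence, for U of degree 0, [U \o cone_pt c d] is the extension of degree 0 whose
    Laplacian defines the spherical one. *)
Definition cone_pt (c d : R) (y : 'rV[R]_N) : 'rV[R]_(N + 1) :=
  row_mx (c *: y) (d * enorm y)%:M.

Lemma cone_upper c d y : 0 < d -> y != 0 -> upper (cone_pt c d y).
Proof.
by move=> d0 y0; rewrite /upper /= row_mxEr mxE eqxx mulr1n mulr_gt0// enorm_gt0.
Qed.

Lemma is_derive_cone F c d y i : 0 < d -> y != 0 -> C1_on upper F ->
  is_derive y (delta_mx 0 i) (F \o cone_pt c d)
    (c * partial (lshift 1 i) F (cone_pt c d y)
     + d * (y 0 i / enorm y) * partial zi F (cone_pt c d y)).
Proof.
move=> d0 y0 CF.
have yE : 0 *: delta_mx 0 i + y = y by rewrite scale0r add0r.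
suff : is_derive (0 *: delta_mx 0 i + y) (delta_mx 0 i) (F \o cone_pt c d)
    (c * partial (lshift 1 i) F (cone_pt c d y)
     + d * (y 0 i / enorm y) * partial zi F (cone_pt c d y)) by rewrite yE.
apply: (is_derive_line (F \o cone_pt c d) _ _ _ _).2.
pose cv (t : R) := cone_pt c d (t *: delta_mx 0 i + y).
have cv0 : cv 0 = cone_pt c d y by rewrite /cv yE.
pose dc : 'I_(N + 1) -> R :=
  row_mx (c *: delta_mx 0 i) (d * (y 0 i / enorm y))%:M 0.
have dcE j : is_derive (0 : R) 1 (fun s => cv s 0 j) (dc j).
  rewrite -(splitK j) /dc; case: fintype.splitP => k _ /=.
    rewrite row_mxEl !mxE eqxx /=.
    rewrite (_ : (fun s => _) = (fun s => c * (i == k)%:R * s + c * y 0 k)); last first.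
      apply/funext => s; rewrite /cv /cone_pt row_mxEl !mxE eqxx /= (eq_sym i k); ring.
    by apply: is_derive_eq; rewrite addr0 [_%:A]mulr1 eq_sym.
  rewrite ord1 row_mxEr mxE eqxx mulr1n.
  rewrite (_ : (fun s => _) = (fun s => d * enorm (s *: delta_mx 0 i + y))); last first.
    by apply/funext => s; rewrite /cv /cone_pt row_mxEr mxE eqxx mulr1n.
  have E : is_derive (0 : R) 1 (fun s => enorm (s *: delta_mx 0 i + y)) (y 0 i / enorm y).
    by apply: (is_derive_line enorm _ _ _ _).1; rewrite yE; exact: is_derive_enorm.
  exact: is_deriveZ.
have := is_derive_curve CF _ dcE; rewrite cv0 => /(_ _)/is_derive_eq; apply.
  by apply: open_nbhs_nbhs; split; [exact: upper_open|exact: cone_upper].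
rewrite big_split_ord/= big_ord1 /dc row_mxEr mxE eqxx mulr1n; congr (_ + _).
rewrite (bigD1 i)//= row_mxEl !mxE !eqxx mulr1 big1 ?addr0// => j ji.
by rewrite row_mxEl !mxE (negbTE ji) andbF mulr0 mul0r.
Qed.

(** By homogeneity a meridian may be traded for the vertical line over a sigma, at height a tan t;
    only [partial zi] then enters the derivative in phi. *)
Lemma is_derive_vertical F a sigma t : 0 < a -> 0 < t < pi / 2 -> C1_on upper F ->
  is_derive t 1 (fun t => F (row_mx (a *: sigma) (a * tan t)%:M))
    (a * (cos t) ^- 2 * partial zi F (row_mx (a *: sigma) (a * tan t)%:M)).
Proof.
move=> a0 tb CF; have [t0 t1] := andP tb.
have st : 0 < sin t by exact: sin_gt0_pihalf.
have ct : 0 < cos t by apply: cos_gt0_pihalf; lra.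
pose cv (t : R) : 'rV[R]_(N + 1) := row_mx (a *: sigma) (a * tan t)%:M.
pose dc : 'I_(N + 1) -> R := row_mx 0 (a * (cos t) ^- 2)%:M 0.
have dcE j : is_derive t 1 (fun s => cv s 0 j) (dc j).
  rewrite -(splitK j) /dc; case: fintype.splitP => k _ /=.
    rewrite row_mxEl !mxE.
    rewrite (_ : (fun s => _) = cst (a * sigma 0 k)); first exact: is_derive_cst.
    by apply/funext => s; rewrite /cv row_mxEl !mxE.
  rewrite ord1 row_mxEr mxE eqxx mulr1n.
  rewrite (_ : (fun s => _) = (fun s => a * tan s)); last first.
    by apply/funext => s; rewrite /cv row_mxEr mxE eqxx mulr1n.
  exact: is_deriveZ (is_derive_tan (lt0r_neq0 ct)).
have := is_derive_curve CF _ dcE => /(_ _)/is_derive_eq; apply.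
  apply: open_nbhs_nbhs; split; first exact: upper_open.
  by rewrite /upper /= row_mxEr mxE eqxx mulr1n mulr_gt0// divr_gt0.
rewrite big_split_ord/= big_ord1 /dc row_mxEr mxE eqxx mulr1n.
by rewrite big1 ?add0r// => j _; rewrite row_mxEl mxE mul0r.
Qed.

End conversion.

Lemma neq0_near (R : realType) n (y : 'rV[R]_n) : y != 0 -> \forall x \near y, x != 0.
Proof.
move=> y0; have s0 : 0 < sqn y by rewrite -sqrtr_gt0 -enormE enorm_gt0.
have H : \forall x \near y, 0 < sqn x by exact: sqn_continuous (lt_nbhsr s0).
near=> x; have : 0 < sqn x by near: x.
by apply: contraTneq => ->; rewrite /sqn big1 ?ltxx// => i _; rewrite mxE expr0n.
Unshelve. all: by end_near. Qed.

(** At a unit vector the derivative of y_i / |y| along e_i is 1 - sigma_i^2; the rest is the product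
    rule. *)
Lemma is_derive_tangential (R : realType) n (A B : 'rV[R]_n -> R) (c d A' B' : R)
    (sigma : 'rV[R]_n) i : sqn sigma = 1 ->
  is_derive sigma (delta_mx 0 i) A A' -> is_derive sigma (delta_mx 0 i) B B' ->
  is_derive sigma (delta_mx 0 i)
    (fun y => c * A y + d * (y 0 i / enorm y) * B y)
    (c * A' + d * ((1 - sigma 0 i ^+ 2) * B sigma + sigma 0 i * B')).
Proof.
move=> s1 dA dB; have e1 : enorm sigma = 1 by exact: enorm_sqn1.
have sigma0 : sigma != 0.
  by apply: contra_eq_neq e1 => ->; rewrite enormE /sqn big1 ?sqrtr0 1?eq_sym ?oner_eq0//
    => j _; rewrite mxE expr0n.
have de := is_derive_enorm i sigma0.
have dx := is_derive_coord sigma (delta_mx 0 i) i.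
have e0 : enorm sigma != 0 by rewrite e1 oner_neq0.
have dv : is_derive sigma (delta_mx 0 i) (fun y => (enorm y)^-1)
    (- enorm sigma ^- 2 *: (sigma 0 i / enorm sigma)).
  have [? _] := de.
  by apply: DeriveDef; [exact: derivableV|rewrite deriveV// derive_val].
rewrite e1 expr1n invr1 mulr1 in dv; rewrite mxE !eqxx in dx.
have H := is_deriveD (is_deriveZ c dA)
  (is_deriveM (is_deriveZ d (is_deriveM dx dv)) dB).
apply: is_derive_eq H _.
have -> : (d \*: ((fun y : 'rV[R]_n => y 0 i) * (fun y => (enorm y)^-1))) sigma
    = d * sigma 0 i.
  by rewrite -[LHS]/(d * (sigma 0 i * (enorm sigma)^-1)) e1 invr1 mulr1.
by rewrite e1 invr1 /GRing.scale /=; ring.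
Qed.

(** The two Euler identities eliminate the mixed second derivatives [a2] and [a3], and the sum of 1
    - t_i^2 is n - 1. *)
Lemma tangential_sum (R : realType) n (c d uz uzz : R) (t a1 a2 a3 : 'I_n -> R) :
  (0 < n)%N -> \sum_i t i ^+ 2 = 1 ->
  \sum_i c * t i * a2 i + d * uzz = - uz ->
  \sum_i c * t i * a3 i + d * uzz = - uz ->
  \sum_i (c * (c * a1 i + d * t i * a2 i) +
     d * ((1 - t i ^+ 2) * uz + t i * (c * a3 i + d * t i * uzz))) =
  c ^+ 2 * (\sum_i a1 i) + d * ((n.-1%:R - 2) * uz - d * uzz).
Proof.
move=> n0 t1 E2 E3.
have S2 : \sum_(i < n) (1 - t i ^+ 2) = n.-1%:R.
  rewrite sumrB t1 sumr_const card_ord.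
  by case: (n) n0 => // m _; rewrite -natr1 addrK.
have H2 : \sum_i c * t i * a2 i = - uz - d * uzz by rewrite -E2 addrK.
have H3 : \sum_i c * t i * a3 i = - uz - d * uzz by rewrite -E3 addrK.
transitivity (\sum_i (c ^+ 2 * a1 i + d * ((1 - t i ^+ 2) * uz +
   c * t i * a2 i + c * t i * a3 i + d * uzz * t i ^+ 2))).
  by apply: eq_bigr => i _; ring.
rewrite big_split/= -mulr_sumr; congr (_ + _); rewrite -mulr_sumr; congr (_ * _).
rewrite !big_split/= -mulr_suml -mulr_sumr t1 S2 H2 H3; ring.
Qed.

(** Splitting r^2 / cos^2 as r^2 + r^2 tan^2 lets the tan^2 part of [uzz] cancel the tangential
    contribution; among the [uz] terms only the one with 1 - 2s survives. *)
Lemma As_algebra (R : realType) (n : R) (s r S sp cp uz uzz : R) :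
  cp != 0 -> sp != 0 -> r != 0 -> cp ^+ 2 + sp ^+ 2 = 1 ->
  (r * cp / cp ^+ 2) ^+ 2 * uzz + 2 * (r * cp) * sp / cp ^+ 3 * uz
  + ((1 - 2 * s) * cp / sp - n * sp / cp) * (r * cp / cp ^+ 2 * uz)
  + ((r * cp) ^+ 2 * S + (r * sp) * ((n - 2) * uz - r * sp * uzz)) / cp ^+ 2
  = r ^+ 2 * (S + uzz + (1 - 2 * s) / (r * sp) * uz).
Proof.
move=> c0 s0 r0 cs.
have -> : (r * cp / cp ^+ 2) ^+ 2 * uzz =
    r ^+ 2 * uzz + r ^+ 2 * sp ^+ 2 / cp ^+ 2 * uzz.
  have -> : sp ^+ 2 = 1 - cp ^+ 2 by rewrite -cs addrAC subrr add0r.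
  by field.
by field; rewrite c0 s0 r0.
Qed.

Section As_euclid.
Context {R : realType} {N : nat}.
Hypothesis N0 : (0 < N)%N.
Variables (s : R) (u : 'rV[R]_(N + 1) -> R).
Let U := u \o @radial_proj R (N + 1).
Hypothesis CU : C2_on upper U.

Let UZ a x : 0 < a -> U (a *: x) = U x.
Proof. by move=> a0; rewrite /U /= radial_projZ. Qed.

Lemma extension_hs sigma t : sqn sigma = 1 -> u (hs_point sigma t) = U (hs_point sigma t).
Proof. by move=> s1; rewrite /U /= radial_proj_id// sqn_hs. Qed.

Variables (sigma : 'rV[R]_N) (phi r : R).
Hypotheses (s1 : sqn sigma = 1) (pb : 0 < phi < pi / 2) (r0 : 0 < r).

Let p0 : 0 < phi. Proof. by case/andP: pb. Qed.
Let p1 : phi < pi / 2. Proof. by case/andP: pb. Qed.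
Let sp : 0 < sin phi. Proof. exact: sin_gt0_pihalf. Qed.
Let cp : 0 < cos phi. Proof. by apply: cos_gt0_pihalf; move: p0 p1; lra. Qed.
Let c := r * cos phi.
Let d := r * sin phi.
Let c0 : 0 < c. Proof. exact: mulr_gt0. Qed.
Let d0 : 0 < d. Proof. exact: mulr_gt0. Qed.
Let P := r *: hs_point sigma phi.
Let uP : upper P. Proof. by apply: upperZ => //; apply: hs_upper; rewrite p0 ltW. Qed.
Let sigma0 : sigma != 0.
Proof.
apply/eqP => E; have := s1; rewrite E /sqn big1 => [/eqP|i _].
  by rewrite eq_sym oner_eq0.
by rewrite mxE expr0n.
Qed.

Let PE : cone_pt c d sigma = P.
Proof.
by rewrite /cone_pt enorm_sqn1// mulr1 /P /hs_point scale_row_mx scalerA scale_scalar_mx.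
Qed.

Let vert (t : R) : 'rV[R]_(N + 1) := row_mx (c *: sigma) (c * tan t)%:M.
Let vertE : vert phi = P.
Proof.
rewrite /vert /P /hs_point scale_row_mx scalerA scale_scalar_mx; congr row_mx.
by congr _%:M; rewrite /c /tan; field; rewrite gt_eqF.
Qed.

Let Uz := partial zi U.
Let W (t : R) := u (hs_point sigma t).
Let dW (t : R) := c * (cos t) ^- 2 * Uz (vert t).

Let WE (t : R) : 0 < t < pi / 2 -> is_derive t 1 W (dW t).
Proof.
move=> tb; apply: near_eq_is_derive (is_derive_vertical sigma c0 tb CU.1).
near=> v; have vb : 0 < v < pi / 2 by near: v; exact: near_between.
have cv : 0 < cos v by apply: cos_gt0_pihalf; case/andP: vb => ? ?; lra.
(* Multiplication by c / cos v moves the point of the meridian onto the vertical line. *)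
rewrite /W extension_hs// -[RHS](UZ _ (_ : 0 < c / cos v)) ?divr_gt0//.
congr U; rewrite /hs_point scale_row_mx scalerA scale_scalar_mx.
by congr row_mx; [rewrite divfK// gt_eqF|rewrite /tan mulrA mulrAC].
Unshelve. all: by end_near. Qed.

Lemma derivable_d_phi : derivable (fun t => u (hs_point sigma t)) phi 1.
Proof. by case: (WE pb). Qed.

Let Uzz := partial zi Uz P.

Let dWE : is_derive phi 1 dW
  ((c * (cos phi) ^- 2) ^+ 2 * Uzz + 2 * c * sin phi * (cos phi) ^- 3 * Uz P).
Proof.
have d1 := is_derive_vertical sigma c0 pb (CU.2 zi).
have d2 := is_deriveX 2 (is_derive_cos phi).
have c2 : (cos ^+ 2) phi != 0 by rewrite exprfctE expf_neq0// gt_eqF.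
have d3 := is_deriveV c2 d2.
have d4 := is_deriveZ c d3.
have := is_deriveM d4 d1; rewrite -/(vert _) vertE -/Uz -/Uzz.
move/is_derive_eq; apply; rewrite /GRing.scale /= ?exprfctE ?fctE /=.
by rewrite -[c *: _]/(c * _) expr1; field; rewrite gt_eqF.
Qed.

Let V y := u (hs_point (radial_proj y) phi).

Let VE y : y != 0 -> V y = U (cone_pt c d y).
Proof.
move=> y0; have ey := enorm_gt0 y0.
rewrite /V extension_hs ?sqn_radial_proj// -[LHS](UZ _ (_ : 0 < r * enorm y)) ?mulr_gt0//.
congr U; rewrite /hs_point scale_row_mx !scalerA scale_scalar_mx; congr row_mx.
  by congr (_ *: _); rewrite /c; field; rewrite gt_eqF.
by congr _%:M; rewrite /d mulrAC.
Qed.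

Let V1 i y : y != 0 -> partial i V y =
   c * partial (lshift 1 i) U (cone_pt c d y)
     + d * (y 0 i / enorm y) * partial zi U (cone_pt c d y).
Proof.
move=> y0; have H := is_derive_cone c i d0 y0 CU.1.
have -> : partial i V y = 'D_(delta_mx 0 i) (U \o cone_pt c d) y.
  apply: near_eq_derive; near=> x; apply: VE; near: x; exact: neq0_near.
exact: derive_val.
Unshelve. all: by end_near. Qed.

Let V2 i : partial i (partial i V) sigma =
  c * (c * partial (lshift 1 i) (partial (lshift 1 i) U) P
        + d * sigma 0 i * partial zi (partial (lshift 1 i) U) P)
  + d * ((1 - sigma 0 i ^+ 2) * Uz P
     + sigma 0 i * (c * partial (lshift 1 i) Uz P + d * sigma 0 i * Uzz)).
Proof.
have e1 : enorm sigma = 1 by exact: enorm_sqn1.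
have dA := is_derive_cone c i d0 sigma0 (CU.2 (lshift 1 i)).
have dB := is_derive_cone c i d0 sigma0 (CU.2 zi).
rewrite PE e1 divr1 in dA; rewrite PE e1 divr1 in dB.
have H := is_derive_tangential c d s1 dA dB.
have E : partial i (partial i V) sigma = 'D_(delta_mx 0 i) (fun y =>
    c * (partial (lshift 1 i) U \o cone_pt c d) y +
    d * (y 0 i / enorm y) * (partial zi U \o cone_pt c d) y) sigma.
  by apply: near_eq_derive; near=> x; apply: V1; near: x; exact: neq0_near.
rewrite E (@derive_val _ _ _ _ _ _ _ H).
by rewrite -[(_ \o _) sigma]/(partial zi U (cone_pt c d sigma)) PE.
Unshelve. all: by end_near. Qed.

(** The phi-derivatives are computed on the vertical line through P, the spherical Laplacian on the
    cone through P. The radius r is free, since [LE] lowers the degree of homogeneity by 2. *)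
Lemma As_coordE : As_coord s u sigma phi = r ^+ 2 * LE s U P.
Proof.
have H := @radial_partE _ N.-1 s W dW _ phi pb WE dWE.
have l0 : 0 < lambda_s s phi * cos phi ^+ N.-1.
  by rewrite mulr_gt0 ?powR_gt0// exprn_gt0.
have PlE i : P 0 (lshift 1 i) = c * sigma 0 i by rewrite mxE hs_pointl mulrA.
have PzE : P 0 zi = d by rewrite mxE hs_pointr.
have E2 : \sum_i c * sigma 0 i * partial (lshift 1 i) Uz P + d * Uzz = - Uz P.
  rewrite -(Euler2 UZ CU uP) [RHS]big_split_ord/= big_ord1 PzE; congr (_ + _).
  by apply: eq_bigr => i _; rewrite PlE.
have E3 : \sum_i c * sigma 0 i * partial zi (partial (lshift 1 i) U) P + d * Uzz = - Uz P.
  rewrite -(Euler3 UZ CU uP) [RHS]big_split_ord/= big_ord1 PzE; congr (_ + _).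
  by apply: eq_bigr => i _; rewrite PlE.
have T := @tangential_sum R N c d (Uz P) Uzz (fun i => sigma 0 i)
  (fun i => partial (lshift 1 i) (partial (lshift 1 i) U) P) _ _ N0 s1 E3 E2.
have -> : As_coord s u sigma phi =
    (c * cos phi ^- 2) ^+ 2 * Uzz + 2 * c * sin phi * cos phi ^- 3 * Uz P
    + ((1 - 2 * s) * cos phi / sin phi - N.-1%:R * sin phi / cos phi) * dW phi
    + (\sum_i partial i (partial i V) sigma) / cos phi ^+ 2.
  rewrite /As_coord derive1E (@derive_val _ _ _ _ _ _ _ H); congr (_ + _).
  by rewrite mulrC mulKf// gt_eqF.
under eq_bigr do rewrite V2.
rewrite T LE.unlock /laplacian [in RHS]big_split_ord/= big_ord1 PzE /dW vertE.
by apply: As_algebra; rewrite ?cos2Dsin2// gt_eqF.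
Qed.

End As_euclid.

Lemma sum_lin (R : realType) (I : finType) (a b : R) (f g : I -> R) :
  \sum_i (a * f i + b * g i) = a * (\sum_i f i) + b * (\sum_i g i).
Proof. by rewrite big_split/= !mulr_sumr. Qed.

Section LE_theory.
Context {R : realType} {N : nat}.
Implicit Types (F G : 'rV[R]_(N + 1) -> R) (x : 'rV[R]_(N + 1)).
Let Uo := @upper_open R N.

Let nbhs_upper x : upper x -> nbhs x upper.
Proof. by move=> ux; exact: open_nbhs_nbhs. Qed.

Lemma LE_continuous s F x : C2_on upper F -> upper x -> {for x, continuous (LE s F)}.
Proof.
move=> CF ux; rewrite LE.unlock; apply: continuousD; last first.
  apply: continuousM; last by have [] := CF.1 zi x ux.
  apply: continuousM; first exact: cst_continuous.
  by apply: continuousV; [rewrite gt_eqF|exact: coord_continuous].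
apply: (@cvg_sumr _ _ _ (nbhs x) _ (fun i y => partial i (partial i F) y)) => i.
by have [] := CF.2 i i x ux.
Qed.

Lemma LE_ext s F G x : (forall y, upper y -> F y = G y) -> upper x ->
  LE s F x = LE s G x.
Proof.
move=> FG ux; have E i y : upper y -> partial i F y = partial i G y.
  by move=> uy; exact: (partial_ext Uo i FG uy).
rewrite LE.unlock /laplacian (E zi x ux); apply: (congr1 (fun t => t + _)).
by apply: eq_bigr => i _; exact: (partial_ext Uo i (E i) ux).
Qed.

Lemma C2_on_lin a b F G : C2_on upper F -> C2_on upper G ->
  C2_on upper (fun y => a * F y + b * G y).
Proof.
move=> CF CG; apply: (C2_onD Uo).
  exact: (@C2_onM _ _ _ Uo (cst a) F (C2_on_cst Uo a) CF).
exact: (@C2_onM _ _ _ Uo (cst b) G (C2_on_cst Uo b) CG).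
Qed.

Lemma partial_lin i a b F G x : C1_on upper F -> C1_on upper G -> upper x ->
  partial i (fun y => a * F y + b * G y) x = a * partial i F x + b * partial i G x.
Proof.
move=> CF CG ux.
have H := is_deriveD (is_deriveZ a (C1_on_derive i CF ux))
  (is_deriveZ b (C1_on_derive i CG ux)).
exact: partial_val H.
Qed.

Lemma LE_lin s a b F G x : C2_on upper F -> C2_on upper G -> upper x ->
  LE s (fun y => a * F y + b * G y) x = a * LE s F x + b * LE s G x.
Proof.
move=> CF CG ux.
have E i : partial i (partial i (fun y => a * F y + b * G y)) x =
    a * partial i (partial i F) x + b * partial i (partial i G) x.
  rewrite -(partial_lin _ _ _ (CF.2 i) (CG.2 i) ux).
  apply: (partial_ext Uo i _ ux) => y uy.
  exact: (partial_lin i a b CF.1 CG.1 uy).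
have alg (k A B c d : R) :
  a * A + b * B + k * (a * c + b * d) = a * (A + k * c) + b * (B + k * d) by ring.
rewrite LE.unlock /laplacian (partial_lin zi a b CF.1 CG.1 ux).
have S : \sum_i partial i (partial i (fun y => a * F y + b * G y)) x =
    a * (\sum_i partial i (partial i F) x) + b * (\sum_i partial i (partial i G) x).
  by rewrite -sum_lin; apply: eq_bigr => i _; exact: E.
apply: etrans (alg _ _ _ _ _); apply: (congr1 (fun t => t + _)); exact: S.
Qed.

End LE_theory.

Section eigenfunctions.
Context {R : realType} {N : nat}.
Hypothesis N0 : (0 < N)%N.
Implicit Types (u w : 'rV[R]_(N + 1) -> R).
Let Uo := @upper_open R N.

Lemma extensionZ u a x : 0 < a ->
  (u \o @radial_proj R (N + 1)) (a *: x) = (u \o @radial_proj R (N + 1)) x.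
Proof. by move=> a0 /=; rewrite radial_projZ. Qed.

(* A_s u + mu u = 0 on the half sphere, for the extension of u homogeneous of degree 0. *)
Definition eigen (s mu : R) u := [/\ C2_on (@upper R N) (u \o @radial_proj R (N + 1))
  & forall x : 'rV[R]_(N + 1), upper x -> LE s (u \o @radial_proj R (N + 1)) x +
      mu * (u (radial_proj x) / sqn x) = 0].

Lemma upper_polar (x : 'rV[R]_(N + 1)) : upper x -> exists sigma phi,
  [/\ sqn sigma = 1, 0 < phi <= pi / 2, 0 < enorm x & x = enorm x *: hs_point sigma phi].
Proof.
move=> ux; have x0 := upper_neq0 ux; have e0 := enorm_gt0 x0.
have /(half_sphereP N0)[r1 ur] := (upper_radial N0 x).2 ux.
have [sigma [phi [s1 pb E]]] := hs_polar N0 r1 (ltW ur).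
exists sigma, phi; split=> //.
  case/andP: pb => p0 ->; rewrite andbT lt_neqAle p0 andbT; apply/eqP => p00.
  by move: ur; rewrite /upper /= E hs_pointr -p00 sin0 ltxx.
by rewrite -E scalerA divff ?scale1r// gt_eqF.
Qed.

(** [As_coordE] gives the equation off the polar axis. On the axis it follows by letting t tend to
    pi / 2 from the left along a meridian, the left-hand side being continuous on [upper]. *)
Lemma eigen_coord s mu u : C2_on upper (u \o @radial_proj R (N + 1)) ->
  (forall sigma phi, sqn sigma = 1 -> 0 < phi < pi / 2 ->
     As_coord s u sigma phi + mu * u (hs_point sigma phi) = 0) -> eigen s mu u.
Proof.
set U := u \o _ => CU AE; split=> // x ux.
have [sigma [phi [s1 /andP[p0 p1] e0 xE]]] := upper_polar ux.
set r := enorm x in e0 xE.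
pose q t := r *: hs_point sigma t.
pose G y := LE s U y + mu * (U y * (sqn y)^-1).
have Gq t : 0 < t < pi / 2 -> G (q t) = 0.
  move=> tb; have := AE sigma t s1 tb.
  rewrite (As_coordE N0 s CU s1 tb e0) extension_hs// -/U.
  have Ur : U (q t) = U (hs_point sigma t) by rewrite /U extensionZ.
  rewrite /G Ur /q sqnZ sqn_hs// mulr1 => E.
  have r2 : r ^+ 2 != 0 by rewrite expf_neq0// gt_eqF.
  by apply: (mulfI r2); rewrite mulr0 -E; field; rewrite gt_eqF.
suff : G (q phi) = 0 by rewrite /G /q -xE.
move: p1; rewrite le_eqVlt => /predU1P[pE|p1]; last by apply: Gq; rewrite p0.
have qc : {for phi, continuous q}.
  apply: (@continuous_comp _ _ _ (hs_point sigma) (fun y => r *: y)).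
    exact: hs_continuous.
  exact: scaler_continuous.
have Gc : {for q phi, continuous G}.
  have uq : upper (q phi) by rewrite /q -xE.
  apply: continuousD; first exact: LE_continuous.
  apply: continuousM; first exact: cst_continuous.
  apply: continuousM; first exact: C1_on_continuous CU.1 uq.
  apply: continuousV; last exact: sqn_continuous.
  by rewrite sqnZ sqn_hs// mulr1 expf_neq0// gt_eqF.
have Gqc : (G \o q) t @[t --> phi^'-] --> G (q phi).
  exact: cvg_at_left_filter (continuous_comp qc Gc).
have Gq0 : (G \o q) t @[t --> phi^'-] --> (0 : R).
  have H : \forall t \near phi^'-, cst (0 : R) t = (G \o q) t.
    near=> t; rewrite /= Gq//; apply/andP; split.
      by near: t; exact: nbhs_left_gt.
    by rewrite -pE; near: t; exact: nbhs_left_lt.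
  exact: cvg_trans (near_eq_cvg H) (cvg_cst _).
exact: cvg_unique Gqc Gq0.
Unshelve. all: by end_near. Qed.

Lemma coord_eigen s mu u sigma phi : eigen s mu u -> sqn sigma = 1 ->
  0 < phi < pi / 2 -> As_coord s u sigma phi + mu * u (hs_point sigma phi) = 0.
Proof.
move=> [CU UE] s1 pb.
have pb' : 0 < phi <= pi / 2 by case/andP: pb => -> /ltW.
rewrite (As_coordE N0 s CU s1 pb ltr01) expr1n mul1r scale1r.
have := UE _ (hs_upper sigma pb').
by rewrite radial_proj_id sqn_hs// divr1.
Qed.

(** At the pole [As] is a limit; the equation at lower latitudes identifies it as the limit of - mu
    u, which continuity evaluates. *)
Lemma As_eigen s mu u sigma phi : eigen s mu u -> sqn sigma = 1 ->
  0 < phi <= pi / 2 -> As s u sigma phi + mu * u (hs_point sigma phi) = 0.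
Proof.
move=> uE s1 /andP[p0]; rewrite le_eqVlt => /predU1P[pE|p1]; last first.
  by rewrite /As p1; apply: coord_eigen; rewrite ?p0.
rewrite /As pE ltxx; apply/eqP; rewrite addr_eq0; apply/eqP.
apply: cvg_lim => //.
have H : \forall t \near (pi / 2)^'-, - (mu * u (hs_point sigma t)) = As_coord s u sigma t.
  near=> t; apply/eqP; rewrite eq_sym -addr_eq0 coord_eigen//; apply/andP; split.
    by near: t; apply: nbhs_left_gt; rewrite -pE.
  by near: t; exact: nbhs_left_lt.
apply: cvg_trans (near_eq_cvg H) _; apply: cvg_at_left_filter.
have uh : upper (hs_point sigma (pi / 2)) by apply: hs_upper; rewrite -pE p0 lexx.
have E : (fun t => - (mu * u (hs_point sigma t))) =
    (fun t => - (mu * (u \o @radial_proj R (N + 1)) (hs_point sigma t))).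
  by apply/funext => t; rewrite extension_hs.
rewrite E extension_hs//; apply: cvgN; apply: cvgMl_tmp.
apply: (@continuous_comp _ _ _ (hs_point sigma)); first exact: hs_continuous.
by case: uE => CU _; exact: C1_on_continuous CU.1 uh.
Unshelve. all: by end_near. Qed.

(** Replaces the equation in coordinates, singular at the pole, by one on the whole half space; only
    the boundary condition keeps the coordinates. *)
Lemma EE_iff s p eps w : EE s p eps w <->
  [/\ {within closure half_sphere, continuous w}, eigen s (@Lambda R N s p) w &
    forall sigma, sqn sigma = 1 -> has_conormal s w sigma /\
      conormal s w sigma + eps * (`|w (hs_point sigma 0)| `^ (p - 1)
                                  * w (hs_point sigma 0)) = 0].
Proof.
split=> [[cw C2 AE Bw]|[cw wE Bw]].
  move: C2; rewrite /C2_on_sphere radial_upperE// => C2.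
  split=> // [|sigma s1]; last by apply: Bw; exact/usphereE.
  apply: eigen_coord => // sigma phi s1 /andP[p0 p1].
  have := AE sigma phi; rewrite /As p1 p0 ltW//=; apply=> //; exact/usphereE.
split=> //.
- by rewrite /C2_on_sphere radial_upperE//; case: wE.
- by move=> sigma phi /usphereE s1 pb; exact: As_eigen.
- by move=> sigma /usphereE s1; exact: Bw.
Qed.

Lemma eigen_ext s mu u w : {in closure half_sphere, u =1 w} ->
  eigen s mu u -> eigen s mu w.
Proof.
move=> uw [CU UE].
have E x : upper x -> (u \o @radial_proj R (N + 1)) x = (w \o @radial_proj R (N + 1)) x.
  move=> ux /=; apply: uw; apply/mem_set; apply: subset_closure; exact/upper_radial.
split=> [|x ux]; first exact: (C2_on_ext (@upper_open R N) E CU).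
by rewrite -(LE_ext s E ux) -[w _](E x ux); exact: UE.
Qed.

Lemma conormal_quot_ext s u w sigma : {in closure half_sphere, u =1 w} -> sqn sigma = 1 ->
  \forall t \near (0 : R)^'+, conormal_quot s u sigma t = conormal_quot s w sigma t.
Proof.
move=> uw s1; have h0 : 0 < pi / 2 :> R by rewrite divr_gt0// pi_gt0.
near=> t; have tb : 0 < t < pi / 2.
  by apply/andP; split; near: t; [exact: nbhs_right_gt|exact: nbhs_right_lt].
congr (_ * _); rewrite /d_phi !derive1E; apply: near_eq_derive.
near=> v; have /andP[v0 v1] : 0 < v < pi / 2 by near: v; exact: near_between.
by apply: uw; apply/mem_set; apply: closure_hs => //; rewrite !ltW.
Unshelve. all: by end_near. Qed.

Lemma conormal_cvgP s w sigma l :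
  conormal_quot s w sigma t @[t --> (0 : R)^'+] --> l ->
  has_conormal s w sigma /\ conormal s w sigma = - l.
Proof.
move=> wl; split; first by apply/cvg_ex; exists l.
by rewrite /conormal; congr (- _); exact: cvg_lim.
Qed.

Lemma EE_ext s p eps u w : {in closure half_sphere, u =1 w} ->
  EE s p eps u -> EE s p eps w.
Proof.
move=> uw /EE_iff[cu uE Bu]; apply/EE_iff; split.
- exact: subspace_eq_continuous uw cu.
- exact: eigen_ext uw uE.
move=> sigma s1; have [hu Eu] := Bu sigma s1.
have cw : conormal_quot s w sigma t @[t --> (0 : R)^'+] -->
    lim (conormal_quot s u sigma t @[t --> (0 : R)^'+]).
  by apply: cvg_trans hu; apply: near_eq_cvg; exact: conormal_quot_ext.
have [hw cwE] := conormal_cvgP cw.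
split=> //; rewrite cwE -/(conormal s u sigma) -uw//.
apply/mem_set; apply: closure_hs => //.
by rewrite lexx divr_ge0// pi_ge0.
Qed.

Lemma EE_zero s p eps w : {in closure half_sphere, w =1 cst 0} -> p != 1 -> EE s p eps w.
Proof.
move=> w0 p1; apply: (@EE_ext _ _ _ (cst 0)); first by move=> x /w0.
apply/EE_iff; split.
- exact: cst_continuous.
- split=> [|x ux]; first exact: (C2_on_cst (@upper_open R N) 0).
  rewrite mul0r mulr0 addr0 LE.unlock /laplacian.
  have E i : partial i (cst 0 \o @radial_proj R (N + 1)) = cst 0.
    by apply/funext => y; exact: partial_cst.
  by rewrite big1 => [|i _]; rewrite !E ?partial_cst ?mulr0 ?addr0.
move=> sigma s1.
have H : conormal_quot s (cst 0 : 'rV[R]_(N + 1) -> R) sigma t @[t --> (0 : R)^'+] --> (0 : R).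
  rewrite (_ : conormal_quot _ _ _ = cst 0); first exact: cvg_cst.
  by apply/funext => t; rewrite /conormal_quot /d_phi derive1_cst mulr0.
by have [? ->] := conormal_cvgP H; rewrite /cst oppr0 !mulr0 addr0.
Qed.

End eigenfunctions.

(** * Strong minimum principle *)

(** If l were negative, dg would be negative just to the right of 0, where it vanishes, and the mean
    value theorem would give g b < g 0. *)
Lemma second_derivative_at_min (R : realType) (g dg : R -> R) (l : R) :
  (\forall t \near (0 : R), is_derive (t : R) 1 g (dg t)) -> is_derive (0 : R) 1 dg l ->
  (\forall t \near (0 : R), g 0 <= g t) -> dg 0 = 0 /\ 0 <= l.
Proof.
move=> dgE dgl gmin.
have /nbhs_ballP[e /= e0 eP] : \forall t \near (0 : R), is_derive (t : R) 1 g (dg t) /\ g 0 <= g t.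
  exact: filterI.
have inb (t : R) : -e < t < e -> is_derive t 1 g (dg t) /\ g 0 <= g t.
  by move=> te; apply: eP; rewrite -ball_normE/= sub0r normrN ltr_norml.
have dg0 : dg 0 = 0.
  have H : is_derive (0 : R) 1 g 0.
    apply: (@derive1_at_min _ g (- e) e); rewrite ?in_itv/= ?oppr_lt0 ?e0//; first lra.
      by move=> t; rewrite in_itv/= => /inb[[]].
    by move=> t; rewrite in_itv/= => /inb[].
  have [|H' _] := inb 0; first by rewrite oppr_lt0 e0.
  by rewrite -(@derive_val _ _ _ _ _ _ _ H') (@derive_val _ _ _ _ _ _ _ H).
split=> //; rewrite leNgt; apply/negP => l0.
case: dgl => dgd dgl.
have : h^-1 *: (dg (h *: 1 + 0) - dg 0) @[h --> (0 : R)^'] --> l by rewrite -dgl; exact: dgd.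
move=> /cvgr_lt/(_ _ l0)/nbhs_ballP[d /= d0 dP].
pose b := Num.min (d / 2) (e / 2).
have b0 : 0 < b by rewrite lt_min !divr_gt0.
have bd : b < d by rewrite gt_min; apply/orP; left; lra.
have be : b < e by rewrite gt_min; apply/orP; right; lra.
have [||c] := @MVT R g dg 0 b b0.
- by move=> t; rewrite in_itv/= => /andP[t0 tb]; apply: (inb t _).1; lra.
- apply: derivable_within_continuous => t; rewrite in_itv/= => /andP[t0 tb].
  by have [|[]] := inb t; first lra.
rewrite in_itv/= => /andP[c0 cb] E.
have : g 0 <= g b by apply: (inb b _).2; lra.
rewrite -subr_ge0 E subr0 pmulr_lge0// leNgt => /negP; apply.
have := dP c; rewrite /= -ball_normE/= sub0r normrN gtr0_norm// => /(_ (lt_trans cb bd)).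
rewrite gt_eqF// => /(_ isT); rewrite addr0 [c%:A]mulr1 dg0 subr0.
by rewrite -[_ *: _]/(_ * _) pmulr_rlt0// invr_gt0.
Qed.

Section minimum.
Context {R : realType} {N : nat}.
Implicit Types (F : 'rV[R]_(N + 1) -> R) (x : 'rV[R]_(N + 1)).
Let Uo := @upper_open R N.

Lemma partial_at_min F x i : C2_on upper F -> upper x ->
  (\forall y \near x, F x <= F y) ->
  partial i F x = 0 /\ 0 <= partial i (partial i F) x.
Proof.
move=> CF ux xmin.
pose L (t : R) := t *: delta_mx 0 i + x.
have L0 : L 0 = x by rewrite /L scale0r add0r.
have Lc : L t @[t --> (0 : R)] --> x.
  rewrite -[X in _ --> X]L0; apply: cvgD; last exact: cvg_cst.
  by apply: cvgZr_tmp; exact: cvg_id.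
have nu : \forall t \near (0 : R), upper (L t).
  by apply: Lc; apply: open_nbhs_nbhs.
have := @second_derivative_at_min R (F \o L) (fun t => partial i F (L t))
  (partial i (partial i F) x).
rewrite /= L0; apply.
- near=> t; apply: (is_derive_line F _ _ _ _).1.
  by apply: (C1_on_derive i CF.1); near: t.
- apply: (is_derive_line (partial i F) _ _ _ _).1.
  by rewrite -/(L 0) L0; exact: (C1_on_derive i (CF.2 i) ux).
- exact: Lc xmin.
Unshelve. all: by end_near. Qed.

(** The gradient vanishes at a minimum, so the drift disappears whatever the sign of 1 - 2s. *)
Lemma LE_at_min s F x : C2_on upper F -> upper x ->
  (\forall y \near x, F x <= F y) -> 0 <= LE s F x.
Proof.
move=> CF ux xmin; have H i := partial_at_min i CF ux xmin.
rewrite LE.unlock (H zi).1 mulr0 addr0; apply: sumr_ge0 => i _.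
exact: (H i).2.
Qed.

End minimum.

Section strong_minimum_principle.
Context {R : realType} {N : nat}.
Implicit Types (F : 'rV[R]_(N + 1) -> R) (x y : 'rV[R]_(N + 1)).
Let Uo := @upper_open R N.

Definition sqdist y x := sqn (x - y).

Let sqdistE y : sqdist y = (fun x => \sum_i (x 0 i + - y 0 i) * (x 0 i + - y 0 i)).
Proof. by apply/funext => x; apply: eq_bigr => i _; rewrite !mxE expr2. Qed.

Lemma C2_sqdist y : C2_on upper (sqdist y).
Proof.
rewrite sqdistE; apply: (C2_on_sum Uo) => i.
have C := C2_onD Uo (C2_on_coord Uo i) (C2_on_cst Uo (- y 0 i)).
exact: (C2_onM Uo C C).
Qed.

Lemma sqdist_continuous y : continuous (sqdist y).
Proof.
move=> x; apply: (@continuous_comp _ _ _ (fun x => x - y) (@sqn R (N + 1))).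
  by apply: (@continuousB _ _ _ id (cst y)); [exact: cvg_id|exact: cst_continuous].
exact: sqn_continuous.
Qed.

Lemma partial_sqdist y i x : partial i (sqdist y) x = 2 * (x 0 i - y 0 i).
Proof.
apply: partial_val; rewrite sqdistE.
have -> : (fun x : 'rV[R]_(N + 1) => \sum_i (x 0 i + - y 0 i) * (x 0 i + - y 0 i)) =
    \sum_i (fun x : 'rV[R]_(N + 1) => (x 0 i + - y 0 i) * (x 0 i + - y 0 i)).
  by apply/funext => z; rewrite fct_sumE.
have H j : is_derive x (delta_mx 0 i)
    (fun x : 'rV[R]_(N + 1) => (x 0 j + - y 0 j) * (x 0 j + - y 0 j))
    (2 * (x 0 j - y 0 j) * (j == i)%:R).
  have H1 := is_deriveD (is_derive_coord x (delta_mx 0 i) j)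
    (is_derive_cst (- y 0 j) x (delta_mx 0 i)).
  have := is_deriveM H1 H1; move/is_derive_eq; apply.
  by rewrite mxE eqxx /= addr0 /GRing.scale /= !fctE; ring.
have := is_derive_sum H; move/is_derive_eq; apply.
rewrite (bigD1 i)//= eqxx mulr1 big1 ?addr0// => j /negbTE ->.
by rewrite mulr0.
Qed.

Definition gauss (a : R) y x : R := expR (- a * sqdist y x).

Let is_derive_gauss1 (a c t : R) :
  is_derive t 1 (fun t => c * expR (- a * t)) (- a * c * expR (- a * t)).
Proof.
have H : is_derive t 1 (fun t => - a * t) (- a).
  by apply: is_derive_eq; rewrite [_%:A]mulr1.
have := is_deriveZ c (is_derive1_comp (is_derive_expR (- a * t)) H).
by move/is_derive_eq; apply; rewrite /GRing.scale/=; ring.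
Qed.

Let gaussE a y : gauss a y = (fun t => 1 * expR (- a * t)) \o sqdist y.
Proof. by apply/funext => x; rewrite /gauss /= mul1r. Qed.

Lemma C2_gauss a y : C2_on upper (gauss a y).
Proof.
rewrite gaussE; pose g (k t : R) := k * expR (- a * t).
apply: (@C2_on_comp _ _ _ Uo (sqdist y) (g 1) (g (- a * 1)) (g (- a * (- a * 1)))
  _ _ _ (C2_sqdist y)) => x ux.
- exact: is_derive_gauss1.
- exact: is_derive_gauss1.
- apply: differentiable_continuous; apply/derivable1_diffP.
  by case: (is_derive_gauss1 a (- a * (- a * 1)) (sqdist y x)).
Qed.

Lemma partial_gauss a y i x : upper x ->
  partial i (gauss a y) x = - 2 * a * (x 0 i - y 0 i) * gauss a y x.
Proof.
move=> ux; rewrite gaussE.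
have P := @partial_comp R _ upper (sqdist y) (fun t => 1 * expR (- a * t))
  (fun t => - a * 1 * expR (- a * t)) (fun x _ => is_derive_gauss1 a 1 _) i x
  (C2_sqdist y).1 ux.
apply: etrans P _.
by rewrite partial_sqdist /=; ring.
Qed.

Lemma partial2_gauss a y i x : upper x ->
  partial i (partial i (gauss a y)) x =
  (4 * a ^+ 2 * (x 0 i - y 0 i) ^+ 2 - 2 * a) * gauss a y x.
Proof.
move=> ux.
rewrite (@partial_ext _ _ _ Uo _ _ i x (fun x => @partial_gauss a y i x) ux).
have H1 := is_deriveD (is_derive_coord x (delta_mx 0 i) i)
    (is_derive_cst (- y 0 i) x (delta_mx 0 i)).
have H2 := C1_on_derive i (C2_gauss a y).1 ux.
have H3 := is_deriveM (is_deriveZ (- 2 * a) H1) H2.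
apply: partial_val; apply: is_derive_eq H3 _.
rewrite partial_gauss// !mxE !eqxx addr0 /GRing.scale /=.
set k := (X in X * _ + _ = _).
have -> : k = - 2 * a * (x 0 i - y 0 i) by [].
by move: (gauss a y x) => e; ring.
Qed.

Lemma LE_gauss s a y x : upper x ->
  LE s (gauss a y) x = (4 * a ^+ 2 * sqdist y x - 2 * a * (N + 1)%:R
     - 2 * a * (1 - 2 * s) * (x 0 zi - y 0 zi) / x 0 zi) * gauss a y x.
Proof.
move=> ux; rewrite LE.unlock /laplacian partial_gauss//.
under eq_bigr do rewrite partial2_gauss//.
rewrite -mulr_suml sumrB sumr_const card_ord -mulr_sumr -mulr_natr.
rewrite (_ : \sum_i (x 0 i - y 0 i) ^+ 2 = sqdist y x); last first.
  by apply: eq_bigr => i _; rewrite !mxE.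
by move: (gauss a y x) (x 0 zi)^-1 => e z; ring.
Qed.

Lemma LE_cst s c x : LE s (cst c) x = 0.
Proof.
have E i : partial i (cst c) = cst 0 :> ('rV[R]_(N + 1) -> R).
  by apply/funext => z; exact: partial_cst.
rewrite LE.unlock /laplacian E mulr0 addr0 big1// => i _.
by rewrite E partial_cst.
Qed.

Lemma compact_sqdist y r : 0 <= r -> compact [set x | sqdist y x <= r ^+ 2].
Proof.
move=> r0; apply: bounded_closed_compact.
  exists (`|y| + r); split=> [|M M1 x /= xr]; first exact: num_real.
  have r1 : 0 <= `|y| + r by rewrite addr_ge0.
  apply: (le_trans _ (ltW M1)); apply: norm_le_coord => // i.
  rewrite -[x 0 i](subrK (y 0 i)) addrC (le_trans (ler_normD _ _))// lerD//.
    exact: coord_le_norm.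
  rewrite -(@ler_pXn2r _ 2) ?nnegrE// real_normK ?num_real//.
  apply: le_trans xr; have := coord_sqr_le (x - y) i.
  by rewrite !mxE.
apply: (@preimage_closed _ _ (sqdist y) [set t | t <= r ^+ 2]).
  by move=> z _; exact: sqdist_continuous.
exact: closed_le.
Qed.

(* F is compared with a multiple of exp (- a |x - y|^2) - exp (- a rho^2), a large, on the
   annulus r0 <= |x - y| <= rho. *)
Lemma positivity_ball s kappa F y (r0 rho z0 : R) : 0 < s < 1 -> 0 <= kappa ->
  C2_on upper F -> (forall x, upper x -> 0 <= F x) ->
  (forall x, upper x -> LE s F x <= kappa * (F x / sqn x)) ->
  0 < z0 -> 0 < r0 < rho ->
  (forall x, sqdist y x <= rho ^+ 2 -> z0 <= x 0 zi) ->
  (forall x, sqdist y x <= r0 ^+ 2 -> 0 < F x) ->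
  forall x, sqdist y x < rho ^+ 2 -> 0 < F x.
Proof.
move=> /andP[s0 s1] kappa0 CF F0 LF z00 /andP[r00 r0rho] yz yF x1 x1rho.
have rho0 : 0 < rho by exact: lt_trans r0rho.
have r2 : r0 ^+ 2 < rho ^+ 2 by rewrite ltr_pXn2r ?nnegrE ?(ltW rho0) ?(ltW r00).
have uy x : sqdist y x <= rho ^+ 2 -> upper x.
  by move=> /yz; exact: lt_le_trans.
have cF x : upper x -> {for x, continuous F}.
  by move=> ux; exact: (C1_on_continuous Uo CF.1 ux).
have [c0 c0A mF] : exists2 c, c \in [set x | sqdist y x <= r0 ^+ 2] &
    forall t, t \in [set x | sqdist y x <= r0 ^+ 2] -> F c <= F t.
  apply: EVT_min_rV.
  - by exists y; rewrite /= /sqdist subrr /sqn big1 ?sqr_ge0// => i _; rewrite mxE expr0n.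
  - by apply: compact_sqdist; exact: ltW.
  apply: continuous_in_subspaceT => x /set_mem /= xr; apply: cF; apply: uy.
  exact: le_trans xr (ltW r2).
set m := F c0 in mF; have m0 : 0 < m by apply: yF; exact: set_mem c0A.
rewrite ltNge; apply/negP => Fx1.
(* On the annulus, [LE] of the Gaussian is at least 4 a^2 r0^2 - a B times the Gaussian: z >= z0 and
   |1 - 2s| <= 1 bound the drift. C bounds kappa / |x|^2, and a is chosen so that the quadratic term
   dominates both. *)
pose B := 2 * (N + 1)%:R + 2 * (rho / z0).
pose C := kappa / z0 ^+ 2.
have B0 : 0 <= B by rewrite addr_ge0// mulr_ge0// divr_ge0// ltW.
have C0 : 0 <= C by rewrite divr_ge0// sqr_ge0.
pose a := (B + C + 1) / (4 * r0 ^+ 2) + 1.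
have r02 : 0 < r0 ^+ 2 by rewrite exprn_gt0.
have a1 : 1 <= a by rewrite lerDr divr_ge0//; lra.
have a0 : 0 < a by lra.
have aP : C < 4 * a ^+ 2 * r0 ^+ 2 - a * B.
  have h : 4 * r0 ^+ 2 * a = B + C + 1 + 4 * r0 ^+ 2.
    by rewrite /a; field; rewrite gt_eqF.
  have -> : 4 * a ^+ 2 * r0 ^+ 2 - a * B = a * (C + 1 + 4 * r0 ^+ 2).
    by rewrite (_ : 4 * a ^+ 2 * r0 ^+ 2 = a * (4 * r0 ^+ 2 * a)); [rewrite h|]; ring.
  nra.
pose e0 := expR (- a * rho ^+ 2).
(* The explicit coefficients give the shape expected by [LE_lin]. The barrier [Bf] vanishes on the
   outer sphere. *)
pose Bf := fun x : 'rV[R]_(N + 1) => 1 * gauss a y x + - e0 * cst 1 x.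
pose D := fun x : 'rV[R]_(N + 1) => 1 * F x + - m * Bf x.
have CB : C2_on upper Bf by apply: C2_on_lin; [exact: C2_gauss|exact: C2_on_cst].
have CD : C2_on upper D by exact: C2_on_lin.
have BfE x : Bf x = gauss a y x - e0 by rewrite /Bf mul1r mulr1.
have DE x : D x = F x - m * (gauss a y x - e0) by rewrite /D BfE mul1r mulNr.
have Dx1 : D x1 < 0.
  have : e0 < gauss a y x1 by rewrite ltr_expR !mulNr ltrN2 ltr_pM2l.
  rewrite DE; nra.
pose K := [set x | r0 ^+ 2 <= sqdist y x] `&` [set x | sqdist y x <= rho ^+ 2].
have cK : compact K.
  apply: (@subclosed_compact _ _ [set x | sqdist y x <= rho ^+ 2]).
  - apply: closedI.
      apply: (@preimage_closed _ _ (sqdist y) [set t | r0 ^+ 2 <= t]); last exact: closed_ge.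
      by move=> z _; exact: sqdist_continuous.
    apply: (@preimage_closed _ _ (sqdist y) [set t | t <= rho ^+ 2]); last exact: closed_le.
    by move=> z _; exact: sqdist_continuous.
  - by apply: compact_sqdist; exact: ltW.
  - by move=> z [].
have Kx1 : K x1.
  split=> /=; last exact: ltW.
  by rewrite leNgt; apply/negP => /ltW/yF; rewrite ltNge Fx1.
have [P PK minP] : exists2 c, c \in K & forall t, t \in K -> D c <= D t.
  apply: EVT_min_rV => //; first by exists x1.
  apply: continuous_in_subspaceT => x /set_mem [_ /uy ux].
  exact: (C1_on_continuous Uo CD.1 ux).
have [Pr0 Prho] := set_mem PK; rewrite /= in Pr0 Prho.
have uP := uy _ Prho; have zP := yz _ Prho.
have DP : D P < 0 by apply: le_lt_trans Dx1; apply: minP; exact/mem_set.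
have e00 : 0 < e0 by exact: expR_gt0.
have g0 : 0 < gauss a y P by exact: expR_gt0.
have g1 : gauss a y P <= 1.
  by rewrite -expR0 ler_expR mulNr oppr_le0 mulr_ge0 ?sqn_ge0// ltW.
(* The negative minimum of D lies strictly inside the annulus: on the inner sphere F >= m while [Bf]
   < 1, and on the outer one D = F >= 0. *)
have Pr0' : r0 ^+ 2 < sqdist y P.
  rewrite lt_neqAle Pr0 andbT; apply/eqP => E.
  have : m <= F P by apply: mF; apply/mem_set; rewrite /= -E.
  by move: DP; rewrite DE; nra.
have Prho' : sqdist y P < rho ^+ 2.
  rewrite lt_neqAle Prho andbT; apply/eqP => E.
  move: DP; rewrite DE /gauss E subrr mulr0 subr0 ltNge => /negP; apply.
  exact: F0.
have Pmin : \forall x \near P, D P <= D x.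
  have H : \forall x \near P, r0 ^+ 2 < sqdist y x < rho ^+ 2.
    have hb : r0 ^+ 2 < sqdist y P < rho ^+ 2 by rewrite Pr0'.
    exact: sqdist_continuous (near_between hb).
  near=> x; apply: minP; apply/mem_set.
  have /andP[xr0 xrho] : r0 ^+ 2 < sqdist y x < rho ^+ 2 by near: x.
  by split; exact: ltW.
have := LE_at_min s CD uP Pmin.
(* At P, D < 0 gives F < m g for the Gaussian g, so [LE] of F is at most m g C, less than m times
   [LE] of g; hence [LE] of D is negative at a minimum. *)
rewrite (LE_lin s _ _ CF CB uP) (LE_lin s _ _ (C2_gauss a y) (C2_on_cst Uo 1) uP).
rewrite LE_cst mulr0 addr0 !mul1r leNgt => /negP; apply.
rewrite LE_gauss//; move: DP; rewrite DE => DP.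
have zP2 : z0 ^+ 2 <= sqn P.
  by apply: le_trans (coord_sqr_le P zi); rewrite ler_pXn2r// nnegrE ltW.
have h1 : kappa * (F P / sqn P) <= m * gauss a y P * C.
  have -> : m * gauss a y P * C = kappa * (m * gauss a y P / z0 ^+ 2).
    by rewrite /C; ring.
  rewrite ler_wpM2l// ler_pM ?F0// ?invr_ge0 ?sqn_ge0//; first nra.
  by rewrite lef_pV2// posrE ?exprn_gt0// (lt_le_trans _ zP2)// exprn_gt0.
have h2 : (1 - 2 * s) * (P 0 zi - y 0 zi) / P 0 zi <= rho / z0.
  have zP0 : 0 < P 0 zi by exact: lt_le_trans zP.
  have h3 : `|P 0 zi - y 0 zi| <= rho.
    rewrite -(@ler_pXn2r _ 2) ?nnegrE ?(ltW rho0)// real_normK ?num_real//.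
    by apply: le_trans Prho; have := coord_sqr_le (P - y) zi; rewrite !mxE.
  rewrite ler_pdivrMr// (le_trans (ler_norm _))// normrM.
  have h4 : `|1 - 2 * s| <= 1 by rewrite ler_norml; lra.
  apply: (@le_trans _ _ (1 * rho)); first exact: ler_pM.
  by rewrite mul1r mulrAC ler_pdivlMr// ler_wpM2l// ltW.
have := LF P uP; move: (LE s F P) h1 h2 => L h1 h2 h3.
move: g0 h1 DP; set g := gauss a y P => g0 h1 DP.
set k := (X in _ + - m * (X * g) < _).
have hk : C < k.
  apply: lt_le_trans aP _; rewrite /k.
  have -> : 2 * a * (1 - 2 * s) * (P 0 zi - y 0 zi) / P 0 zi =
    2 * a * ((1 - 2 * s) * (P 0 zi - y 0 zi) / P 0 zi) by ring.
  rewrite /B; nra.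
have : m * g * C < m * g * k by rewrite ltr_pM2l// mulr_gt0.
nra.
Unshelve. all: by end_near. Qed.

End strong_minimum_principle.

Section strong_minimum_chain.
Context {R : realType} {N : nat}.
Implicit Types (F : 'rV[R]_(N + 1) -> R) (x y : 'rV[R]_(N + 1)).
Let Uo := @upper_open R N.

(** Positivity propagates along the segment from x1 to x by overlapping balls of radius h / 2. The
    segment stays at height at least h, so the balls stay above h / 2 and [positivity_ball] applies
    to each. *)
Lemma strong_minimum s kappa F x1 x : 0 < s < 1 -> 0 <= kappa ->
  C2_on upper F -> (forall x, upper x -> 0 <= F x) ->
  (forall x, upper x -> LE s F x <= kappa * (F x / sqn x)) ->
  upper x1 -> 0 < F x1 -> upper x -> 0 < F x.
Proof.
move=> s01 kappa0 CF F0 LF ux1 Fx1 ux.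
pose h := Num.min (x1 0 zi) (x 0 zi).
have h0 : 0 < h by rewrite lt_min; apply/andP; split.
have step (p q : 'rV[R]_(N + 1)) : h <= p 0 zi -> 0 < F p -> sqdist p q < (h / 2) ^+ 2 -> 0 < F q.
  move=> hp Fp pq.
  have up : upper p by exact: lt_le_trans hp.
  have [r r0 rP] : exists2 r : R, 0 < r & forall z, sqdist p z <= r ^+ 2 -> 0 < F z.
    have : \forall z \near p, 0 < F z.
      exact: (C1_on_continuous Uo CF.1 up) (lt_nbhsr Fp).
    move=> /nbhs_ballP[e /= e0 eP]; exists (e / 2); first by rewrite divr_gt0.
    move=> z zr; apply: eP; rewrite -ball_normE/= distrC.
    apply: (@le_lt_trans _ _ (e / 2)); last lra.
    have e20 : 0 <= e / 2 by rewrite ltW ?divr_gt0.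
    apply: norm_le_coord => // i.
    rewrite -(@ler_pXn2r _ 2) ?nnegrE// real_normK ?num_real//.
    by apply: le_trans zr; exact: coord_sqr_le.
  pose r1 := Num.min r (h / 4).
  have r10 : 0 < r1 by rewrite lt_min r0 divr_gt0.
  have r1h : r1 < h / 2.
    by rewrite gt_min; apply/orP; right; lra.
  apply: (@positivity_ball _ _ s kappa F p r1 (h / 2) (h / 2)) => //.
  - by rewrite divr_gt0.
  - by rewrite r10.
  - move=> z zh; have := le_trans (coord_sqr_le (z - p) zi) zh.
    rewrite !mxE; have h20 : 0 <= h / 2 by rewrite ltW ?divr_gt0.
    rewrite -real_normK ?num_real// ler_pXn2r ?nnegrE// ler_norml => /andP[+ _].
    by move: hp; set a := p 0 zi; set b := z 0 zi; lra.
  - move=> z zr; apply: rP; apply: le_trans zr _.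
    by rewrite ler_pXn2r ?nnegrE ?(ltW r0) ?(ltW r10)// ge_min lexx.
(* Enough equal steps to make each one strictly shorter than h / 2. *)
pose n := (Num.truncn (enorm (x - x1) / (h / 2))).+1.
have nP : enorm (x - x1) / (h / 2) < n%:R.
  by rewrite /n truncnS_gt.
have n0 : 0 < n%:R :> R by [].
pose c (k : nat) := x1 + (k%:R / n%:R) *: (x - x1).
have cz k : (k <= n)%N -> h <= c k 0 zi.
  move=> kn; rewrite /c !mxE.
  have t0 : 0 <= k%:R / n%:R :> R by rewrite divr_ge0.
  have t1 : k%:R / n%:R <= 1 :> R by rewrite ler_pdivrMr// mul1r ler_nat.
  have hx1 : h <= x1 0 zi by rewrite ge_min lexx.
  have hx : h <= x 0 zi by rewrite ge_min lexx orbT.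
  move: (k%:R / n%:R) t0 t1 => t t0 t1.
  set a := x1 0 zi in hx1 *; set b := x 0 zi in hx *; nra.
have H k : (k <= n)%N -> 0 < F (c k).
  elim: k => [_|k IH kn]; first by rewrite /c mul0r scale0r addr0.
  apply: step (cz k (ltnW kn)) (IH (ltnW kn)) _.
  rewrite /sqdist (_ : c k.+1 - c k = n%:R^-1 *: (x - x1)); last first.
    rewrite /c opprD addrACA subrr add0r -scalerBl; congr (_ *: _).
    by rewrite -mulrBl -natr1 addrAC subrr add0r mul1r.
  rewrite sqnZ -[sqn _]sqr_sqrtr ?sqn_ge0// -enormE -exprMn.
  have e0 : 0 <= enorm (x - x1) by rewrite enormE sqrtr_ge0.
  have h20 : 0 < h / 2 by rewrite divr_gt0.
  have lt1 : n%:R^-1 * enorm (x - x1) < h / 2.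
    by rewrite ltr_pdivrMl// -ltr_pdivrMr.
  by rewrite ltr_pXn2r// nnegrE ?(ltW h20)// mulr_ge0// invr_ge0 ltW.
have := H n (leqnn n).
by rewrite /c divff ?gt_eqF// scale1r addrC subrK.
Qed.

End strong_minimum_chain.

(** * Zonal functions and the Hopf lemma *)

Lemma C2_onV (R : realType) n (U : set 'rV[R]_n) (f : 'rV[R]_n -> R) : open U ->
  (forall x, U x -> f x != 0) -> C2_on U f -> C2_on U (fun y => (f y)^-1).
Proof.
move=> Uo f0 Cf.
have d1 (t : R) : t != 0 -> is_derive t 1 (fun t => t^-1) (- (t ^- 2)).
  move=> t0; have := is_deriveV (f := id) t0 (is_derive_id t 1).
  by move/is_derive_eq; apply; rewrite [_%:A]mulr1.
have d2 (t : R) : t != 0 -> is_derive t 1 (fun t => - (t ^- 2)) (2 * t ^- 3).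
  move=> t0; have t20 : t ^+ 2 != 0 by rewrite expf_neq0.
  have dX := is_deriveX 2 (is_derive_id t (1 : R)).
  have := is_deriveN (is_deriveV (f := fun t => t ^+ 2) t20 dX).
  by move/is_derive_eq; apply; rewrite /GRing.scale /= expr1; field.
apply: (@C2_on_comp _ _ _ Uo f (fun t => t^-1) (fun t => - (t ^- 2))
  (fun t => 2 * t ^- 3) _ _ _ Cf) => x Ux.
- by apply: d1; exact: f0.
- by apply: d2; exact: f0.
- apply: continuousM; first exact: cst_continuous.
  apply: continuousV; first by rewrite expf_neq0// f0.
  exact: exprn_continuous.
Qed.

Section zonal.
Context {R : realType} {N : nat}.
Hypothesis N0 : (0 < N)%N.
Implicit Types (x : 'rV[R]_(N + 1)).
Let Uo := @upper_open R N.

(** sin^2 phi, extended with degree 0. It is smooth on [upper], and as a variable it turns A_s into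
    a hypergeometric operator. *)
Definition zeta x : R := x 0 zi ^+ 2 / sqn x.

Lemma zetaZ a x : a != 0 -> zeta (a *: x) = zeta x.
Proof.
move=> a0; rewrite /zeta mxE sqnZ exprMn invfM mulrACA divff ?mul1r//.
by rewrite expf_neq0.
Qed.

Lemma zeta_radial x : x != 0 -> zeta (radial_proj x) = zeta x.
Proof. by move=> x0; rewrite zetaZ// invr_eq0 gt_eqF// enorm_gt0. Qed.

Lemma zeta_hs sigma t : sqn sigma = 1 -> zeta (hs_point sigma t) = sin t ^+ 2.
Proof. by move=> s1; rewrite /zeta hs_pointr sqn_hs// divr1. Qed.

Lemma sqn_gt0 x : upper x -> 0 < sqn x.
Proof. by move=> /upper_neq0/enorm_gt0; rewrite enormE sqrtr_gt0. Qed.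

Lemma zeta_gt0 x : upper x -> 0 < zeta x.
Proof. by move=> ux; rewrite divr_gt0 ?sqn_gt0// exprn_gt0. Qed.

Lemma zeta_ge0 x : 0 <= zeta x.
Proof. by rewrite divr_ge0 ?sqr_ge0 ?sqn_ge0. Qed.

Lemma zeta_le1 x : upper x -> zeta x <= 1.
Proof. by move=> ux; rewrite ler_pdivrMr ?sqn_gt0// mul1r coord_sqr_le. Qed.

Lemma C2_zeta : C2_on upper zeta.
Proof.
have C := C2_on_coord Uo (@zi N).
apply: (C2_on_ext Uo) (C2_onM Uo (C2_onM Uo C C) (C2_onV Uo _ (C2_on_sqn Uo))).
  by move=> x ux; rewrite -expr2.
by move=> x ux; rewrite gt_eqF// sqn_gt0.
Qed.

Variables (G dG ddG : R -> R).
Hypothesis GE : forall t : R, 0 < t <= 1 -> is_derive t 1 G (dG t).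
Hypothesis dGE : forall t : R, 0 < t <= 1 -> is_derive t 1 dG (ddG t).
Hypothesis ddGc : forall t : R, 0 < t <= 1 -> {for t, continuous ddG}.

Lemma zonal_ext x : upper x -> (G \o zeta) (radial_proj x) = (G \o zeta) x.
Proof. by move=> ux /=; rewrite zeta_radial// upper_neq0. Qed.

Lemma C2_zonal : C2_on upper ((G \o zeta) \o @radial_proj R (N + 1)).
Proof.
apply: (C2_on_ext Uo) (_ : C2_on upper (G \o zeta)).
  by move=> x ux; rewrite [RHS]zonal_ext.
have z01 x : upper x -> 0 < zeta x <= 1 by move=> ux; rewrite zeta_gt0 ?zeta_le1.
apply: (C2_on_comp Uo (dG := dG) (ddG := ddG)) C2_zeta => x ux.
- exact/GE/z01.
- exact/dGE/z01.
- exact/ddGc/z01.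
Qed.

Let W (t : R) := G (sin t ^+ 2).
Let dW (t : R) := dG (sin t ^+ 2) * (2 * sin t * cos t).

Let sin01 (t : R) : 0 < t < pi / 2 -> 0 < sin t ^+ 2 <= 1.
Proof.
move=> tb; have st : 0 < sin t by exact: sin_gt0_pihalf.
by rewrite exprn_gt0//= expr_le1// ?sin_le1// ltW.
Qed.

Let dsin2 (t : R) : is_derive t 1 (fun t => sin t ^+ 2) (2 * sin t * cos t).
Proof.
have := is_deriveX 2 (is_derive_sin t).
by move/is_derive_eq; apply; rewrite expr1.
Qed.

Let WE (t : R) : 0 < t < pi / 2 -> is_derive t 1 W (dW t).
Proof. by move=> tb; exact: (@is_derive1_comp _ G (fun t => sin t ^+ 2) t _ _ (GE (sin01 tb)) (dsin2 t)). Qed.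

Let dWE (t : R) : 0 < t < pi / 2 -> is_derive t 1 dW
  (ddG (sin t ^+ 2) * (2 * sin t * cos t) ^+ 2 +
   dG (sin t ^+ 2) * (2 * (cos t ^+ 2 - sin t ^+ 2))).
Proof.
move=> tb; have d1 := @is_derive1_comp _ dG (fun t => sin t ^+ 2) t _ _ (dGE (sin01 tb)) (dsin2 t).
have d2 := is_deriveM (is_deriveZ 2 (is_derive_sin t)) (is_derive_cos t).
have := is_deriveM d1 d2; move/is_derive_eq; apply.
rewrite /GRing.scale /=.
rewrite (_ : ((2 \*: sin) * cos) t = 2 * sin t * cos t)//.
rewrite -[2 *: sin t]/(2 * sin t); ring.
Qed.

Lemma d_phi_zonal sigma (t : R) : sqn sigma = 1 -> 0 < t < pi / 2 ->
  d_phi (G \o zeta) sigma t = dG (sin t ^+ 2) * (2 * sin t * cos t).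
Proof.
move=> s1 tb; rewrite /d_phi (_ : (fun t => _) = W); last first.
  by apply/funext => v; rewrite /= zeta_hs.
by rewrite derive1E; have H := WE tb; rewrite derive_val.
Qed.

(** The spherical term vanishes, since a zonal function is constant in sigma. One quarter of the
    result is the hypergeometric operator with third parameter 1 - s at z = 0 and N / 2 at z = 1. *)
Lemma As_zonal s sigma (t : R) : sqn sigma = 1 -> 0 < t < pi / 2 ->
  let z := sin t ^+ 2 in
  As_coord s (G \o zeta) sigma t = 4 * z * (1 - z) * ddG z
    + (4 - 4 * s - (2 * N%:R + 4 - 4 * s) * z) * dG z.
Proof.
move=> s1 tb z.
have st : 0 < sin t by exact: sin_gt0_pihalf.
have ct : 0 < cos t by apply: cos_gt0_pihalf; case/andP: tb => t0 t1; lra.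
have H := @radial_partE _ N.-1 s W dW _ t tb WE (dWE tb).
have l0 : 0 < lambda_s s t * cos t ^+ N.-1.
  by rewrite mulr_gt0 ?powR_gt0// exprn_gt0.
have -> : As_coord s (G \o zeta) sigma t =
    (ddG z * (2 * sin t * cos t) ^+ 2 + dG z * (2 * (cos t ^+ 2 - sin t ^+ 2)))
    + ((1 - 2 * s) * cos t / sin t - N.-1%:R * sin t / cos t) * dW t.
  rewrite /As_coord.
  have -> : sphere_laplacian (fun sigma' => (G \o zeta) (hs_point sigma' t)) sigma = 0.
    have sigma0 : sigma != 0.
      by apply: contra_eq_neq s1 => ->; rewrite /sqn big1 1?eq_sym ?oner_eq0//
        => j _; rewrite mxE expr0n.
    have E i y : y != 0 -> partial i ((fun sigma' => (G \o zeta) (hs_point sigma' t)) \o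
        @radial_proj R N) y = 0.
      move=> y0; rewrite -[RHS](partial_cst (G z) i y).
      apply: near_eq_derive; near=> v.
      rewrite /= zeta_hs// sqn_radial_proj//; near: v; exact: neq0_near.
    rewrite /sphere_laplacian /laplacian big1// => i _.
    rewrite -[RHS](partial_cst 0 i sigma); apply: near_eq_derive; near=> v.
    by apply: E; near: v; exact: neq0_near.
  rewrite mul0r addr0 derive1E.
  have WW : (fun v => (G \o zeta) (hs_point sigma v)) = W.
    by apply/funext => v; rewrite /= zeta_hs.
  rewrite /d_phi WW.
  by rewrite (@derive_val _ _ _ _ _ _ _ H) mulrC mulKf// gt_eqF.
have N1 : N%:R = N.-1%:R + 1 :> R by rewrite -{1}(prednK N0) -natr1.
have zE : 1 - z = cos t ^+ 2 by rewrite -(cos2Dsin2 t) addrK.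
have c2 : cos t ^+ 2 = 1 - z by [].
have zsin : z = sin t ^+ 2 by [].
rewrite /dW -/z N1 zE.
move: (dG z) (ddG z) => a b.
have -> : ((1 - 2 * s) * cos t / sin t - N.-1%:R * sin t / cos t) *
   (a * (2 * sin t * cos t)) = a * 2 * ((1 - 2 * s) * cos t ^+ 2 - N.-1%:R * sin t ^+ 2).
  by field; rewrite !gt_eqF.
rewrite -zsin c2 exprMn c2 exprMn -zsin; ring.
Unshelve. all: by end_near. Qed.

Lemma zeta_continuous x : sqn x != 0 -> {for x, continuous zeta}.
Proof.
move=> x0; apply: continuousM; last first.
  by apply: continuousV => //; exact: sqn_continuous.
apply: (@continuous_comp _ _ _ (fun y : 'rV[R]_(N + 1) => y 0 zi) (fun t => t ^+ 2)).
  exact: coord_continuous.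
exact: exprn_continuous.
Qed.

(** At the boundary zeta tends to 0 through nonnegative values, so a right limit of G suffices. *)
Lemma zonal_continuous :
  G t @[t --> (0 : R)^'+] --> G 0 ->
  {within closure (@half_sphere R N), continuous (G \o zeta)}.
Proof.
move=> G0; apply/subspace_continuousP => x /(closure_half_sphereP N0)[x1 z0].
have zc : {for x, continuous zeta} by apply: zeta_continuous; rewrite x1 oner_neq0.
move: z0; rewrite le_eqVlt => /predU1P[z0|ux]; last first.
  have Gc : {for zeta x, continuous G}.
    apply: differentiable_continuous; apply/derivable1_diffP.
    by have [] // := @GE (zeta x); rewrite zeta_gt0 ?zeta_le1.
  exact: cvg_within_filter (continuous_comp zc Gc).
have zx : zeta x = 0 by rewrite /zeta -z0 expr0n mul0r.
suff : G (zeta y) @[y --> within (closure (@half_sphere R N)) (nbhs x)] --> G (zeta x) by [].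
rewrite zx; apply/cvgrPdist_lt => e e0.
move/cvgrPdist_lt : G0 => /(_ e e0)/nbhs_ballP[d /= d0 dP].
have zd : zeta x < d by rewrite zx.
have H : \forall y \near x, zeta y < d by exact: zc (lt_nbhsl zd).
apply: filterS H => y yd _ /=.
have := zeta_ge0 y; rewrite le_eqVlt => /predU1P[<-|y0].
  by rewrite subrr normr0.
by apply: dP => //; rewrite /= -ball_normE/= sub0r normrN gtr0_norm.
Qed.

End zonal.

(** [As_coordE] with r = 1 read backwards; excluding the pole is harmless for the barrier, which is
    used near the boundary. *)
Lemma LE_zonal (R : realType) N (N0 : (0 < N)%N) (G dG ddG : R -> R) s
    (x : 'rV[R]_(N + 1)) :
  (forall t : R, 0 < t <= 1 -> is_derive t 1 G (dG t)) ->
  (forall t : R, 0 < t <= 1 -> is_derive t 1 dG (ddG t)) ->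
  (forall t : R, 0 < t <= 1 -> {for t, continuous ddG}) ->
  sqn x = 1 -> upper x -> zeta x < 1 ->
  LE s ((G \o zeta) \o @radial_proj R (N + 1)) x =
    4 * zeta x * (1 - zeta x) * ddG (zeta x)
    + (4 - 4 * s - (2 * N%:R + 4 - 4 * s) * zeta x) * dG (zeta x).
Proof.
move=> GE dGE ddGc x1 ux zx.
have [sigma [phi [s1 /andP[p0 p1] xE]]] := hs_polar N0 x1 (ltW ux).
have zE : zeta x = sin phi ^+ 2 by rewrite xE zeta_hs.
have pb : 0 < phi < pi / 2.
  rewrite lt_neqAle p0 lt_neqAle p1 !andbT; apply/andP; split; apply/eqP => E.
    by move: ux; rewrite /upper /= xE hs_pointr -E sin0 ltxx.
  by move: zx; rewrite zE E sin_pihalf expr1n ltxx.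
have := As_coordE N0 s (C2_zonal GE dGE ddGc) s1 pb ltr01.
rewrite (As_zonal N0 GE dGE s s1 pb) -zE expr1n mul1r scale1r -xE.
by move=> ->.
Qed.

(** * Powers of sin^2 phi and the barrier *)

Section powers.
Context {R : realType} (s : R).
Hypothesis s01 : 0 < s < 1.

Let g (a : R) (t : R) : R := t `^ a.

Lemma is_derive_powR_scale (k a t : R) : 0 < t ->
  is_derive t 1 (fun t => k * t `^ a) (k * a * t `^ (a - 1)).
Proof.
move=> t0; have := is_deriveZ k (is_derive1_powR a t0).
by move/is_derive_eq; apply; rewrite /GRing.scale /= mulrA.
Qed.

Lemma powR_le1 (a t : R) : 0 <= a -> 0 <= t <= 1 -> t `^ a <= 1.
Proof.
move=> a0 /andP[t0 t1].
by have := ge0_ler_powR a0 t0 (ler01 : 1 \in Num.nneg) t1; rewrite powR1.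
Qed.

Lemma powR_scale_continuous (k a t : R) : 0 < t ->
  {for t, continuous (fun t => k * t `^ a)}.
Proof.
move=> t0; apply: differentiable_continuous; apply/derivable1_diffP.
by case: (is_derive_powR_scale k a t0).
Qed.

Lemma powR_split (a t : R) : 0 < t -> t `^ a = t * t `^ (a - 1).
Proof.
move=> t0; rewrite powRB ?(gt_eqF t0) ?implybT// powRr1 ?ltW//.
by rewrite mulrCA divff ?mulr1// gt_eqF.
Qed.

(** (sin phi)^(2s) in the variable zeta; the factor 1 matches [is_derive_powR_scale]. *)
Definition hzonal (t : R) : R := 1 * t `^ s.
Definition dhzonal (t : R) : R := 1 * s * t `^ (s - 1).
Definition ddhzonal (t : R) : R := 1 * s * (s - 1) * t `^ (s - 1 - 1).

Lemma hzonalE (t : R) : 0 < t <= 1 -> is_derive t 1 hzonal (dhzonal t).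
Proof. by move=> /andP[t0 _]; exact: is_derive_powR_scale. Qed.

Lemma dhzonalE (t : R) : 0 < t <= 1 -> is_derive t 1 dhzonal (ddhzonal t).
Proof. by move=> /andP[t0 _]; exact: is_derive_powR_scale. Qed.

Lemma ddhzonalC (t : R) : 0 < t <= 1 -> {for t, continuous ddhzonal}.
Proof. by move=> /andP[t0 _]; exact: powR_scale_continuous. Qed.

(** s is an exponent of the equation at t = 0, so the terms in t^(s - 1) cancel. *)
Lemma hzonal_ode (n t : R) : 0 < t ->
  4 * t * (1 - t) * ddhzonal t + (4 - 4 * s - (2 * n + 4 - 4 * s) * t) * dhzonal t
  = - (2 * s * n) * t `^ s.
Proof.
move=> t0; rewrite /ddhzonal /dhzonal (powR_split s t0) (powR_split (s - 1) t0).
by ring.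
Qed.

Lemma hzonal0 : hzonal 0 = 0.
Proof. by rewrite /hzonal powR0 ?mulr0// gt_eqF//; case/andP: s01. Qed.

Lemma hzonal_cvg0 : hzonal t @[t --> (0 : R)^'+] --> hzonal 0.
Proof.
have s0 : 0 < s by case/andP: s01.
rewrite hzonal0; have := @cvgMl_tmp _ _ _ _ _ 1 _ (powR_cvg0 s0).
by rewrite mulr0; exact.
Qed.

(* As a function of zeta, the barrier of the Hopf lemma. *)
Definition bzonal (C t : R) : R := hzonal t + C * t.
Definition dbzonal (C t : R) : R := dhzonal t + C.

Lemma bzonalE C (t : R) : 0 < t <= 1 -> is_derive t 1 (bzonal C) (dbzonal C t).
Proof.
move=> t01; have d : is_derive t 1 (fun t => C * t) C.
  by apply: is_derive_eq; rewrite [_%:A]mulr1.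
exact: is_deriveD (hzonalE t01) d.
Qed.

Lemma dbzonalE C (t : R) : 0 < t <= 1 -> is_derive t 1 (dbzonal C) (ddhzonal t).
Proof.
move=> t01; have := is_deriveD (dhzonalE t01) (is_derive_cst C t 1).
by move/is_derive_eq; apply; rewrite addr0.
Qed.

Lemma bzonal_cvg0 C : bzonal C t @[t --> (0 : R)^'+] --> bzonal C 0.
Proof.
have c : C * t @[t --> (0 : R)^'+] --> C * 0.
  by apply: cvgMl_tmp; apply: cvg_at_right_filter; exact: cvg_id.
exact: (cvgD hzonal_cvg0 c).
Qed.

End powers.

Section Hopf.
Context {R : realType} {N : nat}.
Hypothesis N0 : (0 < N)%N.
Variables (s : R) (u : 'rV[R]_(N + 1) -> R).
Hypothesis s01 : 0 < s < 1.
Let cl := closure (@half_sphere R N).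
Let ext (v : 'rV[R]_(N + 1) -> R) := v \o @radial_proj R (N + 1).
Hypothesis cu : {within cl, continuous u}.
Hypothesis CU : C2_on upper (ext u).
Hypothesis u_ge0 : forall x, cl x -> 0 <= u x.
Hypothesis LU : forall x, upper x -> LE s (ext u) x <= 0.
Hypothesis u_gt0 : forall x, half_sphere x -> 0 < u x.
Let s0 : 0 < s. Proof. by case/andP: s01. Qed.
Let s1 : s < 1. Proof. by case/andP: s01. Qed.

Let NR : 0 < N%:R :> R. Proof. by rewrite ltr0n. Qed.
(** For zeta < z0 the term C zeta contributes at least 2 C (1 - s) = 4 s N to [LE], more than the
    loss 2 s N zeta^s caused by zeta^s; thus the barrier is a strict subsolution there. *)
Let z0 : R := (1 - s) / (2 - 2 * s + N%:R).
Let C : R := 2 * s * N%:R / (1 - s).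
Let den : 0 < 2 - 2 * s + N%:R. Proof. by have := NR; have := s1; lra. Qed.
Let z00 : 0 < z0. Proof. by rewrite divr_gt0// subr_gt0. Qed.
Let z01 : z0 < 1. Proof. by rewrite ltr_pdivrMr// mul1r; have := NR; have := s1; lra. Qed.
Let C0 : 0 < C. Proof. by rewrite divr_gt0 ?subr_gt0// !mulr_gt0. Qed.

Let b := bzonal s C \o @zeta R N.

Let LEb x : sqn x = 1 -> upper x -> zeta x < z0 -> 0 < LE s (ext b) x.
Proof.
move=> x1 ux zx.
rewrite /ext (LE_zonal N0 s (@bzonalE R s C) (@dbzonalE R s C) (@ddhzonalC R s) x1 ux); last first.
  exact: lt_trans z01.
have z0x := zeta_gt0 ux; move: (zeta x) zx z0x => z zx z0x.
rewrite /dbzonal [X in _ + X]mulrDr addrA (hzonal_ode s N%:R z0x).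
have p1 : z `^ s <= 1.
  by apply: powR_le1; rewrite ?(ltW s0)// (ltW z0x) ltW// (lt_trans zx).
have h : (1 - s) <= (2 - 2 * s - (N%:R + 2 - 2 * s) * z).
  have : (2 - 2 * s + N%:R) * z <= 1 - s.
    by rewrite mulrC -ler_pdivlMr// ltW.
  lra.
have E : C * (1 - s) = 2 * s * N%:R by rewrite /C divfK// gt_eqF// subr_gt0.
have h2 : 2 * C * (1 - s) <= 2 * C * (2 - 2 * s - (N%:R + 2 - 2 * s) * z).
  by rewrite ler_pM2l// mulr_gt0.
have h3 : 2 * s * N%:R * z `^ s <= 2 * s * N%:R.
  by rewrite ler_piMr// !mulr_ge0// ltW.
have h4 : 0 < 2 * s * N%:R by rewrite !mulr_gt0.
nra.
Qed.

Let b_le x : cl x -> b x <= 1 + C.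
Proof.
move=> /(closure_half_sphereP N0)[x1 _].
have z1 : zeta x <= 1 by rewrite /zeta x1 divr1 -x1 coord_sqr_le.
rewrite /b /= /bzonal /hzonal mul1r lerD//; last by rewrite ler_piMr// ltW.
by apply: powR_le1; rewrite ?(ltW s0)// zeta_ge0.
Qed.

Let cb : {within cl, continuous b}.
Proof. exact: (zonal_continuous N0 (@bzonalE R s C) (bzonal_cvg0 s01 (C := C))). Qed.

Let zeta_cont_on : {within cl, continuous (@zeta R N)}.
Proof.
apply: continuous_in_subspaceT => x /set_mem/(closure_half_sphereP N0)[x1 _].
by apply: zeta_continuous; rewrite x1 oner_neq0.
Qed.

Let closed_cl : closed cl. Proof. exact: closed_closure. Qed.

Let compact_part (A : set R) : closed A -> compact (cl `&` @zeta R N @^-1` A).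
Proof.
move=> cA; have clA : closed (cl `&` @zeta R N @^-1` A).
  rewrite closed_setSI//; apply: preimage_closed => // y _; exact: zeta_cont_on.
apply: (subclosed_compact clA (closure_compact N0)); exact: subIsetl.
Qed.

(** On zeta >= z0, u has a positive minimum m, and d = m / (1 + C) makes d b <= m. On the layer zeta
    <= z0 a negative minimum of u - d b can lie neither at zeta = 0, where b = 0, nor at zeta = z0,
    nor between, where [LE] of u - d b is negative. Finally zeta^s <= b. *)
Lemma Hopf_boundary : exists2 c : R, 0 < c &
  forall x, half_sphere x -> c * zeta x `^ s <= u x.
Proof.
have cl_half x : cl x -> 0 < zeta x -> half_sphere x.
  move=> /(closure_half_sphereP N0)[x1 xz] zx; apply/(half_sphereP N0); split=> //.
  rewrite /upper /= lt_neqAle xz andbT; apply/eqP => E.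
  by move: zx; rewrite /zeta -E expr0n mul0r ltxx.
pose K1 := cl `&` @zeta R N @^-1` [set t | z0 <= t].
have [pole polecl zpole] : exists2 x : 'rV[R]_(N + 1), cl x & zeta x = 1.
  pose sg : 'rV[R]_N := delta_mx 0 (Ordinal N0).
  have sg1 : sqn sg = 1.
    rewrite /sqn (bigD1 (Ordinal N0))//= mxE !eqxx expr1n big1 ?addr0// => j jn.
    by rewrite mxE (negbTE jn) andbF expr0n.
  exists (hs_point sg (pi / 2)); last by rewrite zeta_hs// sin_pihalf expr1n.
  by apply: closure_hs; rewrite // lexx divr_ge0// pi_ge0.
have [c1 c1K mP] : exists2 c, c \in K1 & forall t, t \in K1 -> u c <= u t.
  apply: EVT_min_rV.
  - by exists pole; split=> //=; rewrite zpole ltW.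
  - by apply: compact_part; exact: closed_ge.
  - by apply: continuous_subspaceW cu => x [].
set m := u c1 in mP.
have m0 : 0 < m.
  by have [cc /= zc] := set_mem c1K; apply/u_gt0/cl_half => //; exact: lt_le_trans zc.
pose d := m / (1 + C).
have C1 : 0 < 1 + C by rewrite addr_gt0.
have d0 : 0 < d by rewrite divr_gt0.
have dm : d * (1 + C) = m by rewrite /d divfK// gt_eqF.
pose D x := 1 * u x + - d * b x.
have cD : {within cl, continuous D}.
  have -> : D = u \- (d \*: b) by apply/funext => x; rewrite /D mul1r mulNr.
  move=> x; apply: continuousB; first exact: cu.
  by apply: continuousZl_tmp; exact: cb.
have D0 x : cl x -> zeta x <= z0 -> 0 <= D x.
  move=> clx zx; rewrite leNgt; apply/negP => Dx.
  pose K2 := cl `&` @zeta R N @^-1` [set t | t <= z0].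
  have [P PK minP] : exists2 c, c \in K2 & forall t, t \in K2 -> D c <= D t.
    apply: EVT_min_rV.
    - by exists x.
    - by apply: compact_part; exact: closed_le.
    - by apply: continuous_subspaceW cD => y [].
  have [clP zP] := set_mem PK; rewrite /= in zP.
  have DP : D P < 0 by apply: le_lt_trans Dx; apply: minP; exact/mem_set.
  have zP0 : 0 < zeta P.
    rewrite lt_neqAle zeta_ge0 andbT; apply/eqP => E.
    move: DP; rewrite /D /b /= -E /bzonal (hzonal0 s01) add0r !mulr0 addr0 mul1r.
    by rewrite ltNge u_ge0.
  have zPz : zeta P < z0.
    rewrite lt_neqAle zP andbT; apply/eqP => E.
    have uP : m <= u P by apply/mP/mem_set; split=> //=; rewrite E.
    have := b_le clP; move: DP; rewrite /D; nra.
  have [P1 uP] := (half_sphereP N0 P).1 (cl_half P clP zP0).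
  have CB : C2_on upper (ext b) by exact: C2_zonal (@bzonalE R s C) (@dbzonalE R s C) (@ddhzonalC R s).
  have CD : C2_on upper (ext D) := C2_on_lin 1 (- d) CU CB.
  have Pmin : \forall y \near P, ext D P <= ext D y.
    have nu : \forall y \near P, upper y.
      by apply: open_nbhs_nbhs; split=> //; exact: upper_open.
    have nz : \forall y \near P, zeta y < z0.
      have zc : {for P, continuous (@zeta R N)}.
        by apply: zeta_continuous; rewrite P1 oner_neq0.
      exact: zc (lt_nbhsl zPz).
    near=> y; have uy : upper y by near: y.
    rewrite /ext /= radial_proj_id//; apply: minP; apply/mem_set; split.
      by apply: subset_closure; exact/upper_radial.
    by rewrite /= zeta_radial ?upper_neq0// ltW//; near: y.
  have := LE_at_min s CD uP Pmin.
  rewrite [LE _ _ _](LE_lin s 1 (- d) CU CB uP) leNgt => /negP; apply.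
  have := LEb P1 uP zPz; have := LU uP; nra.
exists d => // x /(half_sphereP N0)[x1 ux].
have clx : cl x by apply/(closure_half_sphereP N0); split=> //; exact: ltW.
have zx0 := zeta_gt0 ux; have zx1 := zeta_le1 ux.
have [zx|zx] := leP (zeta x) z0.
  have := D0 x clx zx; rewrite /D /b /= /bzonal /hzonal !mul1r => H.
  have Cz : 0 <= C * zeta x by rewrite mulr_ge0// ltW.
  have dC : 0 <= d * (C * zeta x) by rewrite mulr_ge0// ltW.
  by move: H; rewrite mulNr mulrDr; move: (d * (C * zeta x)) dC => a1; lra.
have um : m <= u x by apply/mP/mem_set; split=> //=; exact: ltW.
have h1 : zeta x `^ s <= 1 by apply: powR_le1; rewrite ?(ltW s0)// ltW.
apply: le_trans um; rewrite -dm ler_pM2l//.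
by apply: le_trans h1 _; rewrite lerDl ltW.
Unshelve. all: by end_near. Qed.

End Hopf.

(** * Triviality and uniqueness *)

Section boundary.
Context {R : realType} {N : nat}.
Hypothesis N0 : (0 < N)%N.
Implicit Types (u w v : 'rV[R]_(N + 1) -> R).
Local Notation cl := (closure (@half_sphere R N)).
Local Notation ext v := (v \o @radial_proj R (N + 1)).

Let pi20 : 0 < pi / 2 :> R. Proof. by rewrite divr_gt0// pi_gt0. Qed.

Lemma closure_hs0 sigma : sqn sigma = 1 -> cl (hs_point sigma 0).
Proof. by move=> s1; apply: closure_hs => //; rewrite lexx ltW. Qed.

Lemma closure_boundary x : cl x -> ~ half_sphere x ->
  exists2 sigma, sqn sigma = 1 & x = hs_point sigma 0.
Proof.
move=> clx nx; have [sigma [phi [s1 /andP[p0 p1] xE]]] := closure_polar N0 clx.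
exists sigma => //; have [p00|p00] := eqVneq phi 0; first by rewrite xE p00.
exfalso; apply: nx; exists sigma; first exact/usphereE.
by exists phi => //=; rewrite in_itv/= p1 lt_neqAle eq_sym p00 p0.
Qed.

Lemma boundary_point_ex : exists sigma : 'rV[R]_N, sqn sigma = 1.
Proof.
exists (delta_mx 0 (Ordinal N0)); rewrite /sqn (bigD1 (Ordinal N0))//= mxE !eqxx.
by rewrite expr1n big1 ?addr0// => j jn; rewrite mxE (negbTE jn) andbF expr0n.
Qed.

Lemma boundary_cvg u sigma : {within cl, continuous u} -> sqn sigma = 1 ->
  u (hs_point sigma t) @[t --> (0 : R)^'+] --> u (hs_point sigma 0).
Proof.
move=> cu s1; have /subspace_continuousP/(_ _ (closure_hs0 s1)) cw := cu.
move=> A /cw; rewrite /within /= => H.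
have c0 : hs_point sigma t @[t --> (0 : R)^'+] --> (hs_point sigma 0 : 'rV[R]_(N + 1)).
  by apply: cvg_at_right_filter; exact: hs_continuous.
have := c0 _ H; rewrite /nbhs /= => H'.
have tb : \forall t \near (0 : R)^'+, 0 < t < pi / 2.
  by near=> t; apply/andP; split; near: t; [exact: nbhs_right_gt|exact: nbhs_right_lt].
apply: filterS2 H' tb => t At /andP[t0 t1]; apply: At; apply: closure_hs => //.
by rewrite !ltW.
Unshelve. all: by end_near. Qed.

(** The weight is nonnegative, so k' > 0 on some (0, e) and k is strictly increasing there. As k may
    have no derivative at 0, the contradiction passes through two interior points: k 0 <= k (e / 3)
    < k (e / 2) <= k 0. *)
Lemma increasing_near0 (s l b : R) (k : R -> R) : 0 < b -> 0 < l ->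
  (forall t : R, 0 < t < b -> derivable k t 1) ->
  sin t `^ (1 - 2 * s) * derive1 k t @[t --> (0 : R)^'+] --> l ->
  k t @[t --> (0 : R)^'+] --> k 0 ->
  (forall t, 0 < t < b -> k t <= k 0) -> False.
Proof.
move=> b0 l0 dk kl k0 kmax.
have : \forall t \near (0 : R)^'+, 0 < derive1 k t.
  apply: filterS (cvgr_gt _ kl _ l0) => t H.
  rewrite ltNge; apply/negP => d0; move: H.
  by rewrite ltNge mulr_ge0_le0// powR_ge0.
move=> /nbhs_ballP[d /= d0 dP].
pose e := Num.min b d.
have e0 : 0 < e by rewrite lt_min b0.
have eb : e <= b by rewrite ge_min lexx.
have ed : e <= d by rewrite ge_min lexx orbT.
have inc : {in `]0, e[%R &, {homo k : x y / x < y}}.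
  apply: gtr0_derive1_lt_oo => [t|t|t].
  - by rewrite in_itv/= => /andP[t0 te]; apply: dk; rewrite t0 (lt_le_trans te).
  - rewrite in_itv/= => /andP[t0 te]; apply: dP => //.
    by rewrite /= -ball_normE/= sub0r normrN gtr0_norm// (lt_le_trans te).
  - rewrite inE/= in_itv/= => /andP[t0 te].
    apply: differentiable_continuous; apply/derivable1_diffP; apply: dk.
    by rewrite t0 (lt_le_trans te).
have h1 : k (e / 3) < k (e / 2).
  by apply: inc; rewrite ?in_itv/=; lra.
have h2 : k (e / 2) <= k 0 by apply: kmax; lra.
have h3 : k 0 <= k (e / 3).
  apply: (cvgr_to_le k0); have e3 : 0 < e / 3 by rewrite divr_gt0.
  near=> t; have t0 : 0 < t by near: t; exact: nbhs_right_gt.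
  have te : t < e / 3 by near: t; exact: nbhs_right_lt.
  by apply/ltW/inc; rewrite ?in_itv/= ?t0//=; lra.
by have := le_lt_trans h3 (lt_le_trans h1 h2); rewrite ltxx.
Unshelve. all: by end_near. Qed.

Lemma no_boundary_max s u sigma l : {within cl, continuous u} -> C2_on upper (ext u) ->
  sqn sigma = 1 -> conormal_quot s u sigma t @[t --> (0 : R)^'+] --> l -> 0 < l ->
  (forall x, cl x -> u x <= u (hs_point sigma 0)) -> False.
Proof.
move=> cu CU s1 ul l0 umax.
apply: (@increasing_near0 s l (pi / 2) (fun t => u (hs_point sigma t)) pi20 l0).
- by move=> t tb; exact: (derivable_d_phi CU s1 tb (@ltr01 R)).
- exact: ul.
- exact: boundary_cvg.
- move=> t /andP[t0 t1]; apply: umax; apply: closure_hs => //.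
  by rewrite !ltW.
Qed.

Lemma conormal_quot_lin s a b u v sigma l1 l2 : C2_on upper (ext u) ->
  C2_on upper (ext v) -> sqn sigma = 1 ->
  conormal_quot s u sigma t @[t --> (0 : R)^'+] --> l1 ->
  conormal_quot s v sigma t @[t --> (0 : R)^'+] --> l2 ->
  conormal_quot s (fun x => a * u x + b * v x) sigma t @[t --> (0 : R)^'+]
    --> a * l1 + b * l2.
Proof.
move=> CU CV s1 h1 h2.
have H : \forall t \near (0 : R)^'+, a * conormal_quot s u sigma t +
    b * conormal_quot s v sigma t = conormal_quot s (fun x => a * u x + b * v x) sigma t.
  near=> t; have tb : 0 < t < pi / 2.
    by apply/andP; split; near: t; [exact: nbhs_right_gt|exact: nbhs_right_lt].
  have d1 := derivableP (derivable_d_phi CU s1 tb (@ltr01 R)).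
  have d2 := derivableP (derivable_d_phi CV s1 tb (@ltr01 R)).
  have d := is_deriveD (is_deriveZ a d1) (is_deriveZ b d2).
  rewrite /conormal_quot /d_phi !derive1E.
  have -> : 'D_1 (fun t => a * u (hs_point sigma t) + b * v (hs_point sigma t)) t =
    a * 'D_1 (fun t => u (hs_point sigma t)) t + b * 'D_1 (fun t => v (hs_point sigma t)) t.
    exact: (@derive_val _ _ _ _ _ _ _ d).
  by ring.
have h : a * conormal_quot s u sigma t + b * conormal_quot s v sigma t
    @[t --> (0 : R)^'+] --> a * l1 + b * l2.
  by apply: cvgD; apply: cvgMl_tmp.
exact: cvg_trans (near_eq_cvg H) h.
Unshelve. all: by end_near. Qed.

Lemma continuous_lin a b u v : {within cl, continuous u} -> {within cl, continuous v} ->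
  {within cl, continuous (fun x => a * u x + b * v x)}.
Proof.
move=> cu cv; rewrite (_ : (fun x => _) = (a \*: u) \+ (b \*: v))//.
move=> x; apply: continuousD.
  by apply: continuousZl_tmp; exact: cu.
by apply: continuousZl_tmp; exact: cv.
Qed.

(** The strong minimum principle settles the interior; if u vanishes there, continuity along
    meridians gives the boundary. *)
Lemma minimum_dichotomy s kappa u : 0 < s < 1 -> 0 <= kappa ->
  {within cl, continuous u} -> C2_on upper (ext u) -> (forall x, cl x -> 0 <= u x) ->
  (forall x, upper x -> LE s (ext u) x <= kappa * (ext u x / sqn x)) ->
  (forall x, half_sphere x -> 0 < u x) \/ (forall x, cl x -> u x = 0).
Proof.
move=> s01 kappa0 cu CU u0 LU.
have ucl (x : 'rV[R]_(N + 1)) : upper x -> half_sphere (radial_proj x) by move=> ux; exact: ((upper_radial N0 x).2 ux).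
have hid (x : 'rV[R]_(N + 1)) : half_sphere x -> radial_proj x = x /\ upper x.
  by move=> /(half_sphereP N0)[x1 ux]; rewrite radial_proj_id.
have [[x1 hx1 ux1]|nopos] := pselect (exists2 x, half_sphere x & 0 < u x).
  left=> x hx; have [rx ux] := hid x hx; have [rx1 ux1'] := hid x1 hx1.
  rewrite -rx -[u _]/(ext u x).
  apply: (@strong_minimum _ _ s kappa (ext u) x1 x s01 kappa0 CU _ LU ux1' _ ux).
    by move=> y uy; apply: u0; apply: subset_closure; exact: ucl.
  by rewrite /= rx1.
right=> x clx.
have half0 (y : 'rV[R]_(N + 1)) : half_sphere y -> u y = 0.
  move=> hy; apply/eqP; rewrite eq_le u0 ?andbT; last exact: subset_closure.
  by rewrite leNgt; apply/negP => uy; apply: nopos; exists y.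
have [hx|nhx] := pselect (half_sphere x); first exact: half0.
have [sigma s1 ->] := closure_boundary clx nhx.
have H : \forall t \near (0 : R)^'+, (0 : R) = u (hs_point sigma t).
  near=> t; rewrite half0//; apply/(half_sphereP N0); split; first exact: sqn_hs.
  apply: hs_upper; apply/andP; split; first by near: t; exact: nbhs_right_gt.
  by apply: ltW; near: t; exact: nbhs_right_lt.
have h0 : u (hs_point sigma t) @[t --> (0 : R)^'+] --> (0 : R).
  exact: cvg_trans (near_eq_cvg H) (cvg_cst _).
exact: cvg_unique (boundary_cvg cu s1) h0.
Unshelve. all: by end_near. Qed.

Lemma eigen_lin s mu1 mu2 a b u v x : eigen s mu1 u -> eigen s mu2 v -> upper x ->
  LE s (ext (fun x => a * u x + b * v x)) x =
  - (a * mu1 * ext u x + b * mu2 * ext v x) / sqn x.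
Proof.
move=> [CU UE] [CV VE] ux.
have E : LE s (ext (fun x => a * u x + b * v x)) x = a * LE s (ext u) x + b * LE s (ext v) x.
  exact: (LE_lin s a b CU CV ux).
have hu := UE x ux; have hv := VE x ux.
have {}hu : LE s (ext u) x = - (mu1 * (ext u x / sqn x)) by apply/eqP; rewrite -addr_eq0 hu.
have {}hv : LE s (ext v) x = - (mu2 * (ext v x / sqn x)) by apply/eqP; rewrite -addr_eq0 hv.
by rewrite E hu hv; ring.
Qed.

(** The minus sign in [conormal] and eps = 1 cancel: the quotient has a limit of the same sign as
    the boundary value. *)
Lemma EE_conormal s p w sigma : EE s p 1 w -> sqn sigma = 1 ->
  conormal_quot s w sigma t @[t --> (0 : R)^'+] -->
  `|w (hs_point sigma 0)| `^ (p - 1) * w (hs_point sigma 0).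
Proof.
move=> /(EE_iff N0)[_ _ Bw] s1; have [hw] := Bw sigma s1.
rewrite mul1r /conormal => /eqP; rewrite addrC subr_eq0 => /eqP ->; exact: hw.
Qed.

End boundary.

(** * The case of nonpositive Lambda, and the function (sin phi)^(2s) *)

Section uniqueness.
Context {R : realType} {N : nat}.
Hypothesis N0 : (0 < N)%N.
Variables (s p : R).
Hypotheses (s01 : 0 < s < 1) (p1 : 1 < p).
Implicit Types (u w v : 'rV[R]_(N + 1) -> R).
Local Notation cl := (closure (@half_sphere R N)).
Local Notation ext v := (v \o @radial_proj R (N + 1)).
Local Notation Lam := (@Lambda R N s p).
Let s0 : 0 < s. Proof. by case/andP: s01. Qed.

Let pi20 : 0 < pi / 2 :> R. Proof. by rewrite divr_gt0// pi_gt0. Qed.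

Lemma cl_radial (x : 'rV[R]_(N + 1)) : upper x -> cl (radial_proj x).
Proof. by move=> ux; apply: subset_closure; exact: ((upper_radial N0 x).2 ux). Qed.

(** An interior zero forces u to vanish identically, so in every case there is a zero on the
    boundary, where the Neumann condition can be used. *)
Lemma boundary_zero kappa u P : 0 <= kappa ->
  {within cl, continuous u} -> C2_on upper (ext u) -> (forall x, cl x -> 0 <= u x) ->
  (forall x, upper x -> LE s (ext u) x <= kappa * (ext u x / sqn x)) ->
  cl P -> u P = 0 -> exists2 sigma, sqn sigma = 1 & u (hs_point sigma 0) = 0.
Proof.
move=> kappa0 cu CU u0 LU clP uP.
have [upos|uz] := minimum_dichotomy N0 s01 kappa0 cu CU u0 LU.
  have [|sigma s1 PE] := closure_boundary N0 clP.
    by move=> /upos; rewrite uP ltxx.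
  by exists sigma; rewrite -?PE.
have [sigma s1] := @boundary_point_ex R N N0; exists sigma => //.
by apply: uz; exact: closure_hs0.
Qed.

Lemma EE_parts w : EE s p 1 w ->
  [/\ {within cl, continuous w}, eigen s Lam w & C2_on upper (ext w)].
Proof. by move=> /(EE_iff N0)[cw wE _]; split=> //; case: wE. Qed.

Lemma eigen_cst (c : R) : eigen s 0 (cst c : 'rV[R]_(N + 1) -> R).
Proof.
split=> [|x ux]; first exact: (C2_on_cst (@upper_open R N) c).
by rewrite mul0r addr0; exact: LE_cst.
Qed.

Lemma EE_nonpos w : Lam <= 0 -> EE s p 1 w -> forall x, cl x -> w x <= 0.
Proof.
move=> Lam0 wEE; have [cw wE CW] := EE_parts wEE.
have [P PK maxP] : exists2 c, c \in cl & forall t, t \in cl -> w t <= w c.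
  by apply: EVT_max_rV => //; [exact: closure_neq0|exact: closure_compact].
have clP := set_mem PK.
suff : w P <= 0 by move=> wP x clx; apply: le_trans wP; apply: maxP; exact/mem_set.
rewrite leNgt; apply/negP => M0; set M := w P in maxP M0.
pose u := fun x => 1 * (cst M : 'rV[R]_(N + 1) -> R) x + -1 * w x.
have uE x : u x = M - w x by rewrite /u mul1r mulN1r.
have cu : {within cl, continuous u}.
  by apply: continuous_lin => // ?; exact: cst_continuous.
have CU : C2_on upper (ext u) := C2_on_lin 1 (-1) (eigen_cst M).1 CW.
have u0 x : cl x -> 0 <= u x by move=> clx; rewrite uE subr_ge0 maxP//; exact/mem_set.
(* A_s (M - w) = Lam w = Lam M - Lam u with Lam M <= 0. This zero-order term is the reason for
   [kappa] in the minimum principle. *)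
have LU x : upper x -> LE s (ext u) x <= - Lam * (ext u x / sqn x).
  move=> ux; rewrite (eigen_lin 1 (-1) (eigen_cst M) wE ux) [X in _ <= X]mulrA.
  rewrite ler_wpM2r ?invr_ge0 ?sqn_ge0//.
  rewrite -[ext u x]/(u (radial_proj x)) uE /=.
  by move: Lam Lam0 => L L0; nra.
have kappa0 : 0 <= - Lam by rewrite oppr_ge0.
have uP : u P = 0 by rewrite uE subrr.
have [sigma s1 us] := boundary_zero kappa0 cu CU u0 LU clP uP.
have wM : w (hs_point sigma 0) = M.
  by move/eqP: us; rewrite uE subr_eq0 => /eqP.
have wl := EE_conormal N0 wEE s1; rewrite wM in wl.
apply: (no_boundary_max cw CW s1 wl).
  by rewrite mulr_gt0// powR_gt0// gtr0_norm.
by move=> x clx; rewrite wM; apply: maxP; exact/mem_set.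
Qed.

(** The boundary nonlinearity is odd. The summand 0 w lets the lemmas on two-term combinations
    apply. *)
Lemma EE_opp w : EE s p 1 w -> EE s p 1 (fun x => -1 * w x + 0 * w x).
Proof.
move=> wEE; have [cw wE CW] := EE_parts wEE.
apply/(EE_iff N0); split; first exact: continuous_lin.
  split=> [|x ux]; first exact: (C2_on_lin (-1) 0 CW CW).
  by rewrite (eigen_lin (-1) 0 wE wE ux) /=; ring.
move=> sigma s1; have wl := EE_conormal N0 wEE s1.
have [h ->] := conormal_cvgP (@conormal_quot_lin R N s (-1) 0 w w sigma _ _ CW CW s1 wl wl).
split=> //; move: (w (hs_point sigma 0)) => a.
by rewrite !mul0r !addr0 !mulN1r normrN; ring.
Qed.

Lemma EE_trivial w : Lam <= 0 -> EE s p 1 w -> {in cl, w =1 cst 0}.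
Proof.
move=> Lam0 wEE x /set_mem clx; apply/eqP; rewrite eq_le EE_nonpos//=.
by have := EE_nonpos Lam0 (EE_opp wEE) clx; rewrite mul0r addr0 mulN1r oppr_le0.
Qed.

Definition hfun : 'rV[R]_(N + 1) -> R := hzonal s \o @zeta R N.

Lemma hfunE x : hfun x = zeta x `^ s. Proof. by rewrite /hfun /= /hzonal mul1r. Qed.

Lemma hfun_continuous : {within cl, continuous hfun}.
Proof. exact: (zonal_continuous N0 (@hzonalE R s) (hzonal_cvg0 s01)). Qed.

Lemma hfun_eigen : eigen s (2 * s * N%:R) hfun.
Proof.
apply: (eigen_coord N0).
  exact: (C2_zonal (@hzonalE R s) (@dhzonalE R s) (@ddhzonalC R s)).
move=> sigma phi s1 pb; rewrite hfunE.
rewrite (As_zonal N0 (@hzonalE R s) (@dhzonalE R s) s s1 pb) zeta_hs//.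
have sp : 0 < sin phi ^+ 2 by rewrite exprn_gt0// sin_gt0_pihalf.
by rewrite (hzonal_ode s N%:R sp); ring.
Qed.

Lemma hfun_boundary sigma : sqn sigma = 1 -> hfun (hs_point sigma 0) = 0.
Proof. by move=> s1; rewrite /hfun /= zeta_hs// sin0 expr0n (hzonal0 s01). Qed.

(** The powers of sin cancel exactly, leaving the quotient 2 s cos t. *)
Lemma hfun_conormal sigma : sqn sigma = 1 ->
  conormal_quot s hfun sigma t @[t --> (0 : R)^'+] --> 2 * s.
Proof.
move=> s1.
have H : \forall t \near (0 : R)^'+, 2 * s * cos t = conormal_quot s hfun sigma t.
  near=> t; have tb : 0 < t < pi / 2.
    by apply/andP; split; near: t; [exact: nbhs_right_gt|exact: nbhs_right_lt].
  have st : 0 < sin t by exact: sin_gt0_pihalf.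
  rewrite /conormal_quot (d_phi_zonal (@hzonalE R s) s1 tb) /dhzonal mul1r.
  have -> : (sin t ^+ 2) `^ (s - 1) = sin t `^ (2 * s - 2).
    by rewrite -powR_mulrn ?ltW// -powRrM mulrBr mulr1.
  have E : sin t `^ (1 - 2 * s) * sin t `^ (2 * s - 2) * sin t = 1.
    rewrite -{3}[sin t](powRr1 (ltW st)) -!powRD ?(gt_eqF st) ?implybT//.
    by rewrite (_ : 1 - 2 * s + (2 * s - 2) + 1 = 0) ?powRr0//; ring.
  by rewrite -[LHS]mulr1 -[X in _ * X = _]E; ring.
have h : 2 * s * cos t @[t --> (0 : R)^'+] --> 2 * s * cos (0 : R).
  by apply: cvgMl_tmp; apply: cvg_at_right_filter; exact: continuous_cos.
rewrite cos0 mulr1 in h.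
exact: cvg_trans (near_eq_cvg H) h.
Unshelve. all: by end_near. Qed.

End uniqueness.

Lemma powR_mono1 (R : realType) (a x y : R) : 0 < a -> 0 <= x -> x < y ->
  x `^ a < y `^ a.
Proof.
move=> a0 x0 xy; apply: gt0_ltr_powR => //; rewrite nnegrE//.
by rewrite ltW// (le_lt_trans x0).
Qed.

(** * Nonnegative solutions: triviality and comparison *)

Section nonnegative_solutions.
Context {R : realType} {N : nat}.
Hypothesis N0 : (0 < N)%N.
Variables (s p : R).
Hypotheses (s01 : 0 < s < 1) (p1 : 1 < p).
Implicit Types (u w v : 'rV[R]_(N + 1) -> R).
Local Notation cl := (closure (@half_sphere R N)).
Local Notation ext v := (v \o @radial_proj R (N + 1)).
Local Notation Lam := (@Lambda R N s p).
Local Notation h := (@hfun R N s).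
Let s0 : 0 < s. Proof. by case/andP: s01. Qed.

Lemma half_cl (x : 'rV[R]_(N + 1)) : half_sphere x -> cl x.
Proof. exact: subset_closure. Qed.

Lemma half_zeta (x : 'rV[R]_(N + 1)) : half_sphere x -> 0 < zeta x <= 1.
Proof. by move=> /(half_sphereP N0)[x1 ux]; rewrite zeta_gt0// zeta_le1. Qed.

Lemma hfun_gt0 (x : 'rV[R]_(N + 1)) : half_sphere x -> 0 < h x.
Proof. by move=> /half_zeta/andP[z0 _]; rewrite hfunE powR_gt0. Qed.

Lemma hfun_out (x : 'rV[R]_(N + 1)) : cl x -> ~ half_sphere x -> h x = 0.
Proof. by move=> clx /(closure_boundary N0 clx)[sg sg1 ->]; exact: hfun_boundary. Qed.

Lemma half_pole : exists x : 'rV[R]_(N + 1), half_sphere x.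
Proof.
have [sg sg1] := @boundary_point_ex R N N0; exists (hs_point sg (pi / 2)).
apply/(half_sphereP N0); split; first exact: sqn_hs.
by apply: hs_upper; rewrite lexx divr_gt0// pi_gt0.
Qed.

Lemma EEplus_trivial w : 2 * s * N%:R <= Lam -> EEplus s p 1 w ->
  {in cl, w =1 cst 0}.
Proof.
move=> LamN [wEE w_ge0]; have [cw wE CW] := EE_parts N0 wEE.
have hE := hfun_eigen N0 s; have Ch := hE.1.
(* Bounded above by w / h at a single interior point; its supremum belongs to it. *)
pose S := [set c | forall x, half_sphere x -> c * h x <= w x].
have S0 : S 0 by move=> x hx; rewrite mul0r w_ge0//; exact: half_cl.
have Sup c x : S c -> half_sphere x -> c <= w x / h x.
  by move=> Sc hx; rewrite ler_pdivlMr ?hfun_gt0//; exact: Sc.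
have hS : has_sup S.
  have [x hx] := half_pole.
  split; first by exists 0.
  by exists (w x / h x) => c Sc; exact: Sup.
pose c0 := sup S.
have c00 : 0 <= c0 by apply: sup_upper_bound.
have Sc0 : S c0.
  move=> x hx; rewrite -ler_pdivlMr ?hfun_gt0//; apply: sup_le_ub; first by exists 0.
  by move=> c Sc; exact: Sup.
pose u := fun x => 1 * w x + - c0 * h x.
have uE x : u x = w x - c0 * h x by rewrite /u mul1r mulNr.
have cu : {within cl, continuous u}.
  by apply: continuous_lin => //; exact: hfun_continuous.
have CU : C2_on upper (ext u) := C2_on_lin 1 (- c0) CW Ch.
have u_ge0 x : cl x -> 0 <= u x.
  move=> clx; rewrite uE; have [hx|nhx] := pselect (half_sphere x).
    by rewrite subr_ge0; exact: Sc0.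
  by rewrite hfun_out// mulr0 subr0 w_ge0.
(* Lam w - 2sN c0 h = (Lam - 2sN) w + 2sN (w - c0 h), a sum of nonnegative terms. *)
have LU x : upper x -> LE s (ext u) x <= 0.
  move=> ux; rewrite (eigen_lin 1 (- c0) wE hE ux).
  rewrite mulNr oppr_le0 divr_ge0 ?sqn_ge0//.
  have clx := cl_radial N0 ux.
  have hx : 0 <= h (radial_proj x) by rewrite hfunE powR_ge0.
  have := u_ge0 _ clx; rewrite uE /=.
  move: (w _) (h _) (w_ge0 _ clx) hx => a b a0 b0 ab.
  have h1 : 0 <= (Lam - 2 * s * N%:R) * a by rewrite mulr_ge0 ?subr_ge0.
  have h2 : 0 <= 2 * s * N%:R * (a - c0 * b) by rewrite mulr_ge0// !mulr_ge0// ltW.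
  move: h1 h2; move: Lam (2 * s * N%:R) => L K; nra.
have LU0 x : upper x -> LE s (ext u) x <= 0 * (ext u x / sqn x).
  by move=> ux; rewrite mul0r; exact: LU.
(* If u is positive inside, the Hopf bound u >= c h puts c0 + c in S, beyond its supremum. *)
have [upos|uz] := minimum_dichotomy N0 s01 (lexx 0) cu CU u_ge0 LU0.
  have [c c_gt0 cP] := Hopf_boundary N0 s01 cu CU u_ge0 LU upos.
  have : S (c0 + c).
    move=> x hx; have := cP x hx; rewrite -(hfunE s) uE; lra.
  by move/(sup_upper_bound hS); rewrite -/c0; lra.
have wh x : cl x -> w x = c0 * h x by move=> /uz/eqP; rewrite uE subr_eq0 => /eqP.
(* The conormal quotient of u is evaluated twice: its limit is 0 because u vanishes, and - 2 s c0 by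
   linearity, the limit for w being 0 because w vanishes on the boundary. *)
suff c00' : c0 = 0 by move=> x /set_mem /wh ->; rewrite c00' mul0r.
have [sg sg1] := @boundary_point_ex R N N0.
have w0 : w (hs_point sg 0) = 0.
  by rewrite wh; [rewrite hfun_boundary// mulr0|exact: closure_hs0].
have wl := EE_conormal N0 wEE sg1; rewrite w0 mulr0 in wl.
have hl := @hfun_conormal R N s sg sg1.
have ul := @conormal_quot_lin R N s 1 (- c0) w h sg _ _ CW Ch sg1 wl hl.
have zl : conormal_quot s (cst 0 : 'rV[R]_(N + 1) -> R) sg t @[t --> (0 : R)^'+] --> (0 : R).
  rewrite (_ : conormal_quot _ _ _ = cst 0); first exact: cvg_cst.
  by apply/funext => t; rewrite /conormal_quot /d_phi derive1_cst mulr0.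
have u0 : {in cl, cst 0 =1 u} by move=> x /set_mem/uz.
have ul0 : conormal_quot s u sg t @[t --> (0 : R)^'+] --> (0 : R).
  apply: cvg_trans zl; apply: near_eq_cvg.
  exact: (conormal_quot_ext s u0 sg1).
have /eqP : 1 * 0 + - c0 * (2 * s) = 0 by exact: cvg_unique ul ul0.
rewrite mulr0 add0r mulNr oppr_eq0 mulf_eq0 => /orP[/eqP//|].
by rewrite gt_eqF// mulr_gt0.
Qed.

Let cont_ratio w w1 : {within cl, continuous w} -> {within cl, continuous w1} ->
  (forall x, cl x -> 0 < w1 x) -> {within cl, continuous (fun x => w x / w1 x)}.
Proof.
move=> cw cw1 w1_gt0; rewrite continuous_subspace_in => x xcl.
apply: (@cvgM _ _ _ _ w (fun x => (w1 x)^-1)); first exact: cw.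
by apply: cvgV; [rewrite gt_eqF// w1_gt0//; exact: set_mem|exact: cw1].
Qed.

(* If w touches M w1 from below (e = 1) or from above (e = -1), it does so at a
   boundary point, where the sign of M^p - M contradicts the boundary conditions. *)
Lemma touching (e M : R) w w1 P : 0 <= Lam -> 0 < M ->
  (e = 1 \/ e = -1) -> 0 < e * (M `^ (p - 1) - 1) ->
  EE s p 1 w1 -> EE s p 1 w -> (forall x, cl x -> 0 < w1 x) ->
  (forall x, cl x -> e * w x <= e * (M * w1 x)) -> cl P -> w P = M * w1 P -> False.
Proof.
move=> Lam0 M0 e1 eM w1EE wEE w1_gt0 wM clP wP.
have [cw wE CW] := EE_parts N0 wEE; have [cw1 w1E CW1] := EE_parts N0 w1EE.
pose v := fun x => e * w x + - (e * M) * w1 x.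
pose u := fun x => - e * w x + e * M * w1 x.
have uE x : u x = e * (M * w1 x) - e * w x by rewrite /u; ring.
have vu x : v x = - u x by rewrite /v /u; ring.
have cu : {within cl, continuous u} by exact: continuous_lin.
have CU : C2_on upper (ext u) := C2_on_lin (- e) (e * M) CW CW1.
have cv : {within cl, continuous v} by exact: continuous_lin.
have CV : C2_on upper (ext v) := C2_on_lin e (- (e * M)) CW CW1.
have u_ge0 x : cl x -> 0 <= u x by move=> clx; rewrite uE subr_ge0 wM.
have LU x : upper x -> LE s (ext u) x <= 0 * (ext u x / sqn x).
  move=> ux; rewrite mul0r (eigen_lin (- e) (e * M) wE w1E ux).
  rewrite mulNr oppr_le0 divr_ge0 ?sqn_ge0//.
  rewrite (_ : _ + _ = Lam * u (radial_proj x)); last by rewrite /u /=; ring.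
  by rewrite mulr_ge0// u_ge0//; exact: cl_radial.
have uP : u P = 0 by rewrite uE wP subrr.
have [sg sg1 us] := boundary_zero N0 s01 (lexx 0) cu CU u_ge0 LU clP uP.
have clsg := closure_hs0 sg1.
have ws : w (hs_point sg 0) = M * w1 (hs_point sg 0).
  have e0 : e != 0 by case: e1 => ->; rewrite ?oner_neq0// oppr_eq0 oner_neq0.
  by apply: (mulfI e0); apply/eqP; rewrite eq_sym -subr_eq0 -uE us.
have wl := EE_conormal N0 wEE sg1; have w1l := EE_conormal N0 w1EE sg1.
have := @conormal_quot_lin R N s e (- (e * M)) w w1 sg _ _ CW CW1 sg1 wl w1l.
move: (w1_gt0 _ clsg); rewrite ws; move: (w1 _) => a a0 vl.
apply: (no_boundary_max cv CV sg1 vl).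
  (* With a the boundary value of w1, the limit for v is e (M^p - M) a^p, positive by hypothesis,
     although v is maximal there. *)
  rewrite !gtr0_norm ?mulr_gt0// powRM ?ltW//.
  rewrite (_ : _ + _ = e * (M `^ (p - 1) - 1) * (M * (a `^ (p - 1) * a))); last ring.
  by apply: mulr_gt0 => //; rewrite !mulr_gt0// powR_gt0.
by move=> x clx; rewrite !vu us oppr0 oppr_le0 u_ge0.
Qed.

Lemma EEplus_unique w w1 : 0 <= Lam -> EE s p 1 w1 -> (forall x, cl x -> 0 < w1 x) ->
  EEplus s p 1 w -> {in cl, w =1 cst 0} \/ {in cl, w =1 w1}.
Proof.
move=> Lam0 w1EE w1_gt0 [wEE w_ge0].
have [cw wE CW] := EE_parts N0 wEE; have [cw1 w1E CW1] := EE_parts N0 w1EE.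
have cr := cont_ratio cw cw1 w1_gt0.
have LW x : upper x -> LE s (ext w) x <= 0.
  move=> ux; have /eqP := wE.2 x ux; rewrite addr_eq0 => /eqP ->.
  rewrite oppr_le0 mulr_ge0// divr_ge0 ?sqn_ge0// w_ge0//; exact: cl_radial.
have LW0 x : upper x -> LE s (ext w) x <= 0 * (ext w x / sqn x).
  by move=> ux; rewrite mul0r; exact: LW.
have [wpos|wz] := minimum_dichotomy N0 s01 (lexx 0) cw CW w_ge0 LW0; last first.
  by left=> x /set_mem/wz.
right.
have [P PK maxP] : exists2 c, c \in cl &
    forall t, t \in cl -> w t / w1 t <= w c / w1 c.
  by apply: EVT_max_rV => //; [exact: closure_neq0|exact: closure_compact].
have [Q QK minQ] : exists2 c, c \in cl &
    forall t, t \in cl -> w c / w1 c <= w t / w1 t.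
  by apply: EVT_min_rV => //; [exact: closure_neq0|exact: closure_compact].
have clP := set_mem PK; have clQ := set_mem QK.
set M := w P / w1 P in maxP; set m := w Q / w1 Q in minQ.
have wPE : w P = M * w1 P by rewrite /M divfK// gt_eqF// w1_gt0.
have wQE : w Q = m * w1 Q by rewrite /m divfK// gt_eqF// w1_gt0.
have leM x : cl x -> w x <= M * w1 x.
  by move=> clx; rewrite -ler_pdivrMr ?w1_gt0// maxP//; exact/mem_set.
have gem x : cl x -> m * w1 x <= w x.
  by move=> clx; rewrite -ler_pdivlMr ?w1_gt0// minQ//; exact/mem_set.
have M1 : M <= 1.
  rewrite leNgt; apply/negP => M1.
  apply: (@touching 1 M w w1 P Lam0 _ _ _ w1EE wEE w1_gt0 _ clP wPE).
  - by lra.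
  - by left.
  - rewrite mul1r subr_gt0; have := @powR_mono1 R (p - 1) 1 M.
    by rewrite powR1 subr_gt0; apply.
  - by move=> x clx; rewrite !mul1r leM.
have m_ge0 : 0 <= m by rewrite divr_ge0 ?w_ge0// ltW// w1_gt0.
have m1 : 1 <= m.
  rewrite leNgt; apply/negP => m1; move: m_ge0; rewrite le_eqVlt => /predU1P[m0|m0].
    (* m = 0 is outside the scope of [touching]. Then w vanishes at Q on the boundary with zero
       conormal limit, while the Hopf bound c h <= w makes c h - w maximal at Q with limit 2 s c >
       0. *)
    have wQ : w Q = 0 by rewrite wQE -m0 mul0r.
    have [c c_gt0 cP] := Hopf_boundary N0 s01 cw CW w_ge0 LW wpos.
    have [|sg sg1 QE] := closure_boundary N0 clQ.
      by move=> /wpos; rewrite wQ ltxx.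
    have hE := hfun_eigen N0 s; have Ch := hE.1.
    pose v := fun x => c * h x + -1 * w x.
    have cv : {within cl, continuous v}.
      by apply: continuous_lin => //; exact: hfun_continuous.
    have CV : C2_on upper (ext v) := C2_on_lin c (-1) Ch CW.
    have wl := EE_conormal N0 wEE sg1; rewrite -QE wQ mulr0 in wl.
    have hl := @hfun_conormal R N s sg sg1.
    have vl := @conormal_quot_lin R N s c (-1) h w sg _ _ Ch CW sg1 hl wl.
    apply: (no_boundary_max cv CV sg1 vl).
      by rewrite mulr0 addr0 !mulr_gt0.
    move=> x clx; rewrite /v -QE wQ QE hfun_boundary// !mulr0 addr0 mulN1r.
    rewrite subr_le0; have [hx|nhx] := pselect (half_sphere x).
      by rewrite hfunE; exact: cP.
    by rewrite hfun_out// mulr0 w_ge0.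
  apply: (@touching (-1) m w w1 Q Lam0 m0 _ _ w1EE wEE w1_gt0 _ clQ wQE).
  - by right.
  - rewrite mulN1r opprB subr_gt0; have := @powR_mono1 R (p - 1) m 1.
    by rewrite powR1 subr_gt0; apply=> //; exact: ltW.
  - by move=> x clx; rewrite !mulN1r lerN2 gem.
move=> x /set_mem clx; apply/eqP; rewrite eq_le; apply/andP; split.
  by rewrite (le_trans (leM x clx))// ler_piMl// ltW// w1_gt0.
by apply: le_trans (gem x clx); rewrite ler_peMl// ltW// w1_gt0.
Qed.

End nonnegative_solutions.

(** * Hypergeometric functions *)

Section power_series.
Context {R : realType}.
Implicit Types (f g : nat -> R) (x : R).

(** Radius of convergence at least 1, in a form easily seen to be stable under differentiation and
    linear combinations. *)
Definition unit_disc_bounded f := forall x, 0 <= x < 1 ->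
  exists B, forall k, `|f k| * x ^+ k <= B.

(** (k + 1) t^k <= 1 + t + ... + t^k; the induction proves this multiplied by 1 - t. *)
Lemma natS_geometric_le (t : R) k : 0 <= t < 1 -> k.+1%:R * t ^+ k <= (1 - t)^-1.
Proof.
move=> /andP[t0 t1]; have t1' : 0 < 1 - t by rewrite subr_gt0.
suff H : k.+1%:R * t ^+ k * (1 - t) <= 1 - t ^+ k.+1.
  by rewrite -[leRHS]mul1r ler_pdivlMr// (le_trans H)// lerBlDr lerDl exprn_ge0.
elim: k => [|k IH]; first by rewrite expr0 expr1 mulr1 mul1r.
have a0 : 0 <= t ^+ k.+1 by rewrite exprn_ge0.
have a1 : t ^+ k.+1 <= 1 by rewrite exprn_ile1// ltW.
have -> : k.+2%:R * t ^+ k.+1 * (1 - t) =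
    t * (k.+1%:R * t ^+ k * (1 - t)) + t ^+ k.+1 * (1 - t).
  by rewrite -[k.+2%:R]natr1 [t ^+ k.+1]exprS; ring.
have := ler_wpM2l t0 IH; rewrite [t ^+ k.+2]exprS.
move: (t ^+ k.+1) a0 a1 => a a0 a1; nra.
Qed.

(** Boundedness at the midpoint r of x and 1 leaves the factor (x / r)^k, which absorbs the k + 1
    from differentiation. *)
Lemma unit_disc_bounded_diffs f : unit_disc_bounded f ->
  unit_disc_bounded (pseries_diffs f).
Proof.
move=> fb x /andP[x0 x1]; pose r := (1 + x) / 2.
have r01 : 0 <= r < 1 by rewrite /r; lra.
have r0 : 0 < r by rewrite /r; lra.
have [B BP] := fb r r01.
have B0 : 0 <= B by apply: le_trans (BP 0%N); rewrite mulr_ge0// exprn_ge0// ltW.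
have t01 : 0 <= x / r < 1.
  by rewrite divr_ge0 ?(ltW r0)//= ltr_pdivrMr// mul1r /r; lra.
exists (B / r * (1 - x / r)^-1) => k.
rewrite /pseries_diffs normrM ger0_norm//.
have -> : k.+1%:R * `|f k.+1| * x ^+ k =
    (`|f k.+1| * r ^+ k.+1 / r) * (k.+1%:R * (x / r) ^+ k).
  rewrite (expr_div_n x r) (exprSr r); have : r ^+ k != 0 by rewrite expf_neq0// gt_eqF.
  move: (r ^+ k) (x ^+ k) (k.+1%:R : R) => a b c a0.
  by field; rewrite a0 gt_eqF.
apply: ler_pM.
- by rewrite divr_ge0 ?(ltW r0)// mulr_ge0// exprn_ge0// ltW.
- by rewrite mulr_ge0// exprn_ge0//; case/andP: t01.
- by rewrite ler_wpM2r// invr_ge0 ltW.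
- exact: natS_geometric_le.
Qed.

Lemma unit_disc_bounded_lin a b f g : unit_disc_bounded f -> unit_disc_bounded g ->
  unit_disc_bounded (fun k => a * f k + b * g k).
Proof.
move=> fb gb x x01; have [B BP] := fb x x01; have [B' BP'] := gb x x01.
exists (`|a| * B + `|b| * B') => k.
have xk : 0 <= x ^+ k by rewrite exprn_ge0//; case/andP: x01.
apply: (@le_trans _ _ (`|a| * (`|f k| * x ^+ k) + `|b| * (`|g k| * x ^+ k))).
  by rewrite !mulrA -mulrDl ler_wpM2r// -!normrM ler_normD.
by rewrite lerD// ler_wpM2l.
Qed.

Lemma pseries_cvg f x : unit_disc_bounded f -> `|x| < 1 -> cvgn (pseries f x).
Proof.
move=> fb x1; pose r := (1 + `|x|) / 2.
have r01 : 0 <= r < 1 by rewrite /r; have := normr_ge0 x; lra.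
have r0 : 0 < r by rewrite /r; have := normr_ge0 x; lra.
have [B BP] := fb r r01.
have B0 : 0 <= B by apply: le_trans (BP 0%N); rewrite mulr_ge0// exprn_ge0// ltW.
apply: normed_cvg; apply: (@series_le_cvg _ _ (geometric B (`|x| / r))) => [k|k|k|] /=.
- exact: normr_ge0.
- by rewrite mulr_ge0// exprn_ge0// divr_ge0// ltW.
- rewrite normrM normrX (expr_div_n `|x| r) [leRHS]mulrA ler_pdivlMr ?exprn_gt0//.
  by rewrite mulrAC ler_wpM2r// exprn_ge0.
- apply: is_cvg_geometric_series.
  rewrite ger0_norm; last by rewrite divr_ge0// ltW.
  by rewrite ltr_pdivrMr// mul1r /r; have := normr_ge0 x; lra.
Qed.

Definition PS f x : R := limn (pseries f x).

Lemma is_derive_PS f x : unit_disc_bounded f -> `|x| < 1 ->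
  is_derive x 1 (PS f) (PS (pseries_diffs f) x).
Proof.
move=> fb x1; pose K := (1 + `|x|) / 2.
have K0 : 0 < K by rewrite /K; have := normr_ge0 x; lra.
have K1 : `|K| < 1 by rewrite gtr0_norm// /K; lra.
have f1 := unit_disc_bounded_diffs fb; have f2 := unit_disc_bounded_diffs f1.
apply: (@pseries_snd_diffs _ f K x); try exact: pseries_cvg.
by rewrite (gtr0_norm K0) /K; lra.
Qed.

Lemma PS_lin a b f g x : unit_disc_bounded f -> unit_disc_bounded g -> `|x| < 1 ->
  PS (fun k => a * f k + b * g k) x = a * PS f x + b * PS g x.
Proof.
move=> fb gb x1; apply/cvg_lim => //.
have -> : pseries (fun k => a * f k + b * g k) x =
    (fun n => a * pseries f x n + b * pseries g x n).
  apply/funext => n; rewrite /pseries /series /= !mulr_sumr -big_split/=.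
  by apply: eq_bigr => i _; ring.
by apply: cvgD; apply: cvgMl_tmp; exact: pseries_cvg.
Qed.

Lemma PS_shift f x : unit_disc_bounded (fun k => f k.+1) -> `|x| < 1 ->
  PS f x = f 0%N + x * PS (fun k => f k.+1) x.
Proof.
move=> fb x1; apply/cvg_lim => //; rewrite -cvg_shiftS.
have -> : [sequence pseries f x n.+1]_n =
    (fun n => f 0%N + x * pseries (fun k => f k.+1) x n).
  apply/funext => n; rewrite /pseries /series /= big_nat_recl//= expr0 mulr1.
  congr (_ + _); rewrite mulr_sumr; apply: eq_bigr => i _.
  by rewrite exprS; ring.
apply: cvgD; first exact: cvg_cst.
by apply: cvgMl_tmp; exact: pseries_cvg.
Qed.

Lemma PS_at0 f : unit_disc_bounded (fun k => f k.+1) -> PS f 0 = f 0%N.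
Proof. by move=> fb; rewrite PS_shift ?normr0// mul0r addr0. Qed.

Lemma PS_le f x : unit_disc_bounded f -> 0 <= x < 1 -> (forall k, f k <= 0) ->
  PS f x <= f 0%N.
Proof.
move=> fb /andP[x0 x1] f0; apply: limr_le.
  by apply: pseries_cvg => //; rewrite ger0_norm.
near=> n; have n0 : (0 < n)%N by near: n; exists 1%N.
rewrite -(prednK n0) /pseries /series /= big_nat_recl//= expr0 mulr1 gerDl.
by apply: sumr_le0 => i _; rewrite mulr_le0_ge0// exprn_ge0.
Unshelve. all: by end_near. Qed.

End power_series.

(** * The hypergeometric series *)

Section hypergeometric.
Context {R : realType}.
Variables (c s kappa : R).
Hypotheses (s01 : 0 < s < 1) (sc : s < c) (kappa0 : 0 < kappa) (kappac : kappa < c * s).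
Let s0 : 0 < s. Proof. by case/andP: s01. Qed.
Let s1 : s < 1. Proof. by case/andP: s01. Qed.
Let c0 : 0 < c. Proof. exact: lt_trans sc. Qed.

(* Coefficients of 2F1(a, b; c; x) with a + b = c - s and a b = - kappa. *)
Fixpoint hyp_coef (k : nat) : R :=
  if k is k'.+1 then
    hyp_coef k' * (k'%:R ^+ 2 + (c - s) * k'%:R - kappa) / ((c + k'%:R) * k'.+1%:R)
  else 1.

Let den k : 0 < (c + k%:R) * k.+1%:R :> R.
Proof. by rewrite mulr_gt0// ltr_wpDr. Qed.

Let num_gt0 k : 0 < k.+1%:R ^+ 2 + (c - s) * k.+1%:R - kappa :> R.
Proof.
have k1 : 1 <= k.+1%:R :> R by rewrite ler1n.
have cs : 0 < c - s by rewrite subr_gt0.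
(* This is the numerator at k = 1 with kappa replaced by its upper bound c s. *)
have h : 0 < (1 - s) * (1 + c) by rewrite mulr_gt0 ?subr_gt0// addr_gt0.
have := kappac; move: k1; move: (k.+1%:R : R) => a a1; nra.
Qed.

Let num_le k : k%:R ^+ 2 + (c - s) * k%:R - kappa <= (c + k%:R) * k.+1%:R :> R.
Proof.
rewrite -[k.+1%:R]natr1; have : 0 <= k%:R :> R by [].
by move: (k%:R : R) => a a0; have := s0; have := c0; have := kappa0; nra.
Qed.

(** Only the first ratio, - kappa / c, is negative; all later ones are positive. *)
Lemma hyp_coef_lt0 k : hyp_coef k.+1 < 0.
Proof.
elim: k => [|k IH].
  rewrite /= expr0n mulr0 !add0r mul1r addr0 mulr1 mulNr oppr_lt0.
  exact: divr_gt0.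
have E : hyp_coef k.+2 = hyp_coef k.+1 *
    ((k.+1%:R ^+ 2 + (c - s) * k.+1%:R - kappa) / ((c + k.+1%:R) * k.+2%:R)).
  by rewrite mulrA.
by rewrite E nmulr_rlt0// divr_gt0.
Qed.

(** All ratios have absolute value at most 1; at k = 0 this is kappa < c s < c. *)
Lemma hyp_coef_norm k : `|hyp_coef k| <= 1.
Proof.
elim: k => [|k IH]; first by rewrite normr1.
have -> : hyp_coef k.+1 = hyp_coef k *
    ((k%:R ^+ 2 + (c - s) * k%:R - kappa) / ((c + k%:R) * k.+1%:R)) by rewrite mulrA.
rewrite normrM mulr_ile1// normrM normfV (gtr0_norm (den k)) ler_pdivrMr// mul1r.
case: k {IH} => [|k]; last by rewrite gtr0_norm.
rewrite expr0n mulr0 !add0r addr0 mulr1 normrN gtr0_norm//.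
by have := s1; have := c0; have := kappac; nra.
Qed.

Lemma hyp_coef_bounded : unit_disc_bounded hyp_coef.
Proof.
move=> x /andP[x0 x1]; exists 1 => k.
by rewrite mulr_ile1 ?exprn_ge0 ?hyp_coef_norm// exprn_ile1// ltW.
Qed.

Let d1 := pseries_diffs hyp_coef.
Let d2 := pseries_diffs d1.
Let b0 := hyp_coef_bounded.
Let b1 : unit_disc_bounded d1 := unit_disc_bounded_diffs b0.
Let b2 : unit_disc_bounded d2 := unit_disc_bounded_diffs b1.

Definition hyp (x : R) := PS hyp_coef x.
Definition dhyp (x : R) := PS d1 x.
Definition ddhyp (x : R) := PS d2 x.

Lemma is_derive_hyp (x : R) : `|x| < 1 -> is_derive x 1 hyp (dhyp x).
Proof. exact: is_derive_PS. Qed.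

Lemma is_derive_dhyp (x : R) : `|x| < 1 -> is_derive x 1 dhyp (ddhyp x).
Proof. exact: is_derive_PS. Qed.

Lemma ddhyp_continuous (x : R) : `|x| < 1 -> {for x, continuous ddhyp}.
Proof.
move=> x1; apply: differentiable_continuous; apply/derivable1_diffP.
by case: (is_derive_PS b2 x1).
Qed.

(** The operator x d/dx on coefficients. *)
Let xf (f : nat -> R) k : R := k%:R * f k.

Let xf_bounded f : unit_disc_bounded f -> unit_disc_bounded (xf f).
Proof.
move=> fb x x01; have [B BP] := unit_disc_bounded_diffs fb x01.
have B0 : 0 <= B.
  by apply: le_trans (BP 0%N); rewrite mulr_ge0// exprn_ge0//; case/andP: x01.
exists B => -[|k]; first by rewrite /xf mul0r normr0 mul0r.
apply: le_trans (BP k); rewrite ler_wpM2l// exprS ler_piMl ?exprn_ge0//.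
  by case/andP: x01.
by apply: ltW; case/andP: x01.
Qed.

Let PS_xf f x : unit_disc_bounded f -> `|x| < 1 ->
  PS (xf f) x = x * PS (pseries_diffs f) x.
Proof.
move=> fb x1; rewrite PS_shift//; last exact: unit_disc_bounded_diffs.
by rewrite /xf mul0r add0r.
Qed.

Lemma hyp_ode (x : R) : `|x| < 1 ->
  x * (1 - x) * ddhyp x + (c - (c - s + 1) * x) * dhyp x + kappa * hyp x = 0.
Proof.
move=> x1.
have e1 : PS (xf d1) x = x * ddhyp x by exact: PS_xf.
have e2 : PS (xf hyp_coef) x = x * dhyp x by exact: PS_xf.
have b3 := xf_bounded b1; have b4 := xf_bounded b0.
pose g k : R := k%:R * (k%:R - 1) * hyp_coef k.
have gS : (fun k => g k.+1) = xf d1.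
  by apply/funext => k; rewrite /g /xf /d1 /pseries_diffs -natr1 addrK; ring.
have gb : unit_disc_bounded g.
  move=> y y01; have [B BP] := b3 y y01; have [B' BP'] := b4 y y01.
  have B0 : 0 <= B.
    by apply: le_trans (BP 0%N); rewrite mulr_ge0// exprn_ge0//; case/andP: y01.
  exists B => -[|k]; first by rewrite /g !mul0r normr0 mul0r.
  have -> : g k.+1 = xf d1 k by rewrite -gS.
  apply: le_trans (BP k); rewrite ler_wpM2l// exprS ler_piMl ?exprn_ge0//.
    by case/andP: y01.
  by apply: ltW; case/andP: y01.
have e3 : PS g x = x * (x * ddhyp x).
  by rewrite PS_shift ?gS// e1 /g !mul0r add0r.
have l1 := PS_lin 1 c b3 b1 x1.
have l2 := PS_lin 1 (c - s + 1) gb b4 x1.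
have gb' := unit_disc_bounded_lin 1 (c - s + 1) gb b4.
have l3 := PS_lin 1 (- kappa) gb' b0 x1.
(* The recursion for the coefficients: the left side represents x F'' + c F', while [g] represents
   x^2 F''. *)
have E : (fun k => 1 * xf d1 k + c * d1 k) =
    (fun k => 1 * (1 * g k + (c - s + 1) * xf hyp_coef k) + - kappa * hyp_coef k).
  apply/funext => k; rewrite /g /xf /d1 /pseries_diffs /=.
  have D1 : c + k%:R != 0 by rewrite gt_eqF// ltr_wpDr.
  by rewrite -[k.+1%:R]natr1; field; rewrite D1 natr1 pnatr_eq0.
rewrite E l3 l2 e3 e2 e1 in l1.
by move: l1; rewrite -/(dhyp x) -/(hyp x); move: (dhyp x) (ddhyp x) (hyp x) => F1 F2 F l1; nra.
Qed.

Lemma hyp0 : hyp 0 = 1.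
Proof.
rewrite /hyp PS_at0// => x /andP[x0 x1]; exists 1 => k.
by rewrite mulr_ile1 ?exprn_ge0 ?hyp_coef_norm// exprn_ile1// ltW.
Qed.

Lemma dhyp_lt0 x : 0 <= x < 1 -> dhyp x < 0.
Proof.
move=> x01; apply: (@le_lt_trans _ _ (d1 0%N)).
  by apply: PS_le => // k; rewrite /d1 /pseries_diffs mulr_ge0_le0// ltW ?hyp_coef_lt0.
by rewrite /d1 /pseries_diffs mul1r hyp_coef_lt0.
Qed.

End hypergeometric.

Lemma right_decrease (R : realType) (f : R -> R) (t d b : R) : t < b ->
  is_derive t 1 f d -> d < 0 -> exists2 u, t < u < b & f u < f t.
Proof.
move=> tb [fd fdE] d0.
have : h^-1 *: (f (h *: 1 + t) - f t) @[h --> (0 : R)^'] --> d by rewrite -fdE; exact: fd.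
move=> /cvgr_lt/(_ _ d0)/nbhs_ballP[e /= e0 eP].
pose h := Num.min (e / 2) ((b - t) / 2).
have bt : 0 < b - t by rewrite subr_gt0.
have h0 : 0 < h by rewrite lt_min !divr_gt0.
have he : h < e by rewrite gt_min; apply/orP; left; lra.
have hb : h < b - t by rewrite gt_min; apply/orP; right; lra.
exists (h + t); first lra.
have := eP h; rewrite /= -ball_normE/= sub0r normrN gtr0_norm// => /(_ he).
rewrite gt_eqF// => /(_ isT); rewrite [h%:A]mulr1 -[_ *: _]/(_ * _).
by rewrite pmulr_rlt0 ?invr_gt0// subr_lt0.
Qed.

(** * Positivity and boundary behaviour of the zonal solution *)

Section hypergeometric_boundary.
Context {R : realType}.
Variables (c s kappa : R) (n : nat).
Hypotheses (s01 : 0 < s < 1) (sc : s < c) (kappa0 : 0 < kappa) (kappac : kappa < c * s).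
Hypothesis cn : c <= n%:R.
Let s0 : 0 < s. Proof. by case/andP: s01. Qed.
Let s1 : s < 1. Proof. by case/andP: s01. Qed.
Let c0 : 0 < c. Proof. exact: lt_trans sc. Qed.

(** With t = zeta, the pole t = 1 becomes the centre of the series; the disc of convergence
    corresponds to 0 < t < 2, so t = 1 needs no one-sided derivatives. *)
Definition Gz (t : R) : R := hyp c s kappa (1 - t).
Definition dGz (t : R) : R := - dhyp c s kappa (1 - t).
Definition ddGz (t : R) : R := ddhyp c s kappa (1 - t).

Let norm1 (t : R) : 0 < t < 2 -> `|1 - t| < 1.
Proof. by move=> t02; rewrite ltr_norml; lra. Qed.

Let d1m (t : R) : is_derive t 1 (fun t => 1 - t) (-1).
Proof.
have := is_deriveB (is_derive_cst (1 : R) t 1) (is_derive_id t (1 : R)).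
by move/is_derive_eq; apply; rewrite sub0r.
Qed.

Lemma is_derive_Gz (t : R) : 0 < t < 2 -> is_derive t 1 Gz (dGz t).
Proof.
move=> t02; have d := is_derive_hyp s01 sc kappa0 kappac (norm1 t02).
have := @is_derive1_comp _ (hyp c s kappa) (fun t => 1 - t) t _ _ d (d1m t).
by move/is_derive_eq; apply; rewrite mulrN1.
Qed.

Lemma is_derive_dGz (t : R) : 0 < t < 2 -> is_derive t 1 dGz (ddGz t).
Proof.
move=> t02; have d := is_derive_dhyp s01 sc kappa0 kappac (norm1 t02).
have := is_deriveN (@is_derive1_comp _ (dhyp c s kappa) (fun t => 1 - t) t _ _ d (d1m t)).
by move/is_derive_eq; apply; rewrite mulrN1 opprK.
Qed.

Lemma ddGz_continuous (t : R) : 0 < t < 2 -> {for t, continuous ddGz}.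
Proof.
move=> t02; have -> : ddGz = ddhyp c s kappa \o (fun t => 1 - t) by [].
apply: continuous_comp.
  by apply: differentiable_continuous; apply/derivable1_diffP; case: (d1m t).
exact: (ddhyp_continuous s01 sc kappa0 kappac (norm1 t02)).
Qed.

Lemma Gz_ode (t : R) : 0 < t < 2 ->
  t * (1 - t) * ddGz t + ((1 - s) - (c + 1 - s) * t) * dGz t + kappa * Gz t = 0.
Proof.
move=> t02; rewrite -(hyp_ode s01 sc kappa0 kappac (norm1 t02)) /Gz /dGz /ddGz.
by ring.
Qed.

Lemma Gz1 : Gz 1 = 1.
Proof. by rewrite /Gz subrr (hyp0 s01 sc kappa0 kappac). Qed.

Lemma dGz_gt0 t : 0 < t <= 1 -> 0 < dGz t.
Proof.
move=> t01; rewrite /dGz oppr_gt0; apply: (dhyp_lt0 s01 sc kappa0 kappac).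
by lra.
Qed.

Let Gc (t : R) : 0 < t < 2 -> {for t, continuous Gz}.
Proof.
move=> t02; apply: differentiable_continuous; apply/derivable1_diffP.
by case: (is_derive_Gz t02).
Qed.

Lemma Gz_mono x y : 0 < x -> x <= y -> y <= 1 -> Gz x <= Gz y.
Proof.
move=> x0 xy y1.
have : {in `[x, 1]%R &, {homo Gz : u v / u <= v >-> u <= v}}.
  apply: ger0_derive1_le_cc => [t|t|].
  - rewrite in_itv/= => /andP[xt t1]; have [] // := @is_derive_Gz t; lra.
  - rewrite in_itv/= => /andP[xt t1].
    have t02 : 0 < t < 2 by lra.
    have H := is_derive_Gz t02; rewrite derive1E derive_val ltW// dGz_gt0//; lra.
  - apply: continuous_in_subspaceT => t; rewrite inE/= in_itv/= => /andP[xt t1].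
    by apply: Gc; lra.
by apply => //; rewrite in_itv/=; lra.
Qed.

(* w solves the first-order equation w_ode and w 1 > 0; excluding a nonpositive interior
   minimum of w gives G > 0, and then (1 - t)^n w, being decreasing, bounds G from below
   near 0. *)
Let w (t : R) := s * Gz t - t * dGz t.
Let dw (t : R) := s * dGz t - (dGz t + t * ddGz t).

Let wE (t : R) : 0 < t < 2 -> is_derive t 1 w (dw t).
Proof.
move=> t02; have a1 := is_deriveZ s (is_derive_Gz t02).
have a2 := is_deriveM (is_derive_id t (1 : R)) (is_derive_dGz t02).
have := is_deriveB a1 a2; move/is_derive_eq; apply.
by rewrite /dw /GRing.scale /=; ring.
Qed.

Let wc (t : R) : 0 < t < 2 -> {for t, continuous w}.
Proof.
move=> t02; apply: differentiable_continuous; apply/derivable1_diffP.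
by case: (wE t02).
Qed.

(** s - t d/dt annihilates t^s, the other exponent at t = 0; combined with the second-order equation
    it leaves no derivative of G. *)
Let w_ode (t : R) : 0 < t < 2 -> (1 - t) * dw t = c * w t - (c * s - kappa) * Gz t.
Proof.
move=> t02; have := Gz_ode t02; rewrite /dw /w.
by move: (Gz t) (dGz t) (ddGz t) => a b d H; nra.
Qed.

(** At t = 1 the equation for w degenerates to c w(1) = c s - kappa. *)
Let w1 : 0 < w 1.
Proof.
have t02 : 0 < (1 : R) < 2 by lra.
have := w_ode t02; rewrite subrr mul0r Gz1 mulr1 => /esym/eqP; rewrite subr_eq0.
move=> /eqP E; have : 0 < c * w 1 by rewrite E subr_gt0.
by rewrite pmulr_rgt0.
Qed.

(** By the equation, w' < 0 at a minimum point of w on [t0, 1]. That point is not 1, since w(1) > 0,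
    so w decreases further to its right; the left endpoint is thus covered as well. *)
Let no_min t0 : 0 < t0 < 1 -> w t0 <= 0 ->
  (forall t, t0 <= t < 1 -> w t <= w t0 -> c * w t < (c * s - kappa) * Gz t) -> False.
Proof.
move=> /andP[t00 t01] wt0 H.
have [|tm] := @EVT_min R w t0 1 (ltW t01).
  apply: continuous_in_subspaceT => t; rewrite inE/= in_itv/= => /andP[xt t1].
  by apply: wc; lra.
rewrite in_itv/= => /andP[t0m tm1] tmP.
have wtm : w tm <= w t0 by apply: tmP; rewrite in_itv/= lexx ltW.
have tm1' : tm < 1.
  rewrite lt_neqAle tm1 andbT; apply/eqP => E.
  by move: wtm; rewrite E; have := w1; lra.
have tm02 : 0 < tm < 2 by lra.
have dwm : dw tm < 0.
  have h : 0 < 1 - tm by lra.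
  have h2 : c * w tm < (c * s - kappa) * Gz tm by apply: H; rewrite ?t0m.
  rewrite -(pmulr_rlt0 _ h) (w_ode tm02); lra.
have [u /andP[tu u1] wu] := right_decrease tm1' (wE tm02) dwm.
have : w tm <= w u by apply: tmP; rewrite in_itv/=; lra.
by rewrite leNgt wu.
Qed.

(** At a zero z of G, w = - z G' < 0, while G >= 0 to the right of z by monotonicity; [no_min]
    excludes this. *)
Lemma Gz_gt0 t : 0 < t <= 1 -> 0 < Gz t.
Proof.
move=> /andP[t0 t1]; rewrite ltNge; apply/negP => Gt.
have [||z] := @IVT R Gz t 1 0 t1.
- apply: continuous_in_subspaceT => v; rewrite inE/= in_itv/= => /andP[xt v1].
  by apply: Gc; lra.
- by rewrite Gz1 ge_min Gt/= le_max ler01 orbT.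
rewrite in_itv/= => /andP[tz z1] Gz0.
have z1' : z < 1.
  by rewrite lt_neqAle z1 andbT; apply/eqP => E; move: Gz0; rewrite E Gz1; lra.
have z0 : 0 < z by lra.
have wz : w z < 0.
  by rewrite /w Gz0 mulr0 sub0r oppr_lt0 mulr_gt0// dGz_gt0// z0 ltW.
apply: (@no_min z); rewrite ?z0 ?ltW// => v /andP[zv v1] wv.
have Gv : 0 <= Gz v by rewrite -Gz0 Gz_mono// ltW.
have h1 : c * w v < 0 by rewrite pmulr_rlt0//; lra.
by apply: (lt_le_trans h1); rewrite mulr_ge0// subr_ge0 ltW.
Qed.

Let w_gt0 t : 0 < t <= 1 -> 0 < w t.
Proof.
move=> /andP[t0 t1]; rewrite ltNge; apply/negP => wt.
have t1' : t < 1.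
  by rewrite lt_neqAle t1 andbT; apply/eqP => E; move: wt w1; rewrite E; lra.
apply: (@no_min t); rewrite ?t0// => v /andP[tv v1] wv.
have Gv : 0 < Gz v by apply: Gz_gt0; lra.
have h1 : c * w v <= 0 by rewrite pmulr_rle0//; lra.
by apply: (le_lt_trans h1); rewrite mulr_gt0// subr_gt0.
Qed.

Let n_gt0 : (0 < n)%N.
Proof. by rewrite lt0n; apply/eqP => n0; move: cn c0; rewrite n0; lra. Qed.

Let y (t : R) := (1 - t) ^+ n * w t.

(** The derivative is (1 - t)^(n - 1) ((c - n) w - (c s - kappa) G), and c <= n. An integer n keeps
    the power polynomial. *)
Let y_decr a b : 0 < a -> a <= b -> b < 1 -> y b <= y a.
Proof.
move=> a0 ab b1.
have yE (t : R) : 0 < t < 1 -> is_derive t 1 y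
    ((1 - t) ^+ n * dw t - n%:R * (1 - t) ^+ n.-1 * w t).
  move=> t01; have t02 : 0 < t < 2 by lra.
  have X := is_deriveX n (d1m t); rewrite exprfctE in X.
  have := is_deriveM X (wE t02); move/is_derive_eq; apply.
  by rewrite /GRing.scale /=; ring.
have : {in `]0, 1[%R &, {homo y : u v /~ u <= v}}.
  apply: ler0_derive1_le_oo => [t|t|t].
  - by rewrite in_itv/= => /yE[].
  - rewrite in_itv/= => t01; have H := yE t t01; rewrite derive1E derive_val.
    have t02 : 0 < t < 2 by lra.
    rewrite -{1}(prednK n_gt0) exprSr -mulrA (w_ode t02).
    rewrite (_ : _ - _ = (1 - t) ^+ n.-1 *
      (c * w t - (c * s - kappa) * Gz t - n%:R * w t)); last by ring.
    have t01' : 0 < t <= 1 by lra.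
    have e0 : 0 <= (1 - t) ^+ n.-1 by rewrite exprn_ge0//; lra.
    rewrite mulr_ge0_le0//.
    have h1 : 0 < w t := w_gt0 t01'.
    have h2 : 0 < (c * s - kappa) * Gz t by rewrite mulr_gt0 ?subr_gt0// Gz_gt0.
    have h3 : 0 <= (n%:R - c) * w t by apply: mulr_ge0; [rewrite subr_ge0|exact: ltW].
    lra.
  - rewrite inE/= in_itv/= => /yE[yd _].
    by apply: differentiable_continuous; apply/derivable1_diffP.
by apply => //; rewrite in_itv/=; lra.
Qed.

(** For t <= 1/2, y(1/2) <= y(t) <= w(t) <= s G(t); beyond 1/2, G is monotone. *)
Lemma Gz_lower_bound : exists2 g0 : R, 0 < g0 & forall t, 0 < t <= 1 -> g0 <= Gz t.
Proof.
have h0 : 0 < (1 / 2 : R) <= 1 by lra.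
have y0 : 0 < y (1 / 2) by rewrite mulr_gt0 ?w_gt0// exprn_gt0//; lra.
exists (y (1 / 2) / s); first by rewrite divr_gt0.
have small t : 0 < t <= 1 / 2 -> y (1 / 2) / s <= Gz t.
  move=> t0; rewrite ler_pdivrMr//.
  have t01 : 0 < t <= 1 by lra.
  have yt : y (1 / 2) <= y t by apply: y_decr; lra.
  have w0 := w_gt0 t01.
  have yw : y t <= w t by rewrite ler_piMl ?(ltW w0)// exprn_ile1//; lra.
  have tt : 0 < t by lra.
  have dG0 : 0 < t * dGz t := mulr_gt0 tt (dGz_gt0 t01).
  apply: le_trans yt (le_trans yw _); rewrite [leRHS]mulrC lerBlDr.
  by rewrite lerDl ltW.
move=> t t01; have [th|th] := leP t (1 / 2).
  by apply: small; rewrite th andbT; case/andP: t01.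
apply: le_trans (small (1 / 2) _) (Gz_mono _ _ _); lra.
Qed.

Let tpow : t `^ (1 - s) @[t --> (0 : R)^'+] --> (0 : R).
Proof. by apply: powR_cvg0; rewrite subr_gt0. Qed.

Lemma Gz_cvg : exists2 l : R, 0 < l & Gz t @[t --> (0 : R)^'+] --> l.
Proof.
have [g0 g00 gP] := Gz_lower_bound.
have /cvg_ex[/= l Gl] : cvg (Gz t @[t --> (0 : R)^'+]).
  apply: nondecreasing_at_right_is_cvgr.
    near=> b; have b1 : b < 1 by near: b; exact: nbhs_right_lt.
    move=> u v; rewrite !in_itv/= => /andP[u0 ub] /andP[v0 vb] uv.
    by apply: Gz_mono => //; lra.
  near=> b; have b1 : b < 1 by near: b; exact: nbhs_right_lt.
  exists g0 => _ [u + <-]; rewrite /= in_itv/= => /andP[u0 ub].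
  by apply: gP; lra.
exists l => //; apply: (lt_le_trans g00); apply: (cvgr_to_ge Gl); near=> t.
apply: gP; apply/andP; split; first by near: t; exact: nbhs_right_gt.
by near: t; exact: nbhs_right_ltW.
Unshelve. all: by end_near. Qed.

(** At t = sin^2 phi, 2 cos phi times [q] is the conormal quotient of the zonal function. *)
Let q (t : R) := t `^ (1 - s) * dGz t.
Let T (t : R) := t `^ (1 - s - 1).
Let dq (t : R) := t `^ (1 - s) * ddGz t + dGz t * ((1 - s) * T t).

Let qE (t : R) : 0 < t < 2 -> is_derive t 1 q (dq t).
Proof.
move=> t02; have t0 : 0 < t by case/andP: t02.
exact: is_deriveM (is_derive1_powR (1 - s) t0) (is_derive_dGz t02).
Qed.

Let q_ode (t : R) : 0 < t < 2 ->
  (1 - t) * dq t = T t * (c * (t * dGz t) - kappa * Gz t).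
Proof.
move=> t02; have t0 : 0 < t by case/andP: t02.
have := Gz_ode t02; rewrite /dq (powR_split (1 - s) t0) -/(T t).
move: (T t) (Gz t) (dGz t) (ddGz t) => a g g1 g2 H.
have -> : kappa * g = - (t * (1 - t) * g2 + (1 - s - (c + 1 - s) * t) * g1) by lra.
by ring.
Qed.

Let q_gt0 t : 0 < t <= 1 -> 0 < q t.
Proof.
by move=> t01; rewrite mulr_gt0 ?dGz_gt0// powR_gt0//; case/andP: t01.
Qed.

(* The limit exists because E = (1 - t) t^(1-s) G' + nu t^(1-s) G is nondecreasing.  It is
   positive, since t^(1-s) G' > 0 would otherwise be decreasing near 0. *)
Lemma dGz_cvg : exists2 L : R, 0 < L &
  t `^ (1 - s) * dGz t @[t --> (0 : R)^'+] --> L.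
Proof.
have [l l0 Gl] := Gz_cvg; have [g0 g00 gP] := Gz_lower_bound.
have s1' : 0 < 1 - s by rewrite subr_gt0.
(* Chosen so that nu (1 - s) - kappa = 1 - s > 0; then both terms of E' are nonnegative. *)
pose nu := 1 + kappa / (1 - s).
pose E (t : R) := (1 - t) * q t + nu * (t `^ (1 - s) * Gz t).
pose dE (t : R) := ((1 - t) * dq t - q t) +
  nu * (t `^ (1 - s) * dGz t + Gz t * ((1 - s) * T t)).
have EE' (t : R) : 0 < t < 2 -> is_derive t 1 E (dE t).
  move=> t02; have t0 : 0 < t by case/andP: t02.
  have a1 := is_deriveM (d1m t) (qE t02).
  have a2 := is_deriveM (is_derive1_powR (1 - s) t0) (is_derive_Gz t02).
  have := is_deriveD a1 (is_deriveZ nu a2); move/is_derive_eq; apply.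
  by rewrite /dE /GRing.scale /= mulrN1.
have dE0 (t : R) : 0 < t < 1 -> 0 <= dE t.
  move=> t01; have t02 : 0 < t < 2 by lra.
  have t0 : 0 < t by lra.
  have t01' : 0 < t <= 1 by lra.
  have T0 : 0 < T t by exact: powR_gt0.
  have -> : dE t = T t * ((c - 1 + nu) * (t * dGz t) + (nu * (1 - s) - kappa) * Gz t).
    rewrite /dE (q_ode t02) /q (powR_split (1 - s) t0) -/(T t).
    by move: (T t) (Gz t) (dGz t) => a g g1; ring.
  have h1 : 0 <= kappa / (1 - s) by rewrite divr_ge0// ltW.
  have h2 : nu * (1 - s) - kappa = 1 - s.
    by rewrite /nu mulrDl mul1r divfK ?addrK// gt_eqF.
  rewrite h2; apply: mulr_ge0; first exact: ltW.
  apply: addr_ge0; apply: mulr_ge0.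
  - by rewrite /nu; have := c0; lra.
  - by rewrite mulr_ge0 ?ltW// dGz_gt0.
  - exact: ltW.
  - by rewrite ltW// Gz_gt0.
have Emono : {in `]0, 1[%R &, {homo E : u v / u <= v >-> u <= v}}.
  apply: ger0_derive1_le_oo => [t|t|t].
  - by rewrite in_itv/= => t01; have [] // := EE' t; lra.
  - rewrite in_itv/= => t01; have t02 : 0 < t < 2 by lra.
    by have H := EE' t t02; rewrite derive1E derive_val dE0.
  - rewrite inE/= in_itv/= => t01; have t02 : 0 < t < 2 by lra.
    have [Ed _] := EE' t t02.
    by apply: differentiable_continuous; apply/derivable1_diffP.
have /cvg_ex[/= L EL] : cvg (E t @[t --> (0 : R)^'+]).
  apply: nondecreasing_at_right_is_cvgr.
    near=> b; have b1 : b < 1 by near: b; exact: nbhs_right_lt.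
    move=> u v; rewrite !in_itv/= => /andP[u0 ub] /andP[v0 vb] uv.
    by apply: Emono => //; rewrite in_itv/=; lra.
  near=> b; have b1 : b < 1 by near: b; exact: nbhs_right_lt.
  exists 0 => _ [u + <-]; rewrite /= in_itv/= => /andP[u0 ub].
  have u01 : 0 < u <= 1 by lra.
  rewrite /E addr_ge0//.
    by rewrite mulr_ge0 ?subr_ge0 ?(ltW (q_gt0 u01))//; lra.
  rewrite mulr_ge0//; last by rewrite mulr_ge0 ?powR_ge0// ltW// Gz_gt0.
  by rewrite addr_ge0// divr_ge0// ltW.
have pG : t `^ (1 - s) * Gz t @[t --> (0 : R)^'+] --> (0 : R).
  by have h := cvgM tpow Gl; rewrite mul0r in h; exact: h.
have omt : 1 - t @[t --> (0 : R)^'+] --> (1 : R).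
  rewrite -[X in _ --> X](subr0 1); apply: cvg_at_right_filter.
  by apply: cvgB; [exact: cvg_cst|exact: cvg_id].
have qL : q t @[t --> (0 : R)^'+] --> L.
  have H : \forall t \near (0 : R)^'+,
      (E t - nu * (t `^ (1 - s) * Gz t)) * (1 - t)^-1 = q t.
    near=> t; have t1 : t < 1 by near: t; exact: nbhs_right_lt.
    by rewrite /E addrK mulrAC divff ?mul1r// subr_eq0 gt_eqF.
  have h : (E t - nu * (t `^ (1 - s) * Gz t)) * (1 - t)^-1 @[t --> (0 : R)^'+]
      --> (L - nu * 0) * 1^-1.
    apply: cvgM; last by apply: cvgV => //; exact: oner_neq0.
    by apply: cvgB => //; apply: cvgMl_tmp.
  rewrite mulr0 subr0 invr1 mulr1 in h.
  exact: cvg_trans (near_eq_cvg H) h.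
(* If L <= 0, then c q < kappa g0 near 0. Since t G' <= q there and G >= g0, [q_ode] gives q' < 0,
   so L is at least a value of q, which is positive. *)
exists L => //; rewrite ltNge; apply/negP => L0.
have hq : \forall t \near (0 : R)^'+, c * q t < kappa * g0.
  have h : c * q t @[t --> (0 : R)^'+] --> c * L by exact: cvgMl_tmp.
  suff cL : c * L < kappa * g0 by exact: cvgr_lt h _ cL.
  apply: (@le_lt_trans _ _ 0); last by rewrite mulr_gt0.
  by rewrite pmulr_rle0.
have : \forall t \near (0 : R)^'+, dq t < 0.
  near=> t; have t1 : t < 1 by near: t; exact: nbhs_right_lt.
  have t0 : 0 < t by near: t; exact: nbhs_right_gt.
  have t01 : 0 < t <= 1 by rewrite t0 ltW.
  have t02 : 0 < t < 2 by lra.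
  have omt0 : 0 < 1 - t by rewrite subr_gt0.
  rewrite -(pmulr_rlt0 _ omt0) (q_ode t02) pmulr_rlt0 ?powR_gt0//.
  have h1 : t * dGz t <= q t.
    rewrite /q (powR_split (1 - s) t0) -mulrA ler_wpM2l ?(ltW t0)//.
    rewrite ler_peMl ?(ltW (dGz_gt0 t01))//.
    have -> : 1 - s - 1 = - s by ring.
    by rewrite powRN invf_ge1 ?powR_gt0// powR_le1 ?(ltW s0)// !ltW.
  have h2 : c * q t < kappa * g0 by near: t.
  have h3 : kappa * g0 <= kappa * Gz t by rewrite ler_pM2l// gP.
  have h4 : c * (t * dGz t) <= c * q t by rewrite ler_pM2l.
  lra.
move=> /nbhs_ballP[d /= d0 dP].
pose b := Num.min d 1.
have b0 : 0 < b by rewrite lt_min d0 ltr01.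
have bd : b <= d by rewrite ge_min lexx.
have b1 : b <= 1 by rewrite ge_min lexx orbT.
have qdec : {in `]0, b[%R &, {homo q : u v /~ u <= v}}.
  apply: ler0_derive1_le_oo => [t|t|t].
  - by rewrite in_itv/= => t01; have [] // := @qE t; lra.
  - rewrite in_itv/= => /andP[t0 tb]; have t02 : 0 < t < 2 by lra.
    have H := qE t02; rewrite derive1E derive_val ltW//; apply: dP => //.
    by rewrite /= -ball_normE/= sub0r normrN gtr0_norm// (lt_le_trans tb).
  - rewrite inE/= in_itv/= => t01; have t02 : 0 < t < 2 by lra.
    have [qd _] := qE t02.
    by apply: differentiable_continuous; apply/derivable1_diffP.
have qb : 0 < q (b / 2) by apply: q_gt0; lra.
have b2 : 0 < b / 2 by lra.
have : q (b / 2) <= L.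
  apply: (cvgr_to_ge qL); near=> t.
  have t0 : 0 < t by near: t; exact: nbhs_right_gt.
  have tb : t < b / 2 by near: t; exact: nbhs_right_lt.
  by apply: qdec; rewrite ?in_itv/=; lra.
by lra.
Unshelve. all: by end_near. Qed.

End hypergeometric_boundary.

(** * The positive solution *)

Section existence.
Context {R : realType} {N : nat}.
Hypothesis N0 : (0 < N)%N.
Variables (s p : R).
Hypotheses (s01 : 0 < s < 1) (sN : 2 * s < N%:R) (p1 : 1 < p).
Local Notation cl := (closure (@half_sphere R N)).
Local Notation Lam := (@Lambda R N s p).
Hypotheses (Lam0 : 0 < Lam) (LamN : Lam < 2 * s * N%:R).
Let s0 : 0 < s. Proof. by case/andP: s01. Qed.
Let p10 : 0 < p - 1. Proof. by rewrite subr_gt0. Qed.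

Let c : R := N%:R / 2.
Let kappa : R := Lam / 4.
Let sc : s < c. Proof. by rewrite /c ltr_pdivlMr// mulrC. Qed.
Let kappa0 : 0 < kappa. Proof. exact: divr_gt0. Qed.
Let kappac : kappa < c * s. Proof.
rewrite /kappa /c ltr_pdivrMr//.
by have -> : N%:R / 2 * s * 4 = 2 * s * N%:R by field.
Qed.
Let cn : c <= N%:R.
Proof. by rewrite /c ler_pdivrMr// ler_peMr ?ler0n// ler1n. Qed.

Section scaling.
Variables (l L : R).
Hypotheses (l0 : 0 < l) (Gl : Gz c s kappa t @[t --> (0 : R)^'+] --> l).
Hypotheses (L0 : 0 < L)
  (GL : t `^ (1 - s) * dGz c s kappa t @[t --> (0 : R)^'+] --> L).

(* The scaling factor turns the conormal derivative [2 k L] into [(k l)^p]. *)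
Let k : R := (2 * L / l `^ p) `^ (p - 1)^-1.

Let k0 : 0 < k.
Proof. by rewrite powR_gt0// divr_gt0 ?powR_gt0// mulr_gt0. Qed.

Let kE : k * (2 * L) = (k * l) `^ (p - 1) * (k * l).
Proof.
have lp : 0 < l `^ p by exact: powR_gt0.
rewrite (powRM _ (ltW k0) (ltW l0)) {2}/k -powRrM mulVf ?gt_eqF// powRr1; last first.
  by rewrite divr_ge0 ?mulr_ge0 ?ltW.
have lpE : l `^ p = l * l `^ (p - 1) by exact: powR_split.
move: lp; rewrite lpE; move: (l `^ (p - 1)) k => m a lm.
have m0 : m != 0 by apply: contraTneq lm => ->; rewrite mulr0 ltxx.
by field; rewrite m0 gt_eqF.
Qed.

(** At t = 0 the series sits on its circle of convergence, so the boundary value is prescribed as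
    the right limit. *)
Let G (t : R) : R := if t <= 0 then k * l else k * Gz c s kappa t.
Let dG (t : R) : R := k * dGz c s kappa t.
Let ddG (t : R) : R := k * ddGz c s kappa t.

Let t02 (t : R) : 0 < t <= 1 -> 0 < t < 2. Proof. by lra. Qed.

Let GE (t : R) : 0 < t <= 1 -> is_derive t 1 G (dG t).
Proof.
move=> t01; have H := is_deriveZ k (is_derive_Gz s01 sc kappa0 kappac (t02 t01)).
apply: near_eq_is_derive H.
near=> u; rewrite /G leNgt ifF//; apply/negbF.
by near: u; apply: lt_nbhsr; case/andP: t01.
Unshelve. all: by end_near. Qed.

Let dGE (t : R) : 0 < t <= 1 -> is_derive t 1 dG (ddG t).
Proof.
move=> t01; have H := is_deriveZ k (is_derive_dGz s01 sc kappa0 kappac (t02 t01)).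
exact: H.
Qed.

Let ddGc (t : R) : 0 < t <= 1 -> {for t, continuous ddG}.
Proof.
move=> t01; have h := ddGz_continuous s01 sc kappa0 kappac (t02 t01).
by apply: cvgMl_tmp; exact: h.
Qed.

Let G0 : G 0 = k * l. Proof. by rewrite /G lexx. Qed.

Let Gcvg0 : G t @[t --> (0 : R)^'+] --> G 0.
Proof.
have h : k * Gz c s kappa t @[t --> (0 : R)^'+] --> k * l by exact: cvgMl_tmp.
rewrite G0; apply: cvg_trans (near_eq_cvg _) h; near=> t.
by rewrite /G leNgt ifF//; apply/negbF; near: t; exact: nbhs_right_gt.
Unshelve. all: by end_near. Qed.

Definition zonal_solution : 'rV[R]_(N + 1) -> R := G \o @zeta R N.

Lemma zonal_solution_gt0 x : cl x -> 0 < zonal_solution x.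
Proof.
move=> /(closure_half_sphereP N0)[x1 z0]; rewrite /zonal_solution /= /G.
case: ifP => [_|/negbT]; first exact: mulr_gt0.
rewrite -ltNge => zx; rewrite mulr_gt0// (Gz_gt0 s01 sc kappa0 kappac)// zx.
by rewrite /zeta x1 divr1 -x1 coord_sqr_le.
Qed.

Let ode (t : R) : 0 < t <= 1 -> 4 * t * (1 - t) * ddG t +
  (4 - 4 * s - (2 * N%:R + 4 - 4 * s) * t) * dG t + Lam * (k * Gz c s kappa t) = 0.
Proof.
move=> /t02 t01; have := Gz_ode s01 sc kappa0 kappac t01; rewrite /ddG /dG.
move: (Gz c s kappa t) (dGz c s kappa t) (ddGz c s kappa t) => g g1 g2.
have -> : Lam = 4 * kappa by rewrite /kappa mulrC divfK.
have -> : N%:R = 2 * c by rewrite /c mulrC divfK.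
move=> E; rewrite -[RHS](mulr0 (4 * k)) -E; ring.
Qed.

Lemma zonal_solution_eigen : eigen s Lam zonal_solution.
Proof.
apply: (eigen_coord N0) => [|sigma phi sg pb]; first exact: (C2_zonal GE dGE ddGc).
rewrite /zonal_solution (As_zonal N0 GE dGE s sg pb) /= zeta_hs//.
have st : 0 < sin phi by exact: sin_gt0_pihalf.
have z0 : 0 < sin phi ^+ 2 by rewrite exprn_gt0.
have z1 : sin phi ^+ 2 <= 1 by rewrite expr_le1// ?sin_le1// ltW.
by rewrite -[RHS](ode (t := sin phi ^+ 2)) ?z0// /G leNgt z0.
Qed.

(** The quotient equals 2 k cos t F(sin^2 t) with F(z) = z^(1 - s) G'(z), and sin^2 t tends to 0
    from the right. *)
Lemma zonal_solution_conormal sigma : sqn sigma = 1 ->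
  conormal_quot s zonal_solution sigma t @[t --> (0 : R)^'+] --> k * (2 * L).
Proof.
move=> s1.
have pi20 : 0 < pi / 2 :> R by rewrite divr_gt0// pi_gt0.
pose F (z : R) := z `^ (1 - s) * dGz c s kappa z.
have sin2 : sin t ^+ 2 @[t --> (0 : R)^'+] --> (0 : R)^'+.
  have c2 : sin t ^+ 2 @[t --> (0 : R)^'+] --> (0 : R).
    have h : sin t @[t --> (0 : R)^'+] --> (0 : R).
      by rewrite -[X in _ --> X]sin0; apply: cvg_at_right_filter; exact: continuous_sin.
    by have h2 := cvgM h h; rewrite mulr0 in h2; exact: h2.
  move=> A /c2 nA.
  have pos : \forall t \near (0 : R)^'+, 0 < sin t ^+ 2.
    near=> t; rewrite exprn_gt0// sin_gt0_pihalf//.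
    by apply/andP; split; near: t; [exact: nbhs_right_gt|exact: nbhs_right_lt].
  by apply: filterS2 nA pos => t; apply.
have FL : F (sin t ^+ 2) @[t --> (0 : R)^'+] --> L by exact: (cvg_comp _ _ sin2 GL).
have H : \forall t \near (0 : R)^'+,
    2 * k * cos t * F (sin t ^+ 2) = conormal_quot s zonal_solution sigma t.
  near=> t; have tb : 0 < t < pi / 2.
    by apply/andP; split; near: t; [exact: nbhs_right_gt|exact: nbhs_right_lt].
  have st : 0 < sin t by exact: sin_gt0_pihalf.
  rewrite /conormal_quot /zonal_solution (d_phi_zonal GE s1 tb) /F /dG.
  have -> : (sin t ^+ 2) `^ (1 - s) = sin t `^ (1 - 2 * s) * sin t.
    rewrite -powR_mulrn ?ltW// -powRrM -{3}[sin t](powRr1 (ltW st)).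
    rewrite -powRD ?(gt_eqF st) ?implybT//.
    by rewrite (_ : 1 - 2 * s + 1 = 2 * (1 - s))//; ring.
  by move: (dGz _ _ _ _) => a; ring.
have C : 2 * k * cos t @[t --> (0 : R)^'+] --> 2 * k * cos (0 : R).
  by apply: cvgMl_tmp; apply: cvg_at_right_filter; exact: continuous_cos.
rewrite cos0 mulr1 in C.
have h : 2 * k * cos t * F (sin t ^+ 2) @[t --> (0 : R)^'+] --> 2 * k * L by exact: cvgM.
rewrite (_ : k * (2 * L) = 2 * k * L); last by ring.
exact: cvg_trans (near_eq_cvg H) h.
Unshelve. all: by end_near. Qed.

Lemma zonal_solution_EE : EE s p 1 zonal_solution.
Proof.
apply/(EE_iff N0); split; first exact: (zonal_continuous N0 GE Gcvg0).
  exact: zonal_solution_eigen.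
move=> sigma s1; have [hc cE] := conormal_cvgP (zonal_solution_conormal s1).
split=> //; rewrite cE mul1r /zonal_solution /= zeta_hs// sin0 expr0n/= G0.
have kl : 0 < k * l by exact: mulr_gt0.
by rewrite gtr0_norm// kE addNr.
Qed.

End scaling.

Lemma EE_positive_ex : exists2 w : 'rV[R]_(N + 1) -> R,
  EE s p 1 w & forall x, cl x -> 0 < w x.
Proof.
have [l l0 Gl] := Gz_cvg s01 sc kappa0 kappac cn.
have [L L0 GL] := dGz_cvg s01 sc kappa0 kappac cn.
exists (zonal_solution l L); first exact: zonal_solution_EE.
by move=> x; exact: zonal_solution_gt0.
Qed.

End existence.

(** * The ranges of p in terms of Lambda *)

Section Lambda_sign.
Context {R : realType} (N : nat) (s p : R).
Hypotheses (s01 : 0 < s < 1) (sN : 2 * s < N%:R) (p1 : 1 < p).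
Local Notation Lam := (@Lambda R N s p).
Let s0 : 0 < s. Proof. by case/andP: s01. Qed.
Let p10 : 0 < p - 1. Proof. by rewrite subr_gt0. Qed.
Let Ns : 0 < N%:R - 2 * s. Proof. by rewrite subr_gt0. Qed.
Let b0 : 0 < 2 * s / (p - 1). Proof. by rewrite divr_gt0// mulr_gt0. Qed.
Let N0 : 0 < N%:R :> R. Proof. by apply: lt_trans sN; exact: mulr_gt0. Qed.

Lemma Lambda_le0 : (Lam <= 0) = (N%:R / (N%:R - 2 * s) <= p).
Proof.
rewrite /Lambda pmulr_rle0// subr_le0 -lerBrDr ler_pdivrMr// ler_pdivrMr//.
by apply/idP/idP => h; lra.
Qed.

(** With b = 2s / (p - 1), Lambda - 2sN factors as (b + 2s)(b - N). *)
Lemma Lambda_ge : (2 * s * N%:R <= Lam) = (p <= 1 + 2 * s / N%:R).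
Proof.
have -> : (p <= 1 + 2 * s / N%:R) = (N%:R <= 2 * s / (p - 1)).
  by rewrite ler_pdivlMr// -lerBlDl ler_pdivlMr// mulrC.
rewrite /Lambda -subr_ge0; set b := 2 * s / (p - 1).
have -> : b * (b + 2 * s - N%:R) - 2 * s * N%:R = (b + 2 * s) * (b - N%:R) by ring.
by rewrite pmulr_rge0 ?subr_ge0// addr_gt0// mulr_gt0.
Qed.

End Lambda_sign.

Theorem theoremA (R : realType) (N : nat) (s p : R) :
  (0 < N)%N -> 0 < s < 1 -> 2 * s < N%:R -> 1 < p ->
  [/\ N%:R / (N%:R - 2 * s) <= p ->
        forall w : 'rV[R]_(N + 1) -> R,
          EE s p 1 w <-> {in closure half_sphere, w =1 cst 0},
      p <= 1 + 2 * s / N%:R ->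
        forall w : 'rV[R]_(N + 1) -> R,
          EEplus s p 1 w <-> {in closure half_sphere, w =1 cst 0}
    & 1 + 2 * s / N%:R < p < N%:R / (N%:R - 2 * s) ->
        exists w1 : 'rV[R]_(N + 1) -> R,
          [/\ EE s p 1 w1,
              forall x, closure half_sphere x -> 0 < w1 x
            & forall w : 'rV[R]_(N + 1) -> R,
                EEplus s p 1 w <->
                  {in closure half_sphere, w =1 cst 0} \/
                  {in closure half_sphere, w =1 w1}]].
Proof.
move=> N0 s01 sN p1.
have zeroE (w : 'rV[R]_(N + 1) -> R) : {in closure half_sphere, w =1 cst 0} ->
    EEplus s p 1 w.
  move=> w0; split; first by apply: EE_zero => //; rewrite gt_eqF.
  by move=> x cx; rewrite w0//; exact/mem_set.
split=> [|| /andP[]].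
- rewrite -Lambda_le0// => Lam0 w; split=> [|/zeroE[]//].
  exact: EE_trivial.
- rewrite -Lambda_ge// => LamN w; split=> [|/zeroE//].
  exact: EEplus_trivial.
rewrite ltNge -Lambda_ge// -ltNge => LamN; rewrite ltNge -Lambda_le0// -ltNge => Lam0.
have [w1 w1E w1_gt0] := EE_positive_ex N0 s01 sN p1 Lam0 LamN.
exists w1; split=> // w; split=> [wE|[/zeroE//|ww1]].
  exact: EEplus_unique (ltW Lam0) w1E w1_gt0 wE.
split=> [|x cx]; last by rewrite ww1 ?ltW ?w1_gt0//; exact/mem_set.
by apply: (EE_ext N0) w1E => x cx; rewrite ww1.
Qed.
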